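(* Let $c>0$, let $A,B\subset\mathbb R$ be measurable with finite measure, and let $$A=\mathop{\dot\bigcup}_{i=1}^{M}A_i,\qquad B=\mathop{\dot\bigcup}_{j=1}^{K}B_j$$ be arbitrary finite measurable partitions, with null pieces discarded. Fix $0<\epsilon<1/2$ and set $t=\sqrt{\epsilon(1-\epsilon)}$. For any local thresholds $0<\epsilon_{ij}<1/2$ satisfying $$\sum_{i=1}^{M}\sum_{j=1}^{K}\sqrt{\epsilon_{ij}(1-\epsilon_{ij})}\le t,$$ one has $$\Lambda_\epsilon(A,cB)\le\sum_{i=1}^{M}\sum_{j=1}^{K}\Lambda_{\epsilon_{ij}}(A_i,cB_j).$$
   Context: $P_E$ is multiplication by the indicator of $E$ on $L^2(\mathbb R)$; $(\mathcal Ff)(\xi)=\int_{\mathbb R}e^{-2\pi i x\xi}f(x)\,dx$; $Q_E=\mathcal F^{-1}P_E\mathcal F$. For finite-measure $A,B$ and $c>0$, $\Lambda_\epsilon(A,cB):=\operatorname{rank}\mathbf 1_{(\epsilon,1-\epsilon)}(P_AQ_{cB}P_A)$. If either global window is null, the count is zero. *)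

(* Defs.v *)
From HB Require Import structures.
From mathcomp Require Import all_boot all_order all_algebra.
From mathcomp Require Import all_classical all_reals all_analysis.
From mathcomp Require Import complex.
From mathcomp Require Import generic_quotient ring_quotient.

Set Implicit Arguments.
Unset Strict Implicit.
Unset Printing Implicit Defensive.

Import Order.TTheory GRing.Theory Num.Theory.
Import numFieldNormedType.Exports.

Local Open Scope classical_set_scope.
Local Open Scope ring_scope.
Local Open Scope complex_scope.

(* The domain of completed_lebesgue_measure. *)
Definition lebesgue_measurable (R : realType) (E : set R) : Prop :=
  ((wlength (@idfun R))^*)%mu.-cara.-measurable E.

Section SquareIntegrable.
Variable R : realType.
Local Notation C := R[i].
Local Notation mu := (@lebesgue_measure R).

Definition sqint : {pred (R -> C)} :=
  [pred f : R -> C | ((fun x => complex.Re (f x)) \in Lfun mu 2%:E) &&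
                     ((fun x => complex.Im (f x)) \in Lfun mu 2%:E)].

Lemma sqint_submod_closed : submod_closed sqint.
Proof.
have [L0 LP] := @Lfun_submod_closed _ _ R mu 2%:E (lee1n 2).
have Z (a : R) f : f \in Lfun mu 2%:E -> (fun x => a * f x) \in Lfun mu 2%:E.
  by move=> fL; have := LP a _ _ fL L0; rewrite addr0.
have D f g : f \in Lfun mu 2%:E -> g \in Lfun mu 2%:E ->
    (fun x => f x + g x) \in Lfun mu 2%:E.
  by move=> fL gL; have := LP 1 _ _ fL gL; rewrite scale1r.
split=> [|a f g /andP[fr fi] /andP[gr gi]].
  by apply/andP; split; exact: L0.
apply/andP; split.
  suff -> : (fun x => complex.Re ((a *: f + g) x)) =
      (fun x => (complex.Re a * complex.Re (f x) +
        - complex.Im a * complex.Im (f x)) + complex.Re (g x)).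
    by apply: (D) => //; apply: (D); exact: Z.
  apply/funext => x; rewrite !fctE /GRing.scale /=.
  by case: a (f x) (g x) => [? ?] [? ?] [? ?] /=; rewrite mulNr.
suff -> : (fun x => complex.Im ((a *: f + g) x)) =
    (fun x => (complex.Re a * complex.Im (f x) +
      complex.Im a * complex.Re (f x)) + complex.Im (g x)).
  by apply: (D) => //; apply: (D); exact: Z.
apply/funext => x; rewrite !fctE /GRing.scale /=.
by case: a (f x) (g x) => [? ?] [? ?] [? ?] /=.
Qed.

HB.instance Definition _ :=
  GRing.isSubmodClosed.Build _ _ sqint sqint_submod_closed.

Record sqfun := SqFun { sqfun_fun :> R -> C; _ : sqfun_fun \in sqint }.
HB.instance Definition _ := [isSub for sqfun_fun].
HB.instance Definition _ := [Choice of sqfun by <:].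
HB.instance Definition _ := [SubChoice_isSubLmodule of sqfun by <:].

Definition ae_zero : {pred sqfun} :=
  [pred f : sqfun | `[< {ae mu, forall x, f x = 0} >]].

Lemma ae_zero_zmod_closed : zmod_closed ae_zero.
Proof.
split=> [|f g /asboolP f0 /asboolP g0]; apply/asboolP.
  exact: aeW.
apply: (@filterS2 _ _ (ae_filter_ringOfSetsType mu) _ _ _ _ f0 g0).
by move=> x /= fx gx; rewrite !fctE fx gx subrr.
Qed.

Lemma ae_zeroZ (a : C) f : f \in ae_zero -> a *: f \in ae_zero.
Proof.
move=> /asboolP f0; apply/asboolP.
apply: (@filterS _ _ (ae_filter_ringOfSetsType mu) _ _ _ f0).
by move=> x /= fx; rewrite !fctE fx scaler0.
Qed.

HB.instance Definition _ :=
  GRing.isZmodClosed.Build _ ae_zero ae_zero_zmod_closed.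

(* L^2(R; C): square-integrable functions modulo equality a.e. *)
Definition L2 : Type := Quotient.quot ae_zero.
HB.instance Definition _ := Choice.on L2.
HB.instance Definition _ := GRing.Zmodule.on L2.
HB.instance Definition _ := ZmodQuotient.on L2.


Local Open Scope quotient_scope.

Definition L2_scale (a : C) (u : L2) : L2 := \pi_L2 (a *: repr u).

Lemma pi_L2_scale a (f : sqfun) : \pi_L2 (a *: f) = L2_scale a (\pi_L2 f).
Proof.
apply/eqP; rewrite -Quotient.idealrBE -scalerBr; apply: ae_zeroZ.
by rewrite Quotient.idealrBE reprK.
Qed.

Lemma pi_L2_add (f g : sqfun) : \pi_L2 (f + g) = \pi_L2 f + \pi_L2 g :> L2.
Proof. by rewrite !piE. Qed.

Fact L2_scaleA a b u : L2_scale a (L2_scale b u) = L2_scale (a * b) u.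
Proof. by rewrite {2}/L2_scale -pi_L2_scale scalerA. Qed.

Fact L2_scale1 : left_id 1 L2_scale.
Proof. by move=> u; rewrite /L2_scale scale1r reprK. Qed.

Fact L2_scaleDr : right_distributive L2_scale +%R.
Proof.
move=> a u v; rewrite -{1}[u]reprK -{1}[v]reprK -pi_L2_add -pi_L2_scale.
by rewrite scalerDr pi_L2_add.
Qed.

Fact L2_scaleDl u : {morph L2_scale^~ u : a b / a + b}.
Proof.
by move=> a b; rewrite /L2_scale scalerDl pi_L2_add.
Qed.

HB.instance Definition _ := GRing.Zmodule_isLmodule.Build C L2
  L2_scaleA L2_scale1 L2_scaleDr L2_scaleDl.

Definition L2_fun (u : L2) : R -> C := repr u.

(* The class of f, for f a.e. equal to some (Borel) square-integrable function,
   and 0 otherwise. "A.e." matters: elements of sqint are Borel-measurable,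
   but f is only Lebesgue-measurable if it is cut off by a Lebesgue set. *)
Definition toL2 (f : R -> C) : L2 :=
  xget 0 [set v : L2 | {ae mu, forall x, L2_fun v x = f x}].

Definition cintegral (D : set R) (f : R -> C) : C :=
  Rintegral mu D (fun x => complex.Re (f x)) +i*
  Rintegral mu D (fun x => complex.Im (f x)).

Definition dotL2 (u v : L2) : C :=
  cintegral setT (fun x => L2_fun u x * (L2_fun v x)^*).

End SquareIntegrable.

Section Fourier.
Variable R : realType.
Local Notation C := R[i].
Local Notation mu := (@lebesgue_measure R).
Local Notation L2 := (L2 R).

(* e^(i t) *)
Definition cis (t : R) : C := cos t +i* sin t.

Definition fourier_integral (D : set R) (f : R -> C) (xi : R) : C :=
  cintegral D (fun x => cis (- (2 * trigo.pi * x * xi)) * f x).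

(* The integral need not converge for u in L^2, so F on L^2 is the usual
   extension by continuity: F u is the limit in L^2-norm of the Fourier
   integrals of the (integrable) truncations of u to [-n, n]. By Plancherel's
   theorem it exists for all u and defines a unitary map, so that the
   defaults of xget below are never used. *)
Definition is_fourier (u v : L2) : Prop :=
  (fun n : nat => \int[mu]_xi
     (ComplexField.Normc.normc
        (fourier_integral `[- n%:R, n%:R]%classic (L2_fun u) xi
         - L2_fun v xi) ^+ 2)%:E)%E @ \oo --> 0%E.

Definition fourier (u : L2) : L2 := xget 0 (is_fourier u).

Definition inv_fourier (v : L2) : L2 := xget 0 [set u | fourier u = v].

Definition time_proj (E : set R) (u : L2) : L2 :=
  toL2 (fun x => (\1_E x)%:C * L2_fun u x).

Definition freq_proj (E : set R) (u : L2) : L2 :=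
  inv_fourier (time_proj E (fourier u)).

End Fourier.

Section Spectral.
Variables (R : realType) (V : lmodType R[i]) (dot : V -> V -> R[i]).

Definition orth_projection (P : V -> V) : Prop :=
  [/\ linear P, forall u, P (P u) = P u &
      forall u v, dot (P u) v = dot u (P v)].

(* E is a projection-valued Borel measure on the real line and T is the
   integral of x dE(x), in the weak sense: for every u, the map
   S |-> <E(S) u, u> is a measure nu, and <T u, u> is the integral of
   x dnu(x). *)
Definition is_spectral_measure (T : V -> V) (E : set R -> V -> V) : Prop :=
  [/\ forall S, measurable S -> orth_projection (E S),
      forall u, E setT u = u &
      forall u, exists nu : {measure set (measurableTypeR R) -> \bar R},
        [/\ forall S, measurable S ->
              nu S \is a fin_num /\ dot (E S u) u = (fine (nu S))%:C,
            nu.-integrable setT (fun x : R => x%:E) &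
            dot (T u) u = (Rintegral nu setT (fun x : R => x))%:C]].

(* The spectral projection 1_S(T), for T bounded and self-adjoint: such a T
   has a spectral measure, unique on Borel sets. *)
Definition spectral_proj (T : V -> V) (S : set R) : V -> V :=
  xget (fun _ _ => 0) (is_spectral_measure T) S.

(* The dimension of the range of a linear map, +oo if it is infinite. *)
Definition rank (T : V -> V) : \bar R :=
  ereal_sup [set n%:R%:E | n in [set n : nat |
    exists s : 'I_n -> V, forall a : 'I_n -> R[i],
      \sum_(i < n) a i *: T (s i) = 0 -> forall i, a i = 0]].

End Spectral.

Definition Lambda (R : realType) (eps : R) (A B : set R) : \bar R :=
  rank (spectral_proj (@dotL2 R)
    (fun u : L2 R => time_proj A (freq_proj B (time_proj A u)))
    `]eps, 1 - eps[%classic).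

(* Main.v *)
(** For T = P_A Q_B P_A the defect <T u, u> - |T u|^2 equals
    |(1 - P_A) Q_B P_A u|^2, so its square root is subadditive over partitions of
    A and B. On the range of the spectral projection of T on (e, 1 - e) the
    defect exceeds e (1 - e) |u|^2, and on its kernel it is at most that. Under
    the assumption on the thresholds, no nonzero vector of the global range is
    thus killed by all local spectral projections, and one counts dimensions.

    The spectral measure of T comes from an orthonormal system of eigenvectors,
    which exists since the trace of T is finite: the Fourier transform of P_A e_k
    at xi is the inner product of e_k with 1_A exp(2 i pi x xi), so Bessel's
    inequality bounds the sum of the |Q_B P_A e_k|^2 by a multiple of |A| |B|.

    The Fourier transform is constructed from the indicators of intervals: as the
    integral of (1 - cos (2 pi s x)) / x^2 is proportional to |s|, it preserves
    inner products up to a positive constant, whose value is never needed.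
    Fubini's theorem on indicators gives the symmetry of the bilinear form
    (f, g) |-> \int (F f) g, whence F conj F is a multiple of conj and F is onto. *)

(* The objects of the statement are chosen by [xget] with default 0, so most of the analysis goes
   into existence: without a spectral measure a local count would silently be 0, and without a
   preimage under the Fourier transform a frequency projection would be 0. Estimates are proved for
   an arbitrary spectral measure, hence hold for the one that [spectral_proj] picks. The notion of
   spectral measure is weak: it gives the quadratic forms of the E(S) and the first moment of T.
   That T preserves the ranges of the E(S) is derived, and both bounds on the defect are arranged to
   use first moments. They rest on x - x^2 > e (1 - e) being equivalent to e < x < 1 - e, which is
   why thresholds enter through the square root of e (1 - e). An undetermined positive factor in the
   Plancherel identity is harmless, as scaling F does not change F^-1 P_E F. Windows are Lebesgue
   sets while elements of L^2 have Borel representatives, so each window is traded for a Borel set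
   with a.e. the same indicator. *)
Require Import Defs.
From mathcomp Require Import all_boot all_order all_algebra.
From mathcomp Require Import all_classical all_reals all_analysis.
From mathcomp Require Import measurable_realfun complex.
From mathcomp Require Import generic_quotient ring_quotient.
From mathcomp Require Import ring lra.

Set Implicit Arguments.
Unset Strict Implicit.
Unset Printing Implicit Defensive.

Import Order.TTheory GRing.Theory Num.Theory.
Import numFieldNormedType.Exports.

Local Open Scope classical_set_scope.
Local Open Scope ring_scope.
Local Open Scope complex_scope.

(** * Inner products and spectral measures *)

Section SquaredModulus.
Variable R : realType.
Implicit Types (x : R) (z w : R[i]).

(** Squared modulus with values in [R], so that it can be integrated and compared without a square
    root. *)
Definition sqn z : R := complex.Re z ^+ 2 + complex.Im z ^+ 2.

Lemma sqn_ge0 z : 0 <= sqn z.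
Proof. by rewrite addr_ge0// sqr_ge0. Qed.

Lemma sqn_eq0 z : sqn z = 0 -> z = 0.
Proof.
case: z => a b; rewrite /sqn/= => /eqP.
rewrite paddr_eq0 ?sqr_ge0// !sqrf_eq0 => /andP[/eqP-> /eqP->].
by [].
Qed.

Lemma sqn_real x : sqn x%:C = x ^+ 2.
Proof. by rewrite /sqn/= expr0n addr0. Qed.

Lemma sqnM z w : sqn (z * w) = sqn z * sqn w.
Proof. case: z w => [a b] [c d]; rewrite /sqn/=; ring. Qed.

Lemma sqn0 : sqn 0 = 0. Proof. by rewrite /sqn/= expr0n addr0. Qed.

Lemma sqnN z : sqn (- z) = sqn z.
Proof. by case: z => a b; rewrite /sqn/= !sqrrN. Qed.

Lemma sqnJ z : sqn (conjc z) = sqn z.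
Proof. by case: z => a b; rewrite /sqn/= sqrrN. Qed.

Lemma mulcJ z : z * conjc z = (sqn z)%:C.
Proof.
by case: z => a b; rewrite /sqn; simpc => /=; congr (_ +i* _)%C; ring.
Qed.

Lemma normc_sqn z : ComplexField.Normc.normc z ^+ 2 = sqn z.
Proof.
by case: z => a b; rewrite /sqn/= sqr_sqrtr// addr_ge0// sqr_ge0.
Qed.

Lemma sqnD_le z w : sqn (z + w) <= 2 * sqn z + 2 * sqn w.
Proof.
case: z w => [a b] [c d]; rewrite /sqn/=.
have := sqr_ge0 (a - c); have := sqr_ge0 (b - d); nra.
Qed.

Lemma RemulrC x z : complex.Re (x%:C * z) = x * complex.Re z.
Proof. by case: z => a b /=; rewrite mul0r subr0. Qed.

Lemma ImmulrC x z : complex.Im (x%:C * z) = x * complex.Im z.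
Proof. by case: z => a b /=; rewrite mul0r addr0. Qed.

Lemma complexP z w : complex.Re z = complex.Re w ->
  complex.Im z = complex.Im w -> z = w.
Proof. by case: z w => [a b] [c d] /= -> ->. Qed.

Lemma conjc_realM x z : conjc (x%:C * z) = x%:C * conjc z.
Proof. by case: z => a b; apply: complexP => /=; ring. Qed.

End SquaredModulus.

Section InnerProduct.
Variables (R : realType) (V : lmodType R[i]) (dot : V -> V -> R[i]).

Record inner_product : Prop := InnerProduct {
  dotPl : forall a u v w, dot (a *: u + v) w = a * dot u w + dot v w;
  dotC : forall u v, dot v u = conjc (dot u v);
  dot_ge0 : forall u, 0 <= dot u u;
  dot_eq0 : forall u, dot u u = 0 -> u = 0 }.

Definition N u := complex.Re (dot u u).
Definition nrm u := Num.sqrt (N u).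

Hypothesis ip : inner_product.

Lemma dotDl u v w : dot (u + v) w = dot u w + dot v w.
Proof. by have := dotPl ip 1 u v w; rewrite scale1r mul1r. Qed.

Lemma dot0l w : dot 0 w = 0.
Proof. by have /eqP := dotDl 0 0 w; rewrite addr0 addrC -subr_eq subrr => /eqP. Qed.

Lemma dotZl a u w : dot (a *: u) w = a * dot u w.
Proof. by have := dotPl ip a u 0 w; rewrite addr0 dot0l addr0. Qed.

Lemma dotNl u w : dot (- u) w = - dot u w.
Proof. by rewrite -scaleN1r dotZl mulN1r. Qed.

Lemma dotBl u v w : dot (u - v) w = dot u w - dot v w.
Proof. by rewrite dotDl dotNl. Qed.

Lemma dotDr u v w : dot w (u + v) = dot w u + dot w v.
Proof. by rewrite (dotC ip) dotDl rmorphD/= -!(dotC ip). Qed.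

Lemma dot0r w : dot w 0 = 0.
Proof. by rewrite (dotC ip) dot0l rmorph0. Qed.

Lemma dotZr a u w : dot w (a *: u) = conjc a * dot w u.
Proof. by rewrite (dotC ip) dotZl rmorphM/= -(dotC ip). Qed.

Lemma dotNr u w : dot w (- u) = - dot w u.
Proof. by rewrite (dotC ip) dotNl rmorphN/= -(dotC ip). Qed.

Lemma dotBr u v w : dot w (u - v) = dot w u - dot w v.
Proof. by rewrite dotDr dotNr. Qed.

Lemma dot_suml I (r : seq I) (P : pred I) (F : I -> V) w :
  dot (\sum_(i <- r | P i) F i) w = \sum_(i <- r | P i) dot (F i) w.
Proof.
by elim/big_rec2: _ => [|i x y _ <-]; rewrite ?dot0l// dotDl.
Qed.

Lemma dot_sumr I (r : seq I) (P : pred I) (F : I -> V) w :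
  dot w (\sum_(i <- r | P i) F i) = \sum_(i <- r | P i) dot w (F i).
Proof.
by elim/big_rec2: _ => [|i x y _ <-]; rewrite ?dot0r// dotDr.
Qed.

Lemma dotE u : dot u u = (N u)%:C.
Proof.
by move: (dot_ge0 ip u); rewrite /N; case: (dot u u) => a b;
  rewrite lecE/= => /andP[/eqP-> _].
Qed.

Lemma N_ge0 u : 0 <= N u.
Proof. by have := dot_ge0 ip u; rewrite dotE lecR. Qed.

Lemma N_eq0 u : N u = 0 -> u = 0.
Proof. by move=> h; apply: (dot_eq0 ip); rewrite dotE h. Qed.

Lemma N_gt0 u : u <> 0 -> 0 < N u.
Proof.
move=> u0; rewrite lt_neqAle N_ge0 andbT eq_sym; apply/eqP => /N_eq0.
by [].
Qed.

Lemma N0 : N 0 = 0. Proof. by rewrite /N dot0l. Qed.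

Lemma NZ a u : N (a *: u) = sqn a * N u.
Proof. by rewrite /N dotZl dotZr mulrA mulcJ dotE/= mul0r subr0. Qed.

Lemma NN u : N (- u) = N u.
Proof. by rewrite /N dotNl dotNr opprK. Qed.

Lemma NBC u v : N (u - v) = N (v - u).
Proof. by rewrite -NN opprB. Qed.

Lemma Re_dotC u v : complex.Re (dot v u) = complex.Re (dot u v).
Proof. by rewrite (dotC ip); case: (dot u v). Qed.

Lemma ND u v : N (u + v) = N u + N v + 2 * complex.Re (dot u v).
Proof.
by rewrite /N dotDl !dotDr !raddfD/= (Re_dotC u v); ring.
Qed.

Lemma NB u v : N (u - v) = N u + N v - 2 * complex.Re (dot u v).
Proof. by rewrite ND NN dotNr raddfN/= mulrN. Qed.

Lemma ND_orth u v : dot u v = 0 -> N (u + v) = N u + N v.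
Proof. by move=> h; rewrite ND h/= mulr0 addr0. Qed.

Lemma ND_le u v : N (u + v) <= 2 * N u + 2 * N v.
Proof. have := N_ge0 (u - v); rewrite NB ND; lra. Qed.

Lemma NB_le u v : N (u - v) <= 2 * N u + 2 * N v.
Proof. by have := ND_le u (- v); rewrite NN. Qed.

Lemma dot_sqn_le u v : sqn (dot u v) <= N u * N v.
Proof.
have [v0|v0] := eqVneq (N v) 0.
  by rewrite (N_eq0 v0) dot0r N0 mulr0 sqn0.
have vgt0 : 0 < N v by rewrite lt_neqAle eq_sym v0 N_ge0.
have := N_ge0 ((N v)%:C *: u - dot u v *: v).
rewrite NB !NZ sqn_real dotZl dotZr.
rewrite [conjc _ * _]mulrC mulcJ RemulrC/= => h.
have : 0 <= N v * (N u * N v - sqn (dot u v)) by lra.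
by rewrite pmulr_rge0// subr_ge0.
Qed.

Lemma Re_dot_le u v : complex.Re (dot u v) <= nrm u * nrm v.
Proof.
rewrite /nrm -sqrtrM ?N_ge0//; apply: le_trans (ler_norm _) _.
rewrite -sqrtr_sqr; apply: ler_wsqrtr; apply: le_trans (dot_sqn_le u v).
by rewrite /sqn lerDl sqr_ge0.
Qed.

Lemma nrm_ge0 u : 0 <= nrm u. Proof. exact: sqrtr_ge0. Qed.

Lemma nrm_sqr u : nrm u ^+ 2 = N u. Proof. by rewrite sqr_sqrtr// N_ge0. Qed.

Lemma nrmD u v : nrm (u + v) <= nrm u + nrm v.
Proof.
rewrite -(@ler_pXn2r _ 2)// ?nnegrE ?addr_ge0 ?nrm_ge0//.
rewrite sqrrD !nrm_sqr ND.
by have := Re_dot_le u v; lra.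
Qed.

Lemma nrmN u : nrm (- u) = nrm u. Proof. by rewrite /nrm NN. Qed.

Lemma nrm_sum I (r : seq I) (P : pred I) (F : I -> V) :
  nrm (\sum_(i <- r | P i) F i) <= \sum_(i <- r | P i) nrm (F i).
Proof.
elim/big_rec2: _ => [|i x y _ h]; first by rewrite /nrm N0 sqrtr0.
by apply: le_trans (nrmD _ _) _; rewrite lerD2l.
Qed.

Lemma dot_inj u v : (forall w, dot u w = dot v w) -> u = v.
Proof.
move=> h; apply/eqP; rewrite -subr_eq0; apply/eqP; apply: N_eq0.
by rewrite /N dotBl h subrr.
Qed.

End InnerProduct.

Section OrthogonalProjection.
Variables (R : realType) (V : lmodType R[i]) (dot : V -> V -> R[i]).
Hypothesis ip : inner_product dot.
Local Notation N := (N dot).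

Lemma linear_fun0 (A : V -> V) : linear A -> A 0 = 0.
Proof.
by move=> lA; have := lA (-1) 0 0; rewrite !scaleN1r oppr0 add0r addNr.
Qed.

Lemma linear_funD (A : V -> V) : linear A -> forall u v, A (u + v) = A u + A v.
Proof. by move=> lA u v; have := lA 1 u v; rewrite !scale1r. Qed.

Lemma linear_funZ (A : V -> V) : linear A -> forall a u, A (a *: u) = a *: A u.
Proof. by move=> lA a u; have := lA a u 0; rewrite (linear_fun0 lA) !addr0. Qed.

Lemma linear_funN (A : V -> V) : linear A -> forall u, A (- u) = - A u.
Proof. by move=> lA u; rewrite -scaleN1r (linear_funZ lA) scaleN1r. Qed.

Lemma linear_funB (A : V -> V) : linear A -> forall u v, A (u - v) = A u - A v.
Proof. by move=> lA u v; rewrite (linear_funD lA) (linear_funN lA). Qed.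

Lemma linear_addf (A B : V -> V) : linear A -> linear B ->
  linear (fun u => A u + B u).
Proof. by move=> lA lB a u v; rewrite lA lB scalerDr addrACA. Qed.

Lemma linear_oppf (A : V -> V) : linear A -> linear (fun u => - A u).
Proof. by move=> lA a u v; rewrite lA opprD scalerN. Qed.

Lemma linear_fun_sum (A : V -> V) : linear A ->
  forall I (r : seq I) (P : pred I) (F : I -> V),
  A (\sum_(i <- r | P i) F i) = \sum_(i <- r | P i) A (F i).
Proof.
move=> lA I r P F; elim/big_rec2: _ => [|i x y _ <-]; first exact: linear_fun0.
exact: linear_funD.
Qed.

(** Polarization over complex scalars: the pairs (u, v) and (u, i v) make both the sum and the
    difference of <A u, v> and <A v, u> vanish. Over the reals a rotation by a right angle is a
    counterexample. *)
Lemma quadratic_form_eq0 (A : V -> V) : linear A ->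
  (forall u, dot (A u) u = 0) -> forall u, A u = 0.
Proof.
move=> lA A0 u; apply: (dot_inj ip) => v; rewrite (dot0l ip).
have sum0 w : dot (A u) w + dot (A w) u = 0.
  have := A0 (u + w); rewrite (linear_funD lA) (dotDl ip) !(dotDr ip) !A0.
  by rewrite add0r addr0.
have := sum0 ('i%C *: v); rewrite (linear_funZ lA) (dotZl ip) (dotZr ip) => h1.
have h2 := sum0 v.
have h3 : 'i%C * ((dot (A u) v + dot (A v) u) - 2 * dot (A u) v) = 0 :> R[i].
  have ciE : conjc 'i%C = - 'i%C :> R[i] by apply: complexP; rewrite /= ?oppr0.
  rewrite -[RHS]h1 ciE; ring.
move: h3; rewrite h2 sub0r => /eqP; rewrite mulf_eq0 oppr_eq0 mulf_eq0.
rewrite pnatr_eq0/= => /orP[|/eqP//].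
by rewrite eq_complex/= oner_eq0 andbF.
Qed.

Lemma orth_projection_le (P : V -> V) u : orth_projection dot P -> N (P u) <= N u.
Proof.
move=> [lP PP sP]; have := N_ge0 ip (u - P u).
by rewrite (NB ip) -(Re_dotC ip) sP -{2}(PP u) -sP -[complex.Re _]/(N (P u)); lra.
Qed.

End OrthogonalProjection.

(** * Consequences of the weak definition of a spectral measure *)

Section SpectralMeasure.
Variables (R : realType) (V : lmodType R[i]) (dot : V -> V -> R[i]).
Hypothesis ip : inner_product dot.
Variables (T : V -> V) (E : set R -> V -> V).
Hypotheses (lT : linear T) (sT : forall u v, dot (T u) v = dot u (T v)).
Hypothesis TE : is_spectral_measure dot T E.
Implicit Types S : set (measurableTypeR R).
Local Notation N := (N dot).

Let pE S : measurable S -> orth_projection dot (E S).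
Proof. by case: TE => + _ _; apply. Qed.

Let lE S : measurable S -> linear (E S).
Proof. by move=> /pE[]. Qed.

(** The definition makes only the diagonal <E(S) u, u> additive in S; [quadratic_form_eq0] turns
    this into additivity of the operators. *)
Lemma spectral_measureU S S' u : measurable S -> measurable S' ->
  S `&` S' = set0 -> E (S `|` S') u = E S u + E S' u.
Proof.
move=> mS mS' SS'; have mU : measurable (S `|` S') by exact: measurableU.
apply/eqP; rewrite -subr_eq0; apply/eqP.
apply: (quadratic_form_eq0 ip (A := fun u => E (S `|` S') u - (E S u + E S' u))).
  by apply: linear_addf; [exact: lE|apply: linear_oppf; apply: linear_addf; exact: lE].
move=> v; rewrite (dotBl ip) (dotDl ip); case: TE => _ _ /(_ v)[nu [nuE _ _]].
have [f1 ->] := nuE _ mS; have [f2 ->] := nuE _ mS'; have [_ ->] := nuE _ mU.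
by rewrite measureU// fineD// rmorphD subrr.
Qed.

(** For w = E(S') u, the projection of the union sends w to E(S) w + w. Its squared norm is |w|^2 +
    3 |E(S) w|^2 and cannot exceed |w|^2. *)
Lemma spectral_measure_orth S S' u : measurable S -> measurable S' ->
  S `&` S' = set0 -> E S (E S' u) = 0.
Proof.
move=> mS mS' SS'; set w := E S' u.
have mU : measurable (S `|` S') by exact: measurableU.
have [lS SS sS] := pE mS; have [lS' S'S' sS'] := pE mS'.
have := orth_projection_le ip w (pE mU).
rewrite (spectral_measureU w mS mS' SS') /w S'S' -/w (ND ip).
rewrite -{2}(SS w) sS -[complex.Re _]/(N (E S w)) => h.
by apply: (N_eq0 ip); apply/eqP; rewrite eq_le N_ge0// andbT; have := N_ge0 ip (E S w); lra.
Qed.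

Lemma spectral_measureC S u : measurable S -> E S u + E (~` S) u = u.
Proof.
move=> mS; rewrite -spectral_measureU ?setICr//; last exact: measurableC.
by rewrite setUv; case: TE => _ ->.
Qed.

Lemma spectral_measureC_eq0 S u : measurable S -> E S u = u -> E (~` S) u = 0.
Proof.
move=> mS uS; have /eqP := spectral_measureC u mS.
by rewrite uS -subr_eq0 addrC addKr => /eqP.
Qed.

(** Without cross terms, the scalar measure of u + v is the sum of those of u and v. *)
Lemma spectral_measure_cross S u v S' : measurable S -> measurable S' ->
  E S u = u -> E (~` S) v = v -> dot (E S' u) v = 0.
Proof.
move=> mS mS' uS vS; have mSC := measurableC mS.
have [lC CC sC] := pE mSC.
have SD0 : E (S' `\` S) u = 0.
  rewrite -uS spectral_measure_orth//; first exact: measurableD.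
  by rewrite setDE -setIA setICl setI0.
rewrite -vS -sC -{1}(setUIDK S' S) spectral_measureU//; last 3 first.
- exact: measurableI.
- exact: measurableD.
- by rewrite setDE setIACA setICr setI0.
rewrite (linear_funD lC).
rewrite SD0 (linear_fun0 lC) addr0 spectral_measure_orth ?(dot0l ip)//.
  exact: measurableI.
by rewrite setICA setICl setI0.
Qed.

(** T is tied to E through first moments only. Since the scalar measures of u and v add up to that
    of u + v, so do the moments; expanding <T (u + v), u + v> leaves twice the real part of <T u,
    v>, which must vanish. *)
Lemma spectral_measure_symT S u v : measurable S ->
  E S u = u -> E (~` S) v = v -> complex.Re (dot (T u) v) = 0.
Proof.
move=> mS uS vS; have mSC := measurableC mS.
have vu S' : measurable S' -> dot (E S' v) u = 0.
  by move=> mS'; apply: (spectral_measure_cross mSC) => //; rewrite setCK.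
case: (TE) => _ _ tE.
have [n1 [n1E n1i n1T]] := tE u; have [n2 [n2E n2i n2T]] := tE v.
have [n3 [n3E n3i n3T]] := tE (u + v).
have n3D S' : measurable S' -> n3 S' = measure_add n1 n2 S'.
  move=> mS'; rewrite measure_addE.
  have [f1 h1] := n1E _ mS'; have [f2 h2] := n2E _ mS'.
  have [f3 h3] := n3E _ mS'.
  move: h3; rewrite (linear_funD (lE mS')) (dotDl ip) !(dotDr ip).
  rewrite (spectral_measure_cross mS mS' uS vS) vu// add0r addr0 h1 h2 -rmorphD.
  by move=> /complexI h; rewrite -(fineK f1) -(fineK f2) -(fineK f3) -EFinD h.
have mid := measurable_int _ n1i.
have : complex.Re (dot (T (u + v)) (u + v)) =
    complex.Re (dot (T u) u) + complex.Re (dot (T v) v).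
  rewrite n1T n2T n3T /= /Rintegral.
  rewrite [X in fine X](eq_measure_integral (measure_add n1 n2)); last first.
    by move=> A mA _; exact: n3D.
  rewrite integral_measure_add// fineD//; exact: integrable_fin_num.
rewrite (linear_funD lT) (dotDl ip) !(dotDr ip) !raddfD/=.
rewrite [dot (T v) u]sT (Re_dotC ip (T u) v); lra.
Qed.

Lemma spectral_measure_orthT S u v : measurable S ->
  E S u = u -> E (~` S) v = v -> dot (T u) v = 0.
Proof.
move=> mS uS vS; apply: complexP => /=; first exact: (spectral_measure_symT mS).
have : E (~` S) ('i%C *: v) = 'i%C *: v.
  by rewrite linear_funZ ?vS//; exact/lE/measurableC.
move=> /(spectral_measure_symT mS uS); rewrite (dotZr ip).
by case: (dot _ _) => a b /=; rewrite mul0r mulN1r opprK add0r.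
Qed.

(** Invariance of spectral subspaces is not part of the definition; it holds because T u is
    orthogonal to the range of the complementary projection. *)
Lemma spectral_measure_stable S u : measurable S ->
  E S u = u -> E S (T u) = T u.
Proof.
move=> mS uS; have mSC := measurableC mS; have [lC CC sC] := pE mSC.
rewrite -[RHS](spectral_measureC (T u) mS).
suff -> : E (~` S) (T u) = 0 by rewrite addr0.
apply: (dot_inj ip) => w; rewrite sC (dot0l ip).
by apply: (spectral_measure_orthT mS) => //; exact: CC.
Qed.

(** The quantity is the integral of a x + b against the scalar measure of u, which does not charge
    the complement of S. In the strict case a zero integral would make that measure zero, hence u
    zero. *)
Lemma spectral_measure_affine S u (a b : R) : measurable S -> E S u = u ->
  ((forall x, S x -> 0 <= a * x + b) ->
     0 <= a * complex.Re (dot (T u) u) + b * N u) /\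
  (u <> 0 -> (forall x, S x -> 0 < a * x + b) ->
     0 < a * complex.Re (dot (T u) u) + b * N u).
Proof.
move=> mS uS; have mSC := measurableC mS.
case: (TE) => _ ET /(_ u)[nu [nuE nui nuT]].
have nuC : nu (~` S) = 0%E.
  have [f1] := nuE _ mSC; rewrite (spectral_measureC_eq0 mS uS) (dot0l ip).
  by move=> /complexI h; rewrite -(fineK f1) -h.
have [fT nuTE] := nuE _ measurableT.
have NuE : N u = fine (nu setT).
  by rewrite -[N u]/(complex.Re (dot u u)) -{1}(ET u) nuTE.
have nuS : nu S = nu setT.
  by rewrite -(setUv S) measureU// ?setICr//= nuC adde0.
pose g (x : measurableTypeR R) := (a * x + b)%:E.
have icst : nu.-integrable setT (fun=> b%:E).
  apply: (@measurable_bounded_integrable _ _ _ nu (fun=> b)) => //.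
    by rewrite -ge0_fin_numE.
  exact: bounded_cst.
have iax : nu.-integrable setT (fun x => a%:E * x%:E)%E by exact: integrableZl.
have gi : nu.-integrable setT g.
  have -> : g = (fun x => a%:E * x%:E + b%:E)%E by apply/funext => x.
  exact: integrableD.
have giS : nu.-integrable S g by exact: integrableS gi.
have gE : a * complex.Re (dot (T u) u) + b * N u = fine (\int[nu]_(x in S) g x)%E.
  have -> : (\int[nu]_(x in S) g x = \int[nu]_x g x)%E.
    by rewrite (negligible_integral mSC measurableT gi nuC) setDE setCK setTI.
  have -> : (\int[nu]_x g x = \int[nu]_x (a%:E * x%:E + b%:E))%E by [].
  rewrite integralD// integralZl// integral_cst// nuT NuE fineD ?fineM//=.
  - exact: integrable_fin_num.
  - by rewrite fin_numM//; exact: integrable_fin_num.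
  - by rewrite fin_numM.
rewrite gE; split=> [g0|u0 g0]; first exact/fine_ge0/integral_ge0.
have g0' x : S x -> (0 <= g x)%E by move=> /g0/ltW; rewrite lee_fin.
rewrite lt_neqAle fine_ge0 ?integral_ge0// andbT eq_sym; apply/eqP => I0.
apply: u0; apply: (N_eq0 ip); rewrite NuE -nuS.
have I0' : (\int[nu]_(x in S) `|g x| = 0)%E.
  rewrite (eq_integral g); last by move=> x /set_mem Sx; rewrite gee0_abs ?g0'.
  by rewrite -(fineK (integrable_fin_num mS giS)) I0.
have [M [mM M0 SM]] : ae_eq nu S g (cst 0%E).
  by apply/ae_eq_integral_abs => //; exact: measurable_int giS.
apply/eqP; rewrite fine_eq0 ?nuS -?nuS//; last by rewrite nuS.
rewrite eq_le measure_ge0 andbT -M0 le_measure ?inE// => x Sx.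
apply: SM => /= /(_ Sx) [] gx0; have := g0 _ Sx.
by rewrite gx0 ltxx.
Qed.

(** Here u is the sum of a piece v carried by x <= e and a piece w carried by x >= 1 - e. Since v, T
    v are orthogonal to w, T w, both sides split into a contribution of v and one of w. *)
Lemma spectral_measure_defect_le (e : R) u : 0 < e < 1 / 2 ->
  E `]e, 1 - e[%classic u = 0 ->
  complex.Re (dot (T u) u) - N (T u) <= e * (1 - e) * N u.
Proof.
move=> /andP[e0 e12] u0.
have mL : measurable (`]-oo, e] : set (measurableTypeR R)) by [].
have mI : measurable (`]e, 1 - e[ : set (measurableTypeR R)) by [].
have mG : measurable (`[1 - e, +oo[ : set (measurableTypeR R)) by [].
set L := `]-oo, e]%classic; set G := `[1 - e, +oo[%classic.
have LG : L `&` G = set0.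
  rewrite /L /G; apply/seteqP; split => // x /=; rewrite !in_itv/= => -[? /andP[]].
  lra.
have uE : u = E L u + E G u.
  rewrite -(spectral_measureU _ mL mG LG) -[LHS](spectral_measureC u mI) u0 add0r.
  congr (E _ u); apply/seteqP; split=> x; rewrite /L /G/= !in_itv/= ?andbT.
    by move=> h; case: (leP x e) => ?; [left|right]; rewrite // leNgt; apply/negP => ?;
       apply: h; apply/andP.
  by move=> h /andP[? ?]; case: h => ?; lra.
set v := E L u in uE *; set w := E G u in uE *.
have vL : E L v = v by have [_ + _] := pE mL; apply.
have wG : E G w = w by have [_ + _] := pE mG; apply.
have wLC : E (~` L) w = w.
  have := spectral_measureC w mL.
  by rewrite -{1}wG (spectral_measure_orth _ mL mG LG) add0r.
have Tvw : dot (T v) w = 0 by exact: (spectral_measure_orthT mL).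
have TwL : E (~` L) (T w) = T w by apply: spectral_measure_stable => //; exact: measurableC.
have TvTw : dot (T v) (T w) = 0.
  have [_ _ sC] := pE (measurableC mL).
  rewrite -TwL -sC.
  by rewrite (spectral_measureC_eq0 mL (spectral_measure_stable mL vL)) (dot0l ip).
have vw : dot v w = 0.
  have [_ _ sC] := pE (measurableC mL).
  by rewrite -wLC -sC (spectral_measureC_eq0 mL vL) (dot0l ip).
have Twv : dot (T w) v = 0 by rewrite sT (dotC ip) Tvw rmorph0.
have [hv _] := spectral_measure_affine (-1) e mL vL.
have [hw _] := spectral_measure_affine 1 (- (1 - e)) mG wG.
have {}hv : complex.Re (dot (T v) v) <= e * N v.
  suff : 0 <= -1 * complex.Re (dot (T v) v) + e * N v by lra.
  by apply: hv => x; rewrite /= in_itv/=; lra.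
have {}hw : (1 - e) * N w <= complex.Re (dot (T w) w).
  suff : 0 <= 1 * complex.Re (dot (T w) w) + - (1 - e) * N w by lra.
  by apply: hw => x; rewrite /= in_itv/= andbT; lra.
rewrite uE (linear_funD lT) (ND_orth ip TvTw) (ND_orth ip vw).
rewrite (dotDl ip) !(dotDr ip) Tvw Twv addr0 add0r raddfD/=.
(* On v this is x - x^2 = e (1 - e) - (1 - 2 e) (e - x) - (x - e)^2, where the square becomes the
   squared norm of T v - e v; on w the same identity is read with 1 - e in place of e. *)
have := N_ge0 ip (T v - e%:C *: v); have := N_ge0 ip (T w - (1 - e)%:C *: w).
rewrite !(NB ip) !(NZ ip) !sqn_real !(dotZr ip) !conjc_real !RemulrC.
have e2 : 0 <= 1 - 2 * e by lra.
move: hv hw; rewrite -subr_ge0 => hv; rewrite -subr_ge0 => hw.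
have := mulr_ge0 e2 hv; have := mulr_ge0 e2 hw; lra.
Qed.

(** With p = (T - e) u and q = (1 - e - T) u, the identity (1 - e - x) (x - e)^2 + (x - e) (1 - e -
    x)^2 = (1 - 2 e) (x - x^2 - e (1 - e)) writes 1 - 2 e times the gap as a sum of two first-moment
    forms, at p and at q. The gap is strict because p + q = (1 - 2 e) u, so p and q are not both
    zero. *)
Lemma spectral_measure_defect_gt (e : R) u : 0 < e < 1 / 2 ->
  E `]e, 1 - e[%classic u = u -> u <> 0 ->
  e * (1 - e) * N u < complex.Re (dot (T u) u) - N (T u).
Proof.
move=> /andP[e0 e12] uS u0.
have mS : measurable (`]e, 1 - e[ : set (measurableTypeR R)) by [].
set S := `]e, 1 - e[%classic in uS mS *.
have TuS : E S (T u) = T u by exact: spectral_measure_stable.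
have sub w a : E S w = w -> E S (T w) = T w -> E S (T w - a *: w) = T w - a *: w.
  move=> wS TwS; rewrite (linear_funB (lE mS)) (linear_funZ (lE mS)).
  by rewrite wS TwS.
have [f fE] : exists f, f = 1 - e by exists (1 - e).
pose p := T u - e%:C *: u; pose q := f%:C *: u - T u.
have pS : E S p = p by exact: sub.
have qS : E S q = q.
  by rewrite /q -opprB (linear_funN (lE mS)) sub.
have Sb x : S x -> 0 < -1 * x + (1 - e) by rewrite /S/= in_itv/=; lra.
have Sa x : S x -> 0 < 1 * x + - e by rewrite /S/= in_itv/=; lra.
have [bp bp'] := spectral_measure_affine (-1) (1 - e) mS pS.
have [aq aq'] := spectral_measure_affine 1 (- e) mS qS.
have {}bp := bp (fun x h => ltW (Sb x h)).
have {}aq := aq (fun x h => ltW (Sa x h)).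
have key : -1 * complex.Re (dot (T p) p) + (1 - e) * N p +
     (1 * complex.Re (dot (T q) q) + - e * N q) =
   (1 - 2 * e) * (complex.Re (dot (T u) u) - N (T u) - e * (1 - e) * N u).
  have TTu : dot (T (T u)) u = (N (T u))%:C by rewrite sT (dotE ip).
  rewrite /p /q !(linear_funB lT) !(linear_funZ lT).
  rewrite !(NB ip) !(NZ ip) !(dotBl ip) !(dotBr ip) !(dotZr ip) !(dotZl ip).
  rewrite !TTu.
  have uTu : dot u (T u) = dot (T u) u by rewrite sT.
  rewrite !conjc_real uTu !raddfB/= !RemulrC !sqn_real fE.
  rewrite -[complex.Re (dot (T u) (T u))]/(N (T u)); ring.
suff : 0 < (1 - 2 * e) * (complex.Re (dot (T u) u) - N (T u) - e * (1 - e) * N u).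
  rewrite pmulr_rgt0; lra.
rewrite -key.
have [p0|/eqP p0] := eqVneq p 0; last by have := bp' p0 Sb; lra.
have [q0|/eqP q0] := eqVneq q 0; last by have := aq' q0 Sa; lra.
exfalso; apply: u0; have : p + q = 0 by rewrite p0 q0 addr0.
rewrite /p /q fE addrC addrA subrK -scalerBl -rmorphB => /eqP.
rewrite scaler_eq0 => /orP[|/eqP//]; rewrite eq_complex/= eqxx andbT.
by move=> /eqP h; exfalso; lra.
Qed.

End SpectralMeasure.

Section Rank.
Variables (R : realType) (V : lmodType R[i]).
Implicit Type T : V -> V.

Lemma rank_ge0 T : (0 <= rank T)%E.
Proof.
apply: ereal_sup_ubound; exists 0%N => //=.
by exists (fun=> 0) => a _ [].
Qed.

(** A finite supremum of natural numbers is attained, and an independent family of values of T of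
    maximal size spans the range. *)
Lemma rank_ltyP T : linear T -> (rank T < +oo)%E ->
  exists d, rank T = d%:R%:E /\ exists s : 'I_d -> V, forall u,
    exists a : 'I_d -> R[i], T u = \sum_(i < d) a i *: T (s i).
Proof.
move=> lT rT.
pose Z n := `[< exists s : 'I_n -> V, forall a : 'I_n -> R[i],
  \sum_(i < n) a i *: T (s i) = 0 -> forall i, a i = 0 >].
have ZE n : Z n -> (n%:R%:E <= rank T)%E.
  by move=> /asboolP Zn; apply: ereal_sup_ubound; exists n.
have Z0 : exists n, Z n.
  by exists 0%N; apply/asboolP; exists (fun=> 0) => a _ [].
have rf : rank T \is a fin_num by rewrite ge0_fin_numE ?rank_ge0.
have Zub n : Z n -> (n <= (Num.truncn (fine (rank T))).+1)%N.
  move=> /ZE; rewrite -(fineK rf) lee_fin => h.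
  by rewrite -(ler_nat R); apply: le_trans h _; exact/ltW/truncnS_gt.
pose d := ex_maxn Z0 Zub.
have [Zd dmax] : Z d /\ forall n, Z n -> (n <= d)%N by rewrite /d; case: ex_maxnP.
exists d; split.
  apply/eqP; rewrite eq_le ZE// andbT; apply: ge_ereal_sup => _ [n Zn <-].
  by rewrite lee_fin ler_nat; apply: dmax; apply/asboolP.
have [s sP] := asboolW Zd; exists s => u.
have /asboolPn NZ : ~~ Z d.+1 by apply/negP => /dmax; rewrite ltnn.
(* Appending u breaks independence, by maximality of [d]; the coefficient of T u in the resulting
   relation is nonzero, since otherwise the relation would concern [s] alone. *)
pose s' i : V := if unlift ord_max i is Some j then s j else u.
have [a [a0 [i0 ai0]]] : exists a : 'I_d.+1 -> R[i],
    \sum_(i < d.+1) a i *: T (s' i) = 0 /\ exists i, a i <> 0.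
  apply: contrapT => h; apply: NZ; exists s' => a a0 i.
  by apply: contrapT => ai; apply: h; exists a; split=> //; exists i.
have s'l j : s' (widen_ord (leqnSn d) j) = s j.
  rewrite /s'; have -> : widen_ord (leqnSn d) j = lift ord_max j.
    by apply: val_inj; rewrite /= /bump leqNgt ltn_ord.
  by rewrite liftK.
move: a0; rewrite big_ord_recr/= {2}/s' unlift_none.
under eq_bigr do rewrite s'l.
move=> a0; have [am0|am0] := eqVneq (a ord_max) 0.
  move: a0; rewrite am0 scale0r addr0 => /sP a0; exfalso; apply: ai0.
  have [j ->|->//] := unliftP ord_max i0.
  rewrite -(a0 j); congr a; apply: val_inj.
  by rewrite /= /bump leqNgt ltn_ord.
exists (fun j => - (a ord_max)^-1 * a (widen_ord (leqnSn d) j)).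
under eq_bigr do rewrite -scalerA.
rewrite -scaler_sumr; apply: (@scalerI _ _ (a ord_max)) => //.
rewrite scalerA mulrN divff// scaleN1r; apply/eqP.
by rewrite -addr_eq0 addrC a0.
Qed.

Lemma exists_kernel_vector (F : fieldType) n (J : finType) (c : 'I_n -> J -> F) :
  (#|J| < n)%N -> exists a : 'I_n -> F,
    (exists i, a i <> 0) /\ forall j, \sum_(i < n) a i * c i j = 0.
Proof.
move=> Jn; pose A := \matrix_(i < n, j < #|J|) c i (enum_val j).
have kA : kermx A != 0.
  rewrite -mxrank_eq0 mxrank_ker subn_eq0 -ltnNge.
  by apply: leq_ltn_trans Jn; exact: rank_leq_col.
have /rowV0Pn [v vk v0] := kA; exists (fun i => v 0 i); split.
  have : [exists i, v 0 i != 0].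
    apply: contraNT v0 => /existsPn h; apply/eqP/rowP => i.
    by rewrite mxE; apply/eqP; have := h i; rewrite negbK.
  by case/existsP => i /eqP vi; exists i.
move=> j; have /sub_kermxP/rowP/(_ (enum_rank j)) := vk.
rewrite !mxE => {2}<-; apply: eq_bigr => i _; by rewrite mxE enum_rankK.
Qed.

End Rank.

Section SpectralCount.
Variables (R : realType) (V : lmodType R[i]) (dot : V -> V -> R[i]).
Hypothesis ip : inner_product dot.
Local Notation N := (N dot).
Local Notation defect T u := (complex.Re (dot (T u) u) - N (T u)).

(* By dimension count, if the inequality failed, some nonzero u in the range of
   the global projection would be killed by all local ones, and its defect
   would violate the assumed subadditivity. *)
Lemma rank_spectral_measure_le (I : finType) (P : pred I)
    (T : V -> V) (E : set R -> V -> V) (e : R)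
    (T_ : I -> V -> V) (E_ : I -> set R -> V -> V) (e_ : I -> R) :
  linear T -> (forall u v, dot (T u) v = dot u (T v)) ->
  (forall k, P k -> linear (T_ k)) ->
  (forall k, P k -> forall u v, dot (T_ k u) v = dot u (T_ k v)) ->
  is_spectral_measure dot T E ->
  (forall k, P k -> is_spectral_measure dot (T_ k) (E_ k)) ->
  0 < e < 1 / 2 -> (forall k, P k -> 0 < e_ k < 1 / 2) ->
  (forall u, Num.sqrt (defect T u) <=
     \sum_(k | P k) Num.sqrt (defect (T_ k) u)) ->
  \sum_(k | P k) Num.sqrt (e_ k * (1 - e_ k)) <= Num.sqrt (e * (1 - e)) ->
  (rank (E `]e, (1 - e)%R[%classic) <=
   \sum_(k | P k) rank (E_ k `](e_ k), (1 - e_ k)%R[%classic))%E.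
Proof.
move=> lT sT lT_ sT_ TE TE_ e0 e_0 sub sume.
pose F k := E_ k `](e_ k), (1 - e_ k)[%classic.
have mF (x y : R) : measurable (`]x, y[%classic : set (measurableTypeR R)) by [].
have lF k : P k -> linear (F k).
  by move=> /TE_[/(_ _ (mF (e_ k) (1 - e_ k)))[]].
have lE : linear (E `]e, 1 - e[%classic).
  by have [/(_ _ (mF e (1 - e)))[]] := TE.
have [/existsP[k /andP[Pk /eqP rk]]|/existsPn fin] :=
    boolP [exists k, P k && (rank (F k) == +oo%E)].
  rewrite (bigD1 k)//= [X in (X + _)%E]rk addye ?leey//.
  rewrite gt_eqF// (lt_le_trans ltNy0)// sume_ge0// => i _.
  exact: rank_ge0.
pose good k (d : nat) := rank (F k) = d%:R%:E /\ exists s : 'I_d -> V, forall u,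
    exists a : 'I_d -> R[i], F k u = \sum_(i < d) a i *: F k (s i).
have [d dP] : exists d : I -> nat, forall k, P k -> good k (d k).
  suff h k : exists d, P k -> good k d.
    by exists (fun k => projT1 (cid (h k))) => k; exact: (projT2 (cid (h k))).
  have [Pk|] := boolP (P k); last by exists 0%N.
  have [//||d dP] := @rank_ltyP _ _ (F k); [exact: lF| |by exists d].
  by have := fin k; rewrite Pk/= ltey.
have -> : (\sum_(k | P k) rank (F k) = (\sum_(k | P k) d k)%:R%:E)%E.
  rewrite natr_sum -sumEFin; apply: eq_bigr => k Pk.
  by have [-> _] := dP _ Pk.
apply: ge_ereal_sup => _ [n [s sP] <-]; rewrite lee_fin ler_nat leqNgt.
apply/negP => dn.
(* Dimension 0 off [P] lets the linear conditions be indexed over all of [I]; their number is then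
   exactly the sum of the local ranks. *)
pose D k := if P k then d k else 0%N.
pose J : finType := {k : I & 'I_(D k)}.
have cJ : #|J| = (\sum_(k | P k) d k)%N.
  rewrite card_tagged sumnE big_map big_enum/= [RHS]big_mkcond/=.
  by apply: eq_bigr => k _; rewrite card_ord.
have [t tP] : exists t : forall k, 'I_(D k) -> V, forall k, P k -> forall u,
    exists a : 'I_(D k) -> R[i], F k u = \sum_(i < D k) a i *: F k (t k i).
  suff h k : exists t : 'I_(D k) -> V, P k -> forall u,
      exists a : 'I_(D k) -> R[i], F k u = \sum_(i < D k) a i *: F k (t i).
    by exists (fun k => projT1 (cid (h k))) => k; exact: (projT2 (cid (h k))).
  rewrite /D; case: ifPn => Pk; last by exists (fun=> 0).
  by have [_ [t tP]] := dP _ Pk; exists t.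
have [c cP] : exists c : 'I_n -> forall k, 'I_(D k) -> R[i], forall i k, P k ->
    F k (E `]e, 1 - e[%classic (s i)) = \sum_(l < D k) c i k l *: F k (t k l).
  suff h i k : exists c : 'I_(D k) -> R[i], P k ->
      F k (E `]e, 1 - e[%classic (s i)) = \sum_(l < D k) c l *: F k (t k l).
    exists (fun i k => projT1 (cid (h i k))) => i k.
    exact: (projT2 (cid (h i k))).
  have [Pk|] := boolP (P k); last by exists (fun=> 0).
  by have [a aP] := tP _ Pk (E `]e, 1 - e[%classic (s i)); exists a.
(* The unknowns are the coefficients of a combination of the n independent global vectors; the
   equations annihilate all its coordinates in the local ranges. *)
have [|a [[i0 ai0] aP]] := @exists_kernel_vector _ n J
  (fun i j => c i (tag j) (tagged j)); first by rewrite cJ.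
pose u := \sum_(i < n) a i *: E `]e, 1 - e[%classic (s i).
have u0 : u <> 0 by move=> /sP/(_ i0).
have Eu : E `]e, 1 - e[%classic u = u.
  have [/(_ _ (mF e (1 - e)))[_ EE _] _ _] := TE.
  rewrite /u (linear_fun_sum lE); apply: eq_bigr => i _.
  by rewrite (linear_funZ lE) EE.
have Fu k : P k -> F k u = 0.
  move=> Pk; rewrite /u (linear_fun_sum (lF _ Pk)).
  under eq_bigr => i _.
    rewrite (linear_funZ (lF _ Pk)) cP// scaler_sumr.
    under eq_bigr do rewrite scalerA.
    over.
  rewrite exchange_big/= big1// => l _; rewrite -scaler_suml.
  by have := aP (Tagged (fun k => 'I_(D k)) l) => /= ->; rewrite scale0r.
have Nu := N_gt0 ip u0.
have d1 := spectral_measure_defect_gt ip lT sT TE e0 Eu u0.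
have /andP[e1 e2] := e0.
have : Num.sqrt (e * (1 - e)) * nrm dot u < Num.sqrt (e * (1 - e)) * nrm dot u.
  have ee : 0 <= e * (1 - e) by apply: mulr_ge0; lra.
  apply: (@lt_le_trans _ _ (Num.sqrt (defect T u))).
    by rewrite /nrm -sqrtrM// ltr_sqrt// (le_lt_trans _ d1)// mulr_ge0// N_ge0.
  apply: le_trans (sub u) _.
  apply: (@le_trans _ _ (\sum_(k | P k) Num.sqrt (e_ k * (1 - e_ k)) * nrm dot u)).
    apply: ler_sum => k Pk; have /andP[ek1 ek2] := e_0 _ Pk.
    have eek : 0 <= e_ k * (1 - e_ k) by apply: mulr_ge0; lra.
    rewrite /nrm -sqrtrM// ler_wsqrtr//.
    apply: (spectral_measure_defect_le ip (lT_ _ Pk) (sT_ _ Pk) (TE_ _ Pk) (e_0 _ Pk)).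
    exact: Fu.
  by rewrite -mulr_suml ler_wpM2r// nrm_ge0.
by rewrite ltxx.
Qed.

End SpectralCount.

(** * Spectral measures of positive operators with finite trace *)

Section HilbertConvergence.
Variables (R : realType) (V : lmodType R[i]) (dot : V -> V -> R[i]).
Hypothesis ip : inner_product dot.
Local Notation N := (N dot).

(** [V] carries no topology, so norm convergence is expressed by the real sequence of squared
    distances. *)
Definition cvgH (u : nat -> V) (l : V) : Prop :=
  N (u n - l) @[n --> \oo] --> (0 : R).

Definition cauchyV (u : nat -> V) : Prop :=
  forall e : R, 0 < e ->
    exists n0, forall m n, (n0 <= m)%N -> (n0 <= n)%N -> N (u m - u n) <= e.

Definition completeV : Prop :=
  forall u, cauchyV u -> exists l, cvgH u l.

Lemma cvg0_le (f g : nat -> R) : (forall n, 0 <= f n <= g n) ->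
  g @ \oo --> (0 : R) -> f @ \oo --> (0 : R).
Proof.
by move=> fg g0; apply: (squeeze_cvgr _ (cvg_cst 0) g0); exact: nearW.
Qed.

Lemma cvgn0P (f : nat -> R) : f @ \oo --> (0 : R) <->
  forall e, 0 < e -> exists n0, forall n, (n0 <= n)%N -> `|f n| <= e.
Proof.
split=> [/cvgrPdist_le h e e0|h].
  by have [n0 _ hn] := h e e0; exists n0 => n /hn/=; rewrite sub0r normrN.
apply/cvgrPdist_le => e e0; have [n0 hn] := h e e0.
by exists n0 => // n /hn/=; rewrite sub0r normrN.
Qed.

Lemma cvgn_mull (c : R) (f : nat -> R) l : f @ \oo --> l ->
  c * f n @[n --> \oo] --> c * l.
Proof. by move=> fl; apply: cvgM => //; exact: cvg_cst. Qed.

Lemma cvgn_unique (f : nat -> R) (a b : R) :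
  f @ \oo --> a -> f @ \oo --> b -> a = b.
Proof.
by move=> fa fb; rewrite -(cvg_lim (@Rhausdorff R) fa) (cvg_lim (@Rhausdorff R) fb).
Qed.

Lemma cvgHP (u : nat -> V) l :
  cvgH u l <-> forall e : R, 0 < e -> exists n0, forall n, (n0 <= n)%N -> N (u n - l) <= e.
Proof.
split=> [/cvgn0P h e /h[n0 hn]|h].
  by exists n0 => n /hn; rewrite ger0_norm ?N_ge0.
apply/cvgn0P => e /h[n0 hn]; exists n0 => n /hn.
by rewrite ger0_norm ?N_ge0.
Qed.

Lemma cvgH_cauchy u l : cvgH u l -> cauchyV u.
Proof.
move=> /cvgHP h e e0; have [n0 hn] : exists n0, forall n, (n0 <= n)%N -> N (u n - l) <= e / 4.
  by apply: h; rewrite divr_gt0.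
exists n0 => m n n0m n0n.
have -> : u m - u n = (u m - l) - (u n - l) by rewrite opprB addrA subrK.
have := NB_le ip (u m - l) (u n - l); have := hn _ n0m; have := hn _ n0n; lra.
Qed.

Lemma cvgH_unique u l l' : cvgH u l -> cvgH u l' -> l = l'.
Proof.
move=> ul ul'; apply/eqP; rewrite -subr_eq0; apply/eqP; apply: (N_eq0 ip).
apply/eqP; rewrite eq_le N_ge0// andbT; apply/ler_addgt0Pr => e e0; rewrite add0r.
have [n1 h1] : exists n0, forall n, (n0 <= n)%N -> N (u n - l) <= e / 4.
  by have /cvgHP := ul; apply; rewrite divr_gt0.
have [n2 h2] : exists n0, forall n, (n0 <= n)%N -> N (u n - l') <= e / 4.
  by have /cvgHP := ul'; apply; rewrite divr_gt0.
have -> : l - l' = (u (maxn n1 n2) - l') - (u (maxn n1 n2) - l).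
  by rewrite opprB [RHS]addrC addrA subrK.
have := NB_le ip (u (maxn n1 n2) - l') (u (maxn n1 n2) - l).
have := h1 _ (leq_maxl n1 n2); have := h2 _ (leq_maxr n1 n2); lra.
Qed.

Lemma cvgH_le u l (f : V -> V) v (c : R) :
  cvgH u l -> (forall n, N (f (u n) - v) <= c * N (u n - l)) ->
  cvgH (f \o u) v.
Proof.
move=> ul fl; apply: (@cvg0_le _ (fun n => c * N (u n - l))).
  by move=> n; rewrite N_ge0//= fl.
by rewrite -(mulr0 c); exact: cvgn_mull.
Qed.

Lemma cvgH_dot u l w : cvgH u l ->
  complex.Re (dot (u n) w) @[n --> \oo] --> complex.Re (dot l w) /\
  complex.Im (dot (u n) w) @[n --> \oo] --> complex.Im (dot l w).
Proof.
move=> ul.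
have h : sqn (dot (u n) w - dot l w) @[n --> \oo] --> (0 : R).
  apply: (@cvg0_le _ (fun n => N w * N (u n - l))).
    by move=> n; rewrite sqn_ge0/= -(dotBl ip) mulrC dot_sqn_le.
  by rewrite -(mulr0 (N w)); exact: cvgn_mull.
have sq0 (f : nat -> R) a : (f n - a) ^+ 2 @[n --> \oo] --> (0 : R) ->
    f n @[n --> \oo] --> a.
  move=> fa; apply/subr_cvg0/cvgn0P => e e0.
  have e20 : 0 < e ^+ 2 by rewrite exprn_gt0.
  have /cvgn0P/(_ _ e20)[n0 hn] := fa; exists n0 => n /hn.
  by rewrite normrX ler_pXn2r// ?nnegrE ?normr_ge0// ltW.
split; apply: sq0; apply: cvg0_le h => n.
  by rewrite sqr_ge0/= -raddfB /sqn lerDl sqr_ge0.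
by rewrite sqr_ge0/= -raddfB /sqn lerDr sqr_ge0.
Qed.

Lemma cvgH_dot_eq u l w c : cvgH u l ->
  (\forall n \near \oo, dot (u n) w = c) -> dot l w = c.
Proof.
move=> /(cvgH_dot w)[hr hi] uc.
apply: complexP.
  apply: (cvgn_unique hr); apply: cvg_near_cst.
  by apply: filterS uc => n ->.
apply: (cvgn_unique hi); apply: cvg_near_cst.
by apply: filterS uc => n ->.
Qed.

Lemma cvgH_N u l : cvgH u l -> N (u n) @[n --> \oo] --> N l.
Proof.
move=> ul; have [hr _] := cvgH_dot l ul.
have -> : (fun n => N (u n)) =
    (fun n => N (u n - l) + 2 * complex.Re (dot (u n) l) - N l).
  by apply/funext => n; rewrite (NB ip); lra.
have Nl : 0 + 2 * complex.Re (dot l l) - N l = N l.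
  by rewrite -[complex.Re (dot l l)]/(N l); lra.
have h := cvgB (cvgD ul (cvgn_mull (c := 2) hr)) (cvg_cst (N l)).
rewrite Nl in h; exact: h.
Qed.

End HilbertConvergence.

(** * Fixed vectors of positive contractions of finite trace *)

Section TopEigenvector.
Variables (R : realType) (V : lmodType R[i]) (dot : V -> V -> R[i]).
Hypothesis ip : inner_product dot.
Local Notation N := (N dot).
Hypothesis cV : completeV dot.

Definition orthonormal_family n (e : nat -> V) : Prop := forall i j,
  (i < n)%N -> (j < n)%N -> dot (e i) (e j) = (i == j)%:R.

(** Finite orthonormal families stand in for a basis, so that no infinite sum is involved. *)
Definition trace_bounded (T : V -> V) (tau : R) : Prop := forall n e,
  orthonormal_family n e -> \sum_(i < n) complex.Re (dot (T (e i)) (e i)) <= tau.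

Lemma orthonormalS n e u : orthonormal_family n e -> N u = 1 ->
  (forall i, (i < n)%N -> dot u (e i) = 0) ->
  orthonormal_family n.+1 (fun k => if (k < n)%N then e k else u).
Proof.
move=> on u1 ue i j; rewrite !ltnS => ni nj.
case: ltnP => hi; case: ltnP => hj; first exact: on.
- by rewrite (dotC ip) ue// rmorph0 ltn_eqF// (leq_trans hi hj).
- by rewrite ue// gtn_eqF// (leq_trans hj hi).
- by rewrite (dotE ip) u1 (@anti_leq i j) ?eqxx// (leq_trans ni hj) (leq_trans nj hi).
Qed.

Lemma orthonormal_sum n e (c : nat -> R[i]) j : orthonormal_family n e -> (j < n)%N ->
  dot (\sum_(i < n) c i *: e i) (e j) = c j.
Proof.
move=> on jn; rewrite (dot_suml ip) (bigD1 (Ordinal jn))//= (dotZl ip) on// eqxx.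
rewrite mulr1 big1 ?addr0// => i ij.
rewrite (dotZl ip) on// -[j]/(val (Ordinal jn)) val_eqE (negbTE ij) mulr0.
by [].
Qed.

Lemma dot_orthonormal_sum n e (c : nat -> R[i]) u : (forall i, (i < n)%N -> dot u (e i) = c i) ->
  dot u (\sum_(i < n) c i *: e i) = (\sum_(i < n) sqn (c i))%:C.
Proof.
move=> uc; rewrite (dot_sumr ip) rmorph_sum; apply: eq_bigr => i _.
by rewrite (dotZr ip) uc// mulrC mulcJ.
Qed.

Lemma N_orthonormal_sum n e (c : nat -> R[i]) : orthonormal_family n e ->
  N (\sum_(i < n) c i *: e i) = \sum_(i < n) sqn (c i).
Proof.
move=> on; rewrite -[LHS]/(complex.Re (dot _ _)) dot_orthonormal_sum//.
by move=> i; exact: orthonormal_sum.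
Qed.

Lemma bessel n e u : orthonormal_family n e -> \sum_(i < n) sqn (dot u (e i)) <= N u.
Proof.
move=> on; have := N_ge0 ip (u - \sum_(i < n) dot u (e i) *: e i).
rewrite (NB ip) (N_orthonormal_sum (fun i => dot u (e i)) on).
rewrite (@dot_orthonormal_sum _ _ (fun i => dot u (e i)))//=; lra.
Qed.

Section Contraction.
Variables (T : V -> V) (M : V -> Prop).
Local Notation q u := (complex.Re (dot (T u) u)).
Hypotheses (lT : linear T) (sT : forall u v, dot (T u) v = dot u (T v)).
Hypotheses (MP : forall a u v, M u -> M v -> M (a *: u + v)) (M0 : M 0).
Hypothesis Mclosed : forall (u : nat -> V) l, (forall n, M (u n)) -> cvgH dot u l -> M l.
Hypothesis MT : forall u, M u -> M (T u).
Hypotheses (q_ge0 : forall u, M u -> 0 <= q u) (q_le : forall u, M u -> q u <= N u).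

Let MZ a u : M u -> M (a *: u).
Proof. by move=> Mu; have := MP a Mu M0; rewrite addr0. Qed.

Let MD u v : M u -> M v -> M (u + v).
Proof. by move=> Mu Mv; have := MP 1 Mu Mv; rewrite scale1r. Qed.

Let MB u v : M u -> M v -> M (u - v).
Proof. by move=> Mu Mv; apply: MD => //; rewrite -scaleN1r; exact: MZ. Qed.

Let Msum n (f : nat -> V) : (forall i, (i < n)%N -> M (f i)) -> M (\sum_(i < n) f i).
Proof.
elim: n => [|n IH] Mf; first by rewrite big_ord0.
by rewrite big_ord_recr/=; apply: MD; [apply: IH => i ni; apply: Mf; exact: ltnW|exact: Mf].
Qed.

Lemma qB u v : q (u - v) = q u + q v - 2 * complex.Re (dot (T u) v).
Proof.
rewrite (linear_funB lT) (dotBl ip) !(dotBr ip) !raddfB/=.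
by rewrite [dot (T v) u]sT (Re_dotC ip (T u) v); lra.
Qed.

Lemma qZ a u : q (a *: u) = sqn a * q u.
Proof.
by rewrite (linear_funZ lT) (dotZl ip) (dotZr ip) mulrA mulcJ RemulrC.
Qed.

(** For 0 <= T <= 1 this is T^2 <= T, obtained without a square root of T: combine positivity of the
    form at u - T u with its upper bound at T u. *)
Lemma NT_le_q u : M u -> N (T u) <= q u.
Proof.
move=> Mu; have := q_ge0 (MB Mu (MT Mu)); have := q_le (MT Mu).
rewrite qB -[complex.Re (dot (T u) (T u))]/(N (T u)); lra.
Qed.

Lemma NT_le u : M u -> N (T u) <= N u.
Proof. by move=> Mu; apply: le_trans (NT_le_q Mu) (q_le Mu). Qed.

Lemma M_iter n u : M u -> M (iter n T u).
Proof. by move=> Mu; elim: n => //= n /MT. Qed.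

Lemma dot_iter n u v : dot (iter n T u) v = dot u (iter n T v).
Proof. by elim: n v => //= n IH v; rewrite sT IH -iterSr. Qed.

(** As <T^(k+2) u, u> = <T^k (T u), T u>, induction by steps of two reduces to k = 0, which is T <=
    1, and k = 1, which is T^2 <= T. *)
Lemma iter_moment_le k u : M u ->
  complex.Re (dot (iter k.+1 T u) u) <= complex.Re (dot (iter k T u) u).
Proof.
elim/ltn_ind: k u => -[|[|k]] IH u Mu; first exact: q_le.
  by rewrite /= sT; exact: NT_le_q.
have e j : dot (iter j.+2 T u) u = dot (iter j T (T u)) (T u).
  by rewrite -sT -iterS -iterSr.
by rewrite !e; apply: IH => //; exact: MT.
Qed.

Lemma iter_moment_ge0 k u : M u -> 0 <= complex.Re (dot (iter k T u) u).
Proof.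
elim/ltn_ind: k u => -[|[|k]] IH u Mu; first exact: N_ge0.
  exact: q_ge0.
have -> : dot (iter k.+2 T u) u = dot (iter k T (T u)) (T u).
  by rewrite -sT -iterS -iterSr.
by apply: IH => //; exact: MT.
Qed.

(** With the moments a_k = <T^k u, u>, the squared distance of T^m u and T^n u is a_2m + a_2n - 2
    a_(m+n). The moments are nonincreasing and nonnegative, hence converge, so the iterates are
    Cauchy; their limit is fixed because T is continuous on M. *)
Lemma iter_cvgH u : M u -> exists v, [/\ M v, cvgH dot (fun n => iter n T u) v & T v = v].
Proof.
move=> Mu; pose a k := complex.Re (dot (iter k T u) u).
have /cvg_ex[l al] : cvgn a.
  apply: nonincreasing_is_cvgn.
    by apply/nonincreasing_seqP => n; exact: iter_moment_le.
  by exists 0 => _ [n _ <-]; exact: iter_moment_ge0.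
have NE m n : N (iter m T u - iter n T u) = a (m + m)%N + a (n + n)%N - 2 * a (n + m)%N.
  have aE i j : a (i + j)%N = complex.Re (dot (iter j T u) (iter i T u)).
    by rewrite /a iterD dot_iter.
  by rewrite (NB ip) !aE.
have [v uv] : exists v, cvgH dot (fun n => iter n T u) v.
  apply: cV => e e0.
  have /cvgrPdist_le/(_ (e / 4)) := al; rewrite divr_gt0// => /(_ erefl)[n0 _ hn].
  exists n0 => m n n0m n0n; rewrite NE.
  have h k : (n0 <= k)%N -> `|l - a k| <= e / 4 by move=> /hn.
  have := h (m + m)%N; have := h (n + n)%N; have := h (n + m)%N.
  rewrite (leq_trans n0m (leq_addr _ _)) (leq_trans n0n (leq_addr _ _)).
  rewrite (leq_trans n0n (leq_addr _ _)) !ler_norml.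
  move=> /(_ erefl)/andP[? ?] /(_ erefl)/andP[? ?] /(_ erefl)/andP[? ?]; lra.
have Mv : M v by apply: (Mclosed _ uv) => n; exact: M_iter.
exists v; split => //; apply: (cvgH_unique ip (u := fun n => iter n.+1 T u)).
  apply: (@cvgH_le _ _ _ ip _ v T (T v) 1 uv) => n; rewrite mul1r -(linear_funB lT).
  by apply: NT_le; apply: MB => //; exact: M_iter.
by have := uv; rewrite /cvgH -(cvg_shiftS (fun n => N (iter n T u - v))).
Qed.

(* If no vector of M were fixed by T then T^n -> 0 strongly, so almost
   maximal unit vectors, being almost fixed, would be almost orthogonal to any
   finite family; but on the complement of a family of almost maximal trace
   the form is at most 1/2. *)
Lemma exists_fixed_vector tau :
  (forall n e, orthonormal_family n e -> (forall i, (i < n)%N -> M (e i)) ->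
     \sum_(i < n) q (e i) <= tau) ->
  (forall d, 0 < d -> exists u, [/\ M u, N u = 1 & 1 - d <= q u]) ->
  exists v, [/\ M v, N v = 1 & T v = v].
Proof.
move=> tr top; apply: contrapT => nofix.
have iter0 u : M u -> cvgH dot (fun n => iter n T u) 0.
  move=> /iter_cvgH[v [Mv uv Tv]]; have [v0|/eqP v0] := eqVneq v 0; first by rewrite -v0.
  exfalso; apply: nofix; have v_gt0 := N_gt0 ip v0.
  exists ((Num.sqrt (N v))^-1%:C *: v); split; [exact: MZ| |].
    by rewrite (NZ ip) sqn_real exprVn sqr_sqrtr ?N_ge0// mulVf// gt_eqF.
  by rewrite (linear_funZ lT) Tv.
(* A family whose trace is within 1/2 of the supremum leaves at most 1/2 to any unit vector of M
   orthogonal to it: otherwise adding that vector would exceed the supremum. *)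
pose A := [set x : R | exists n e, [/\ orthonormal_family n e,
  forall i, (i < n)%N -> M (e i) & x = \sum_(i < n) q (e i)]].
have supA : has_sup A.
  split; first by exists 0, 0%N, (fun=> 0); split => //; rewrite big_ord0.
  by exists tau => _ [n [e [on eM ->]]]; exact: tr.
have h2 : 0 < 1 / 2 :> R by lra.
have [_ [n [e [on eM ->]]] sup_lt] := sup_adherent h2 supA.
have half u : M u -> (forall i, (i < n)%N -> dot u (e i) = 0) -> q u <= 1 / 2 * N u.
  move=> Mu ue; have [->|/eqP u0] := eqVneq u 0.
    by rewrite (linear_fun0 lT) (dot0l ip) (N0 ip) mulr0.
  have u_gt0 := N_gt0 ip u0.
  pose a := (Num.sqrt (N u))^-1%:C : R[i].
  have aN : sqn a = (N u)^-1 by rewrite sqn_real exprVn sqr_sqrtr ?N_ge0.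
  have au1 : N (a *: u) = 1 by rewrite (NZ ip) aN mulVf// gt_eqF.
  have aue i : (i < n)%N -> dot (a *: u) (e i) = 0.
    by move=> ni; rewrite (dotZl ip) ue// mulr0.
  have : \sum_(i < n) q (e i) + q (a *: u) <= sup A.
    apply: sup_upper_bound => //; exists n.+1, (fun k => if (k < n)%N then e k else a *: u).
    split; first exact: orthonormalS.
      by move=> i _; case: ltnP => // ni; [exact: eM|exact: MZ].
    rewrite big_ord_recr/= ltnn; congr (_ + _).
    by apply: eq_bigr => i _; rewrite ltn_ord.
  rewrite qZ aN => h; have {}h : (N u)^-1 * q u <= 1 / 2 by lra.
  by move: h; rewrite ler_pdivrMl// mulrC.
have [m em] : exists m, \sum_(i < n) N (iter m T (e i)) <= 1 / 100.
  suff h k : (k <= n)%N -> \sum_(i < k) N (iter m T (e i)) @[m --> \oo] --> (0 : R).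
    have /cvgn0P/(_ (1 / 100)) := h n (leqnn n).
    have -> : 0 < 1 / 100 :> R by lra.
    by move=> /(_ erefl)[m hm]; exists m; apply: le_trans (hm _ (leqnn m)); exact: ler_norm.
  elim: k => [|k IH] kn; first by under eq_fun do rewrite big_ord0; exact: cvg_cst.
  under eq_fun do rewrite big_ord_recr/=.
  have h := iter0 _ (eM _ kn); rewrite /cvgH in h.
  under eq_fun do rewrite -[iter _ T (e k)]subr0.
  have h' := cvgD (IH (ltnW kn)) h; rewrite addr0 in h'; exact: h'.
(* Replacing u by T^m u costs at most m^2 d in squared norm, for each of n coefficients: K d in
   total. The choice of d makes K d + d = 1/1000. *)
pose K : R := n%:R * m%:R ^+ 2.
have K0 : 0 <= K by rewrite mulr_ge0// exprn_ge0.
pose d : R := (1000 * (K + 1))^-1.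
have d0 : 0 < d by rewrite invr_gt0; lra.
have Kd : K * d + d = 1 / 1000.
  by rewrite /d; field; rewrite gt_eqF//; lra.
have [u [Mu u1 qu]] := top _ d0.
have uTu : N (u - T u) <= d.
  have := NT_le_q Mu; rewrite (NB ip) u1 (Re_dotC ip (T u) u); lra.
have iter_near j : nrm dot (iter j T u - u) <= j%:R * nrm dot (u - T u).
  elim: j => [|j IH]; first by rewrite /= subrr /nrm (N0 ip) sqrtr0 mul0r.
  have -> : iter j.+1 T u - u = (T (iter j T u) - T u) - (u - T u).
    by rewrite opprB addrA subrK.
  apply: le_trans (nrmD ip _ _) _; rewrite (nrmN ip) -natr1 mulrDl mul1r lerD2r.
  apply: le_trans IH; rewrite /nrm ler_wsqrtr// -(linear_funB lT).
  by apply: NT_le; apply: MB => //; exact: M_iter.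
have {iter_near} uTmu : N (u - iter m T u) <= m%:R ^+ 2 * d.
  rewrite (NBC ip) -(nrm_sqr ip); apply: (@le_trans _ _ ((m%:R * nrm dot (u - T u)) ^+ 2)).
    by apply: lerXn2r; rewrite ?nnegrE ?mulr_ge0 ?nrm_ge0 ?iter_near.
  by rewrite exprMn (nrm_sqr ip) ler_wpM2l// exprn_ge0.
(* w is the projection of u on the span of the family. Its coefficients are small: T^m hardly moves
   u, and T^m (e i) is itself small. *)
pose c i := dot u (e i); pose w := \sum_(i < n) c i *: e i.
have cE i : (i < n)%N -> sqn (c i) <= 2 * (m%:R ^+ 2 * d) + 2 * N (iter m T (e i)).
  move=> ni; have -> : c i = dot (u - iter m T u) (e i) + dot u (iter m T (e i)).
    by rewrite -dot_iter -(dotDl ip) subrK.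
  apply: le_trans (sqnD_le _ _) _; rewrite lerD// ler_wpM2l//.
    apply: le_trans (dot_sqn_le ip _ _) _.
    by rewrite -[N (e i)]/(complex.Re (dot _ _)) on// eqxx/= mulr1.
  by apply: le_trans (dot_sqn_le ip _ _) _; rewrite u1 mul1r.
have Nw : N w <= 3 / 100.
  rewrite /w N_orthonormal_sum//.
  apply: (@le_trans _ _ (\sum_(i < n) (2 * (m%:R ^+ 2 * d) + 2 * N (iter m T (e i))))).
    by apply: ler_sum => i _; exact: cE.
  rewrite big_split/= -!mulr_sumr sumr_const card_ord -[d *+ n]mulr_natl.
  have -> : 2 * (m%:R ^+ 2 * (n%:R * d)) = 2 * (K * d) by rewrite /K; ring.
  by lra.
have Mw : M w by apply: (@Msum n (fun i => c i *: e i)) => i ni; apply/MZ/eM.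
have uw : dot u w = (N w)%:C.
  by rewrite /w N_orthonormal_sum// dot_orthonormal_sum.
have Nu' : N (u - w) = 1 - N w by rewrite (NB ip) uw u1/=; lra.
have := half (u - w) (MB Mu Mw); rewrite Nu'.
have ue' i : (i < n)%N -> dot (u - w) (e i) = 0.
  by move=> ni; rewrite (dotBl ip) /w orthonormal_sum// subrr.
move=> /(_ ue') qu'.
(* Positivity at (u - w) - 2 w bounds the cross term and gives q(u) <= 3/2 q(u - w) + 3 q(w) <= 3/4
   + 9/4 |w|^2. With |w|^2 <= 3/100 this is below 1 - d. *)
have := q_ge0 (MB (MB Mu Mw) (MZ 2%:C Mw)); rewrite !qB qZ sqn_real.
rewrite (dotZr ip) conjc_real RemulrC (linear_funB lT) (dotBl ip) raddfB/=.
move: qu'; rewrite qB; have := q_le Mw; have := N_ge0 ip w.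
have := mulr_ge0 K0 (ltW d0); lra.
Qed.

End Contraction.

End TopEigenvector.

Section TraceClassSpectralMeasure.
Variables (R : realType) (V : lmodType R[i]) (dot : V -> V -> R[i]).
Hypothesis ip : inner_product dot.
Local Notation N := (N dot).
Hypothesis cV : completeV dot.
Variables (T : V -> V) (tau : R).
Local Notation q u := (complex.Re (dot (T u) u)).
Hypotheses (lT : linear T) (sT : forall u v, dot (T u) v = dot u (T v)).
Hypotheses (q_ge0 : forall u, 0 <= q u) (trT : trace_bounded dot T tau).

Let unit_vector u : u <> 0 -> exists2 a : R, sqn a%:C = (N u)^-1 & N (a%:C *: u) = 1.
Proof.
move=> u0; have u_gt0 := N_gt0 ip u0; exists (Num.sqrt (N u))^-1.
  by rewrite sqn_real exprVn sqr_sqrtr ?N_ge0.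
by rewrite (NZ ip) sqn_real exprVn sqr_sqrtr ?N_ge0// mulVf// gt_eqF.
Qed.

Let q_unit u : N u = 1 -> q u <= tau.
Proof.
move=> u1; have := @trT 1 (fun=> u); rewrite big_ord_recl big_ord0 addr0.
by apply => -[|//] [|//] _ _ /=; rewrite (dotE ip) u1.
Qed.

Let q_le u : q u <= tau * N u.
Proof.
have [->|/eqP u0] := eqVneq u 0.
  by rewrite (linear_fun0 lT) (dot0l ip) (N0 ip) mulr0.
have [a aN /q_unit] := unit_vector u0.
by rewrite (qZ ip lT) aN ler_pdivrMl ?N_gt0// mulrC.
Qed.

(** A null vector of a nonnegative form lies in the kernel: test the form at c u - T u, with c
    larger than its bound [tau]. *)
Let T_eq0 u : q u <= 0 -> T u = 0.
Proof.
move=> qu; have {}qu : q u = 0 by apply/eqP; rewrite eq_le qu q_ge0.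
apply: (N_eq0 ip); apply/eqP; rewrite eq_le N_ge0// andbT.
pose c := `|tau| + 1; have c0 : 0 < c by rewrite ltr_pwDr.
have := q_ge0 (c%:C *: u - T u); rewrite (qB ip lT sT) (qZ ip lT) qu mulr0 add0r.
rewrite (linear_funZ lT) (dotZl ip) RemulrC.
rewrite -[complex.Re (dot (T u) (T u))]/(N (T u)) => h.
have h2 : q (T u) <= c * N (T u).
  apply: le_trans (q_le _) _; rewrite ler_wpM2r ?N_ge0// /c.
  by apply: le_trans (ler_norm _) _; rewrite lerDl.
have : c * N (T u) <= 0 by lra.
by rewrite pmulr_rle0.
Qed.

(** T preserves the orthogonal complement of l, as l consists of eigenvectors. There, T divided by
    the supremum of its form on unit vectors is a positive contraction, and its fixed vectors are
    eigenvectors for that supremum. If the form is nowhere positive on the complement, the dummy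
    pair (0, 0) is returned, so that the recursion in [eigensystem] never stops. *)
Lemma top_eigenvector (l : seq V) : (forall x, x \in l -> exists mu : R, T x = mu%:C *: x) ->
  exists (e : V) (la : R), [/\ T e = la%:C *: e, 0 <= la,
    (forall x, x \in l -> dot e x = 0), (N e = 1 \/ e = 0 /\ la = 0) &
    forall u, (forall x, x \in l -> dot u x = 0) -> q u <= la * N u].
Proof.
move=> lE; pose M u := forall x, x \in l -> dot u x = 0.
have [[u0 [Mu0 qu0]]|h] := pselect (exists u, M u /\ 0 < q u); last first.
  exists 0, 0; split => //.
  - by rewrite (linear_fun0 lT) scaler0.
  - by move=> x _; rewrite (dot0l ip).
  - by right.
  - move=> u Mu; rewrite mul0r leNgt; apply/negP => qu; apply: h.
    by exists u.
have MP a u v : M u -> M v -> M (a *: u + v).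
  by move=> Mu Mv x xl; rewrite (dotPl ip) Mu// Mv// mulr0 addr0.
have M0 : M 0 by move=> x _; rewrite (dot0l ip).
have MZ a u : M u -> M (a *: u) by move=> Mu; have := MP a _ _ Mu M0; rewrite addr0.
have Mcl (u : nat -> V) v : (forall n, M (u n)) -> cvgH dot u v -> M v.
  by move=> Mu uv x xl; apply: (cvgH_dot_eq ip uv); apply: nearW => n; exact: Mu.
have MT u : M u -> M (T u).
  move=> Mu x xl; have [mu xE] := lE _ xl.
  by rewrite sT xE (dotZr ip) Mu// mulr0.
pose A := [set q u | u in [set u | M u /\ N u = 1]].
have supA : has_sup A.
  split; last by exists tau => _ [u [Mu u1] <-]; exact: q_unit.
  have u0_neq0 : u0 <> 0.
    by move=> u0E; move: qu0; rewrite u0E (dot0r ip) ltxx.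
  have [a aN a1] := unit_vector u0_neq0.
  by exists (q (a%:C *: u0)); exists (a%:C *: u0) => //; split; first exact: MZ.
pose la := sup A.
have qla u : M u -> q u <= la * N u.
  move=> Mu; have [->|/eqP u0'] := eqVneq u 0.
    by rewrite (linear_fun0 lT) (dot0l ip) (N0 ip) mulr0.
  have [a aN a1] := unit_vector u0'.
  have : q (a%:C *: u) <= la.
    by apply: sup_upper_bound => //; exists (a%:C *: u) => //; split; first exact: MZ.
  by rewrite (qZ ip lT) aN ler_pdivrMl ?N_gt0// mulrC.
have la0 : 0 < la.
  have := lt_le_trans qu0 (qla _ Mu0); rewrite pmulr_lgt0//.
  rewrite lt_neqAle N_ge0// andbT eq_sym; apply/eqP => /(N_eq0 ip) u0E.
  by move: qu0; rewrite u0E (dot0r ip) ltxx.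
pose S u := la^-1%:C *: T u.
have lS : linear S.
  by move=> a u v; rewrite /S lT scalerDr !scalerA [_ * a]mulrC.
have sS u v : dot (S u) v = dot u (S v).
  by rewrite /S (dotZl ip) (dotZr ip) conjc_real sT.
have qS u : complex.Re (dot (S u) u) = la^-1 * q u.
  by rewrite /S (dotZl ip) RemulrC.
have MS u : M u -> M (S u) by move=> Mu; apply/MZ/MT.
have qS0 u : M u -> 0 <= complex.Re (dot (S u) u).
  by move=> _; rewrite qS mulr_ge0// invr_ge0 ltW.
have qSN u : M u -> complex.Re (dot (S u) u) <= N u.
  by move=> Mu; rewrite qS ler_pdivrMl// qla.
have := @exists_fixed_vector _ _ _ ip cV S M lS sS MP M0 Mcl MS qS0 qSN (la^-1 * tau).
case=> [n e on _|d d0|e [Me e1 Se]].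
- under eq_bigr do rewrite qS.
  by rewrite -mulr_sumr ler_wpM2l ?invr_ge0 ?(ltW la0)//; exact: trT.
- have ld0 : 0 < la * d by rewrite mulr_gt0.
  have [_ [u [Mu u1] <-] hu] := sup_adherent ld0 supA.
  exists u; split => //; rewrite qS ler_pdivlMl// mulrBr mulr1.
  exact: ltW.
exists e, la; split => //; [|exact: ltW|by left].
by rewrite -{2}Se /S scalerA -rmorphM divff ?gt_eqF// scale1r.
Qed.

Lemma eigensystem : exists (e : nat -> V) (la : nat -> R),
  [/\ forall n, T (e n) = (la n)%:C *: e n, forall n, 0 <= la n,
      forall m n, m <> n -> dot (e m) (e n) = 0,
      forall n, N (e n) = 1 \/ e n = 0 &
      forall u, (forall n, dot u (e n) = 0) -> T u = 0].
Proof.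
pose good (l : seq (V * R)) := forall p, p \in l -> T p.1 = p.2%:C *: p.1.
pose step (l : seq (V * R)) (p : V * R) := [/\ T p.1 = p.2%:C *: p.1, 0 <= p.2,
    (forall x, x \in l -> dot p.1 x.1 = 0), (N p.1 = 1 \/ p.1 = 0 /\ p.2 = 0) &
    forall u, (forall x, x \in l -> dot u x.1 = 0) -> q u <= p.2 * N u].
have ex l : exists p, good l -> step l p.
  have [gl|] := pselect (good l); last by exists (0, 0).
  have [|e [la [h1 h2 h3 h4 h5]]] := @top_eigenvector [seq p.1 | p <- l].
    by move=> _ /mapP[p pl ->]; exists p.2; exact: gl.
  exists (e, la) => _; split => //= [x xl|u ul]; first exact/h3/map_f.
  by apply: h5 => _ /mapP[p pl ->]; exact: ul.
pose f l := projT1 (cid (ex l)).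
have fP l : good l -> step l (f l) by exact: (projT2 (cid (ex l))).
pose L := fix L n := if n is n'.+1 then rcons (L n') (f (L n')) else [::].
have gL n : good (L n).
  elim: n => // n IH p; rewrite /= mem_rcons inE => /predU1P[->|]; last exact: IH.
  by have [] := fP _ IH.
pose e n := (f (L n)).1; pose la n := (f (L n)).2.
have eL m n : (m < n)%N -> f (L m) \in L n.
  elim: n => // n IH; rewrite ltnS leq_eqVlt /= mem_rcons inE => /predU1P[->|/IH ->].
    by rewrite eqxx.
  by rewrite orbT.
have Le n p : p \in L n -> exists2 m, (m < n)%N & p = f (L m).
  elim: n => // n IH; rewrite /= mem_rcons inE => /predU1P[->|/IH[m mn ->]].
    by exists n.
  by exists m => //; exact: ltnW.
have lt_orth m n : (m < n)%N -> dot (e n) (e m) = 0.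
  by move=> mn; have [_ _ h _ _] := fP _ (gL n); apply: h; exact: eL.
have qe n u : (forall m, (m < n)%N -> dot u (e m) = 0) -> q u <= la n * N u.
  move=> ue; have [_ _ _ _ h] := fP _ (gL n); apply: h => x /Le[m mn ->].
  exact: ue.
have Te n : T (e n) = (la n)%:C *: e n by have [] := fP _ (gL n).
have la0 n : 0 <= la n by have [] := fP _ (gL n).
have e01 n : N (e n) = 1 \/ e n = 0 /\ la n = 0 by have [] := fP _ (gL n).
exists e, la; split => //.
- move=> m n /eqP; rewrite neq_ltn => /orP[mn|]; last exact: lt_orth.
  by rewrite (dotC ip) lt_orth// rmorph0.
- by move=> n; have [|[]] := e01 n; [left|right].
(* The form at u is at most [la n * N u] for every n, so it suffices that some [la n] is below c. If
   none is, all [e n] are unit vectors, and n of them with n c > tau violate the trace bound. *)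
move=> u ue; apply: T_eq0; apply/ler_addgt0Pr => d d0; rewrite add0r.
pose c := d / (N u + 1).
have Nu1 : 0 < N u + 1 by rewrite ltr_wpDl// N_ge0.
have c0 : 0 < c by rewrite divr_gt0.
have [[n lan]|h] := pselect (exists n, la n < c).
  apply: le_trans (qe n u (fun m _ => ue m)) _.
  apply: (@le_trans _ _ (c * N u)); first by rewrite ler_wpM2r ?N_ge0// ltW.
  by rewrite /c mulrAC ler_pdivrMr// ler_wpM2l ?(ltW d0)// lerDl.
have {}h n : c <= la n by rewrite leNgt; apply/negP => ?; apply: h; exists n.
exfalso; pose n := (Num.truncn (tau / c)).+1.
have on : orthonormal_family dot n e.
  move=> i j _ _; have [->|ij] := eqVneq i j.
    rewrite (dotE ip); have [->//|[_ l0]] := e01 j.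
    by have := h j; rewrite l0 leNgt c0.
  move: ij; rewrite neq_ltn => /orP[ij|]; last exact: lt_orth.
  by rewrite (dotC ip) lt_orth// rmorph0.
have := trT on; apply/negP; rewrite -ltNge.
apply: (@lt_le_trans _ _ (n%:R * c)); first by rewrite -ltr_pdivrMr// truncnS_gt.
rewrite mulr_natl -[n in _ *+ n]card_ord -sumr_const; apply: ler_sum => i _.
rewrite Te (dotZl ip) RemulrC -[complex.Re _]/(N (e i)).
by have [->|[_ l0]] := e01 i; [rewrite mulr1|have := h i; rewrite l0 leNgt c0].
Qed.

End TraceClassSpectralMeasure.

(** * From a complete system of eigenvectors to a spectral measure *)

Section EigensystemSpectralMeasure.
Variables (R : realType) (V : lmodType R[i]) (dot : V -> V -> R[i]).
Hypothesis ip : inner_product dot.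
Local Notation N := (N dot).
Hypothesis cV : completeV dot.
Variables (T : V -> V) (e : nat -> V) (la : nat -> R).
Hypotheses (lT : linear T) (sT : forall u v, dot (T u) v = dot u (T v)).
Hypotheses (Te : forall n, T (e n) = (la n)%:C *: e n) (la0 : forall n, 0 <= la n)
  (e_orth : forall m n, m <> n -> dot (e m) (e n) = 0)
  (e01 : forall n, N (e n) = 1 \/ e n = 0)
  (e_total : forall u, (forall n, dot u (e n) = 0) -> T u = 0).
Implicit Types S : set R.

Let chi S k : R[i] := if `[< S (la k) >] then 1 else 0.
Let cf S u k : R[i] := chi S k * dot u (e k).
Let part S u n := \sum_(k < n) cf S u k *: e k.

Let sqn_cf S u k : sqn (cf S u k) = if `[< S (la k) >] then sqn (dot u (e k)) else 0.
Proof. by rewrite /cf /chi; case: ifP => _; rewrite ?mul1r// mul0r sqn0. Qed.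

Let cfE S u k : cf S u k * dot (e k) (e k) = cf S u k.
Proof.
rewrite (dotE ip); have [->|e0] := e01 k; first by rewrite mulr1.
by rewrite /cf e0 (dot0r ip) mulr0 mul0r.
Qed.

Let dot_part S u n k : dot (part S u n) (e k) = if (k < n)%N then cf S u k else 0.
Proof.
rewrite /part (dot_suml ip); case: ltnP => kn.
  rewrite (bigD1 (Ordinal kn))//= (dotZl ip) cfE big1 ?addr0// => i ik.
  rewrite (dotZl ip) e_orth ?mulr0//; apply/eqP.
  by move: ik; rewrite -val_eqE.
rewrite big1// => i _; rewrite (dotZl ip) e_orth ?mulr0//; apply/eqP.
by rewrite ltn_eqF// (leq_trans (ltn_ord i) kn).
Qed.

Let b S u n := \sum_(k < n) sqn (cf S u k).

Let dot_part_part S u m n : (n <= m)%N -> dot (part S u m) (part S u n) = (b S u n)%:C.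
Proof.
move=> nm; rewrite [part S u n]/part (dot_sumr ip) rmorph_sum; apply: eq_bigr => k _.
by rewrite (dotZr ip) dot_part (leq_trans (ltn_ord k) nm) mulrC mulcJ.
Qed.

Let N_part S u n : N (part S u n) = b S u n.
Proof. by rewrite -[LHS]/(complex.Re (dot _ _)) dot_part_part. Qed.

Let b_nd S u : nondecreasing_seq (b S u).
Proof.
apply/nondecreasing_seqP => n.
by rewrite /b big_ord_recr/= lerDl sqn_ge0.
Qed.

Let b_le S u n : b S u n <= N u.
Proof.
have := N_ge0 ip (u - part S u n); rewrite (NB ip) N_part.
have -> : dot u (part S u n) = (b S u n)%:C.
  rewrite /part (dot_sumr ip) rmorph_sum; apply: eq_bigr => k _.
  rewrite (dotZr ip) mulrC sqn_cf /cf /chi; case: ifP => _.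
    by rewrite !mul1r mulcJ.
  by rewrite mul0r conjc0 mulr0.
by rewrite /=; lra.
Qed.

Let b_cvg S u : cvgn (b S u).
Proof.
apply: nondecreasing_is_cvgn; first exact: b_nd.
by exists (N u) => _ [n _ <-].
Qed.

Let part_cvg S u : exists v, cvgH dot (part S u) v.
Proof.
apply: cV => d d0; have /cvg_ex[l bl] := @b_cvg S u.
have /cvgrPdist_le/(_ (d / 2)) := bl; rewrite divr_gt0// => /(_ erefl)[n0 _ hn].
exists n0; suff h m n : (n0 <= m)%N -> (n0 <= n)%N -> (n <= m)%N ->
    N (part S u m - part S u n) <= d.
  move=> m n hm hnn; have [nm|mn] := leqP n m; first exact: h.
  by rewrite (NBC ip); apply: h => //; exact: ltnW.
move=> n0m n0n nm; rewrite (NB ip) !N_part dot_part_part//=.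
have := hn _ n0m; have := hn _ n0n; rewrite /= !ler_norml => /andP[? ?] /andP[? ?].
lra.
Qed.

Let P S u := projT1 (cid (part_cvg S u)).
Let PP S u : cvgH dot (part S u) (P S u).
Proof. exact: (projT2 (cid (part_cvg S u))). Qed.

Let P_coef S u k : dot (P S u) (e k) = cf S u k.
Proof.
apply: (cvgH_dot_eq ip (PP S u)); exists k.+1 => // n /= kn.
by rewrite dot_part kn.
Qed.

Let P_perp S u w : (forall k, S (la k) -> dot w (e k) = 0) -> dot (P S u) w = 0.
Proof.
move=> we; apply: (cvgH_dot_eq ip (PP S u)); apply: nearW => n.
rewrite /part (dot_suml ip) big1// => k _; rewrite (dotZl ip) /cf /chi.
case: asboolP => [Sk|_]; last by rewrite !mul0r.
by rewrite (dotC ip w) we// rmorph0 mulr0.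
Qed.

(** The second condition says that v lies in the closed span of the [e k] with [la k] in S. With the
    coefficients it determines v, which makes linearity and idempotence of [P S] algebraic, without
    returning to the limits. *)
Let P_unique S u v : (forall k, dot v (e k) = cf S u k) ->
  (forall w, (forall k, S (la k) -> dot w (e k) = 0) -> dot v w = 0) -> v = P S u.
Proof.
move=> vc vp; apply/eqP; rewrite -subr_eq0; apply/eqP.
have de k : dot (v - P S u) (e k) = 0 by rewrite (dotBl ip) vc P_coef subrr.
apply: (dot_eq0 ip); rewrite (dotBl ip) vp; last by move=> k _; exact: de.
by rewrite P_perp ?subr0// => k _; exact: de.
Qed.

Let P_linear S : linear (P S).
Proof.
move=> a u v; apply/esym/P_unique => [k|w wS].
  by rewrite (dotPl ip) !P_coef /cf (dotPl ip); ring.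
by rewrite (dotPl ip) !P_perp// mulr0 addr0.
Qed.

Let P_idem S u : P S (P S u) = P S u.
Proof.
apply/esym/P_unique => [k|w wS]; last exact: P_perp.
by rewrite [RHS]/cf !P_coef /cf /chi; case: ifP; rewrite ?mul1r ?mul0r.
Qed.

Let P_sym S u v : dot (P S u) v = dot u (P S v).
Proof.
have h x y : dot (P S x) y = dot (P S x) (P S y).
  apply/eqP; rewrite -subr_eq0 -(dotBr ip) P_perp// => k Sk.
  by rewrite (dotBl ip) P_coef /cf /chi asboolT// mul1r subrr.
by rewrite h (dotC ip) -h -(dotC ip).
Qed.

(** Vectors orthogonal to all [e k] belong to the spectral value 0. A set that contains 0 must
    receive them, which complementation achieves. *)
Let E S u := if `[< S 0 >] then u - P (~` S) u else P S u.

Let P_proj S : orth_projection dot (P S).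
Proof. by split. Qed.

Let E_proj S : orth_projection dot (E S).
Proof.
rewrite /E; case: asboolP => _ //; split => [a u v|u|u v].
- by rewrite P_linear scalerBr opprD addrACA.
- rewrite (linear_funB (@P_linear _)) P_idem subrr subr0.
  by [].
- by rewrite (dotBl ip) (dotBr ip) P_sym.
Qed.

Let NP S u : dot (P S u) u = (N (P S u))%:C.
Proof. by rewrite -(dotE ip) -[in LHS]P_idem P_sym. Qed.

Let b_lim S u : b S u @ \oo --> N (P S u).
Proof.
have := cvgH_N ip (PP S u).
by under eq_fun do rewrite N_part.
Qed.

Let N_split S u : N (P setT u) = N (P S u) + N (P (~` S) u).
Proof.
have h := cvgD (@b_lim S u) (@b_lim (~` S) u).
apply: (cvgn_unique (@b_lim setT u)).
have -> : b setT u = b S u \+ b (~` S) u; last exact: h.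
apply/funext => n; rewrite /= /b -big_split/=; apply: eq_bigr => k _.
rewrite !sqn_cf asboolT//.
by case: asboolP => Sk; case: asboolP => // nSk; rewrite ?addr0 ?add0r.
Qed.

Let w u k : {nonneg R} := NngNum (sqn_ge0 (dot u (e k))).

Let w0_ge0 u : 0 <= N u - N (P setT u).
Proof. by rewrite subr_ge0; exact: (orth_projection_le ip). Qed.

Let w0 u : {nonneg R} := NngNum (w0_ge0 u).

Let atom (x : measurableTypeR R) : {measure set (measurableTypeR R) -> \bar R} := @dirac _ (measurableTypeR R) x R.

Let nuS u : {measure set (measurableTypeR R) -> \bar R} :=
  mseries (fun k => mscale (w u k) (atom (la k))) 0.

(** An atom of mass |<u, e_k>|^2 at each eigenvalue, and at 0 the squared norm of the part of u
    orthogonal to all [e k]. *)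
Let nu u : {measure set (measurableTypeR R) -> \bar R} :=
  measure_add (nuS u) (mscale (w0 u) (atom 0)).

Let nuSE u S : nuS u S = (N (P S u))%:E.
Proof.
rewrite /nuS /= /mseries; apply: cvg_lim => //.
rewrite [X in X @ _](_ : _ = EFin \o b S u); last first.
  apply/funext => n; rewrite /b /= -sumEFin big_mkord; apply: eq_bigr => k _.
  rewrite sqn_cf /mscale/= /dirac indicE.
  by case: asboolP => Sk; [rewrite mem_set// mule1|rewrite memNset// mule0].
by apply: cvg_EFin; [exact: nearW|exact: b_lim].
Qed.

Let nuE u S : nu u S = ((N (P S u)) + (if `[< S 0 >] then N u - N (P setT u) else 0))%:E.
Proof.
have -> : nu u S = (nuS u S + mscale (w0 u) (atom (0%R : R)) S)%E by rewrite -measure_addE.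
rewrite nuSE EFinD; congr (_ + _)%E.
rewrite /mscale/= /dirac indicE.
by case: asboolP => S0; [rewrite mem_set// mule1|rewrite memNset// mule0].
Qed.

Let E_dot S u : dot (E S u) u = (fine (nu u S))%:C.
Proof.
rewrite nuE/= /E; case: asboolP => S0; last by rewrite addr0 NP.
by rewrite (dotBl ip) (dotE ip) NP (N_split S u) -rmorphB; congr (_%:C); lra.
Qed.

(** By [e_total], T kills the part of u orthogonal to all [e k], so u may be replaced by the limit
    of its partial expansions. *)
Let moment_lim u :
  \sum_(k < n) la k * sqn (dot u (e k)) @[n --> \oo] --> complex.Re (dot (T u) u).
Proof.
have [h _] := cvgH_dot ip (T u) (PP setT u).
have -> : complex.Re (dot (T u) u) = complex.Re (dot (P setT u) (T u)).
  rewrite -sT; congr (complex.Re (dot _ _)).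
  have := e_total (u := u - P setT u); rewrite (linear_funB lT) => Tu.
  apply/eqP; rewrite -subr_eq0 Tu// => k.
  by rewrite (dotBl ip) P_coef /cf /chi asboolT// mul1r subrr.
rewrite [X in X @ _](_ : _ = fun n => complex.Re (dot (part setT u n) (T u)))//.
apply/funext => n; rewrite /part (dot_suml ip) raddf_sum; apply: eq_bigr => k _.
rewrite (dotZl ip) -sT Te (dotZl ip) /cf /chi asboolT// mul1r.
by rewrite mulrCA [dot (e k) u](dotC ip) mulcJ/= mul0r subr0.
Qed.

Let mid : measurable_fun [set: measurableTypeR R] (fun x : R => x%:E).
Proof. exact/measurable_EFinP. Qed.

Let int_abs u : (\int[nu u]_x `|x%:E| = (complex.Re (dot (T u) u))%:E)%E.
Proof.
have mabs : measurable_fun [set: measurableTypeR R] (fun x : R => `|x%:E|%E).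
  exact: measurableT_comp.
rewrite ge0_integral_measure_add//.
rewrite [X in (_ + X)%E](_ : _ = 0%E); last first.
  by rewrite ge0_integral_mscale// integral_dirac//= diracE in_setT normr0 mul1e mule0.
rewrite adde0 ge0_integral_measure_series//.
apply: cvg_lim => //.
rewrite [X in X @ _](_ : _ = EFin \o (fun n => \sum_(k < n) la k * sqn (dot u (e k)))).
  by apply: cvg_EFin; [exact: nearW|exact: moment_lim].
apply/funext => n /=; rewrite -sumEFin big_mkord; apply: eq_bigr => k _.
rewrite ge0_integral_mscale// integral_dirac//= diracE in_setT mul1e.
by rewrite ger0_norm// EFinM muleC.
Qed.

Lemma eigensystem_spectral_measure : exists F, is_spectral_measure dot T F.
Proof.
exists E; split => [S _|u|u]; first exact: E_proj.
  rewrite /E asboolT// setCT; suff <- : 0 = P set0 u by rewrite subr0.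
  apply: P_unique => [k|v _]; last by rewrite (dot0l ip).
  by rewrite (dot0l ip) /cf /chi asboolF// mul0r.
have nui : (nu u).-integrable setT (fun x : R => x%:E).
  by apply/integrableP; split => //; rewrite int_abs ltry.
exists (nu u); split => // [S mS|]; first by rewrite E_dot nuE.
suff -> : Rintegral (nu u) setT (fun x : R => x) = complex.Re (dot (T u) u).
  rewrite -[dot (T u) u]/(dot (T u) u); apply: complexP => //=.
  have := dotC ip (T u) u; rewrite -sT; case: (dot _ _) => a c [] /=; lra.
rewrite /Rintegral -[RHS]/(fine (complex.Re (dot (T u) u))%:E) -int_abs.
congr fine; apply: ae_eq_integral => //.
  by apply: measurableT_comp => //; exact/measurable_EFinP.
(* x and |x| differ only on the negative half-line, which carries no mass because the eigenvalues
   are nonnegative. *)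
exists `]-oo, 0[%classic; split => //.
  have Pneg : P `]-oo, 0[%classic u = 0.
    apply/esym/P_unique => [k|v _]; last by rewrite (dot0l ip).
    rewrite (dot0l ip) /cf /chi asboolF ?mul0r//= in_itv/= => /lt_geF.
    by rewrite la0.
  rewrite nuE Pneg (N0 ip) asboolF ?addr0//= in_itv/= ltxx.
  by [].
move=> x /= /not_implyP[_ xx]; rewrite in_itv/= ltNge; apply/negP => x0.
by apply: xx; rewrite ger0_norm.
Qed.

End EigensystemSpectralMeasure.

Lemma trace_class_spectral_measure (R : realType) (V : lmodType R[i])
    (dot : V -> V -> R[i]) (T : V -> V) (tau : R) :
  inner_product dot -> completeV dot -> linear T ->
  (forall u v, dot (T u) v = dot u (T v)) ->
  (forall u, 0 <= complex.Re (dot (T u) u)) -> trace_bounded dot T tau ->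
  exists F, is_spectral_measure dot T F.
Proof.
move=> ip cV lT sT T0 tr.
have [e [la [Te la0 eo e01 et]]] := eigensystem ip cV lT sT T0 tr.
exact: (eigensystem_spectral_measure ip cV lT sT Te la0 eo e01 et).
Qed.

(** * The Hilbert space of square-integrable functions *)

Section SquareIntegrableFunctions.
Variable R : realType.
Local Notation C := R[i].
Local Notation mu := (@lebesgue_measure R).
Local Notation RM := (measurableTypeR R).
Implicit Types (f g h : R -> C) (D : set RM).

Definition cmeasurable f : Prop :=
  measurable_fun [set: RM] (fun x => complex.Re (f x)) /\
  measurable_fun [set: RM] (fun x => complex.Im (f x)).

Definition energy f : \bar R := (\int[mu]_x (sqn (f x))%:E)%E.

Lemma aeS (P Q : RM -> Prop) : (forall x, P x -> Q x) ->
  {ae mu, forall x, P x} -> {ae mu, forall x, Q x}.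
Proof. by move=> PQ; apply: (@filterS _ _ (ae_filter_ringOfSetsType mu)). Qed.

Lemma aeS2 (P1 P2 Q : RM -> Prop) : (forall x, P1 x -> P2 x -> Q x) ->
  {ae mu, forall x, P1 x} -> {ae mu, forall x, P2 x} -> {ae mu, forall x, Q x}.
Proof. by move=> PQ; apply: (@filterS2 _ _ (ae_filter_ringOfSetsType mu)). Qed.

Lemma Lfun2P (g : R -> R) : g \in Lfun mu 2%:E <->
  measurable_fun [set: RM] g /\ (\int[mu]_x (g x ^+ 2)%:E < +oo)%E.
Proof.
split=> [gL|[mg ig]].
  have /integrableP[_] := Lfun2_integrable_sqr gL.
  move: gL; rewrite inE => /andP[]; rewrite inE/= => mg _ ig; split => //.
  move: ig; congr (_ < _)%E; apply: eq_integral => x _ /=.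
  by rewrite ger0_norm// sqr_ge0.
rewrite inE; apply/andP; split; first by rewrite inE.
rewrite inE/= /finite_norm unlock /Lnorm; apply: poweR_lty.
move: ig; congr (_ < _)%E; apply: eq_integral => x _ /=.
by rewrite powR_mulrn// real_normK// num_real.
Qed.

Lemma cmeasurable_sqn f : cmeasurable f -> measurable_fun [set: RM] (fun x => sqn (f x)).
Proof. by move=> [mr mi]; apply: measurable_funD; exact: measurable_funX. Qed.

Lemma sqintP f : f \in sqint (R:=R) <-> cmeasurable f /\ (energy f < +oo)%E.
Proof.
have mE (g : R -> R) : measurable_fun [set: RM] g ->
    measurable_fun [set: RM] (fun x => (g x ^+ 2)%:E).
  by move=> mg; apply/measurable_EFinP; exact: measurable_funX.
have enE : cmeasurable f -> energy f = (\int[mu]_x (complex.Re (f x) ^+ 2)%:E +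
    \int[mu]_x (complex.Im (f x) ^+ 2)%:E)%E.
  move=> [mr mi]; rewrite /energy -ge0_integralD//.
  - by move=> x _; rewrite lee_fin sqr_ge0.
  - exact: mE.
  - by move=> x _; rewrite lee_fin sqr_ge0.
  - exact: mE.
split=> [/andP[/Lfun2P[mr ir] /Lfun2P[mi ii]]|[mf ef]].
  by split=> //; rewrite enE//; exact: lte_add_pinfty.
have [mr mi] := mf; move: ef; rewrite enE// => ef.
by apply/andP; split; apply/Lfun2P; split => //; apply: le_lt_trans ef;
  rewrite ?leeDl ?leeDr// integral_ge0// => x _; rewrite lee_fin sqr_ge0.
Qed.

Lemma cmeasurableD f g : cmeasurable f -> cmeasurable g -> cmeasurable (fun x => f x + g x).
Proof.
by move=> [? ?] [? ?]; split; under eq_fun do rewrite raddfD/=; exact: measurable_funD.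
Qed.

Lemma cmeasurableM f g : cmeasurable f -> cmeasurable g -> cmeasurable (fun x => f x * g x).
Proof.
have ME (z w : C) : (complex.Re (z * w) = complex.Re z * complex.Re w - complex.Im z * complex.Im w) *
   (complex.Im (z * w) = complex.Re z * complex.Im w + complex.Im z * complex.Re w).
  by case: z w => [? ?] [? ?].
move=> [? ?] [? ?]; split; under eq_fun do rewrite ME.
  by apply: measurable_funB; exact: measurable_funM.
by apply: measurable_funD; exact: measurable_funM.
Qed.

Lemma cmeasurable_cst (a : C) : cmeasurable (fun=> a).
Proof. by split. Qed.

Lemma cmeasurable_real (f : R -> R) : measurable_fun [set: RM] f ->
  cmeasurable (fun x => (f x)%:C).
Proof. by []. Qed.

Lemma cmeasurableJ f : cmeasurable f -> cmeasurable (fun x => conjc (f x)).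
Proof.
have JE (z : C) : (complex.Re (conjc z) = complex.Re z) * (complex.Im (conjc z) = - complex.Im z).
  by case: z.
move=> [? ?]; split; under eq_fun do rewrite JE; first by [].
exact: measurableT_comp.
Qed.

Lemma cmeasurableZ (a : C) f : cmeasurable f -> cmeasurable (fun x => a * f x).
Proof. by move=> mf; apply: cmeasurableM => //; exact: cmeasurable_cst. Qed.

Lemma cmeasurableB f g : cmeasurable f -> cmeasurable g -> cmeasurable (fun x => f x - g x).
Proof.
move=> mf mg; under eq_fun do rewrite -mulN1r; apply: cmeasurableD => //.
exact: cmeasurableZ.
Qed.

Lemma cmeasurable_indic D : measurable D -> cmeasurable (fun x => (\1_D x)%:C).
Proof. by move=> mD; apply: cmeasurable_real; exact: measurable_indic. Qed.

Lemma cvg_sqn_ReIm (u : nat -> C) (l : C) : sqn (u n - l) @[n --> \oo] --> (0 : R) ->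
  complex.Re (u n) @[n --> \oo] --> complex.Re l /\
  complex.Im (u n) @[n --> \oo] --> complex.Im l.
Proof.
move=> h; have sq0 (f : nat -> R) a : (f n - a) ^+ 2 @[n --> \oo] --> (0 : R) ->
    f n @[n --> \oo] --> a.
  move=> fa; apply/subr_cvg0/cvgn0P => e e0.
  have e20 : 0 < e ^+ 2 by rewrite exprn_gt0.
  have /cvgn0P/(_ _ e20)[n0 hn] := fa; exists n0 => n /hn.
  by rewrite normrX ler_pXn2r// ?nnegrE ?normr_ge0// ltW.
split; apply: sq0; apply: cvg0_le h => n.
  by rewrite sqr_ge0/= -raddfB /sqn lerDl sqr_ge0.
by rewrite sqr_ge0/= -raddfB /sqn lerDr sqr_ge0.
Qed.

Lemma cvg_ReIm_sqn (u : nat -> C) (l : C) :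
  complex.Re (u n) @[n --> \oo] --> complex.Re l ->
  complex.Im (u n) @[n --> \oo] --> complex.Im l ->
  sqn (u n - l) @[n --> \oo] --> (0 : R).
Proof.
move=> /subr_cvg0 hr /subr_cvg0 hi.
have h := cvgD (cvgM hr hr) (cvgM hi hi).
rewrite mulr0 addr0 in h.
by under eq_fun do rewrite /sqn !raddfB/= !expr2; exact: h.
Qed.

Lemma cmeasurable_cvg (f_ : nat -> R -> C) f : (forall n, cmeasurable (f_ n)) ->
  (forall x, sqn (f_ n x - f x) @[n --> \oo] --> (0 : R)) -> cmeasurable f.
Proof.
move=> mf ff; split.
  apply: (measurable_fun_cvg (h := fun n x => complex.Re (f_ n x))) => [n|x _].
    by have [] := mf n.
  by have [] := cvg_sqn_ReIm (ff x).
apply: (measurable_fun_cvg (h := fun n x => complex.Im (f_ n x))) => [n|x _].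
  by have [] := mf n.
by have [] := cvg_sqn_ReIm (ff x).
Qed.

Lemma energy_ge0 f : (0 <= energy f)%E.
Proof. by apply: integral_ge0 => x _; rewrite lee_fin sqn_ge0. Qed.

Lemma ae_eq_energy f g : cmeasurable f -> cmeasurable g ->
  {ae mu, forall x, f x = g x} -> energy f = energy g.
Proof.
move=> mf mg fg; apply: ae_eq_integral => //.
- by apply/measurable_EFinP; exact: cmeasurable_sqn.
- by apply/measurable_EFinP; exact: cmeasurable_sqn.
- by apply: aeS fg => x /= -> _.
Qed.

Lemma le_energy f g : cmeasurable f -> cmeasurable g ->
  (forall x, sqn (f x) <= sqn (g x)) -> (energy f <= energy g)%E.
Proof.
move=> mf mg fg; have mE h : cmeasurable h ->
    measurable_fun [set: RM] (fun x => (sqn (h x))%:E).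
  by move=> mh; apply/measurable_EFinP; exact: cmeasurable_sqn.
by apply: ge0_le_integral => //; do ?[exact: mE | move=> x _; rewrite lee_fin ?sqn_ge0].
Qed.

Lemma energy_fatou (f_ : nat -> R -> C) f (c : \bar R) :
  (forall n, cmeasurable (f_ n)) -> cmeasurable f ->
  {ae mu, forall x, sqn (f_ n x - f x) @[n --> \oo] --> (0 : R)} ->
  (exists n0, forall n, (n0 <= n)%N -> (energy (f_ n) <= c)%E) -> (energy f <= c)%E.
Proof.
move=> mf_ mf ff [n0 ec].
have mE h : cmeasurable h -> measurable_fun [set: RM] (fun x => (sqn (h x))%:E).
  by move=> mh; apply/measurable_EFinP; exact: cmeasurable_sqn.
pose F n x := (sqn (f_ n x))%:E.
have -> : energy f = (\int[mu]_x limn_einf (F^~ x))%E.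
  apply: ae_eq_integral => //; first exact: mE.
    apply: measurableT_comp => //; apply: measurable_fun_limn_esup => n.
    by apply: measurableT_comp => //; exact: mE.
  apply: aeS ff => x h _ /=; apply/esym.
  suff Fx : F n x @[n --> \oo] --> (sqn (f x))%:E.
    by rewrite (cvg_limn_einf_sup Fx).
  apply: cvg_EFin; first exact: nearW.
  have [hr hi] := cvg_sqn_ReIm h.
  have h2 := cvgD (cvgM hr hr) (cvgM hi hi).
  rewrite -!expr2 in h2.
  rewrite [X in X @ _](_ : _ = fun n => complex.Re (f_ n x) * complex.Re (f_ n x) +
    complex.Im (f_ n x) * complex.Im (f_ n x)); first exact: h2.
  by apply/funext => n; rewrite /= /sqn !expr2.
apply: (le_trans (fatou mu _ _ _)) => //.
- by move=> n; exact: mE.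
- by move=> n x _; rewrite lee_fin sqn_ge0.
rewrite -[limn_einf _]/(limf_einf _ \oo) limf_einfE.
apply: ge_ereal_sup => _ [W [n1 _ n1W] <-].
apply: le_trans (ec _ (leq_maxl n0 n1)); apply: ereal_inf_lbound.
by exists (maxn n0 n1) => //; apply: n1W => /=; exact: leq_maxr.
Qed.

End SquareIntegrableFunctions.

Section ComplexIntegral.
Variable R : realType.
Local Notation C := R[i].
Local Notation mu := (@lebesgue_measure R).
Local Notation RM := (measurableTypeR R).
Implicit Types (f g h : R -> C) (D : set RM).

Definition cintegrable D f : Prop :=
  mu.-integrable D (fun x => (complex.Re (f x))%:E) /\
  mu.-integrable D (fun x => (complex.Im (f x))%:E).

Lemma cintegrableZ D (a : C) f : measurable D -> cintegrable D f ->
  cintegrable D (fun x => a * f x).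
Proof.
move=> mD [hr hi]; have [ar [ai ->]] : exists x y, a = (x +i* y)%C.
  by case: (a) => x y; exists x, y.
split.
  have -> : (fun x => (complex.Re ((ar +i* ai)%C * f x))%:E) = (fun x =>
      ar%:E * (complex.Re (f x))%:E - ai%:E * (complex.Im (f x))%:E)%E.
    by apply/funext => x; case: (f x) => p q.
  by apply: integrableB => //; exact: integrableZl.
have -> : (fun x => (complex.Im ((ar +i* ai)%C * f x))%:E) = (fun x =>
    ar%:E * (complex.Im (f x))%:E + ai%:E * (complex.Re (f x))%:E)%E.
  by apply/funext => x; case: (f x) => p q.
by apply: integrableD => //; exact: integrableZl.
Qed.

Lemma cintegralD D f g : measurable D -> cintegrable D f -> cintegrable D g ->
  cintegral D (fun x => f x + g x) = cintegral D f + cintegral D g.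
Proof.
move=> mD [? ?] [? ?]; apply: complexP => /=; rewrite -RintegralD//;
by apply: eq_Rintegral => x _; rewrite raddfD.
Qed.

Lemma cintegralZ D (a : C) f : measurable D -> cintegrable D f ->
  cintegral D (fun x => a * f x) = a * cintegral D f.
Proof.
move=> mD [hr hi]; have [ar [ai ->]] : exists x y, a = (x +i* y)%C.
  by case: (a) => x y; exists x, y.
have ir (y : R) := integrableZl mD y hr; have ii (y : R) := integrableZl mD y hi.
have reE : complex.Re (cintegral D (fun x => (ar +i* ai)%C * f x)) =
    Rintegral mu D (fun x => ar * complex.Re (f x) - ai * complex.Im (f x)).
  by apply: eq_Rintegral => x _; case: (f x).
have imE : complex.Im (cintegral D (fun x => (ar +i* ai)%C * f x)) =
    Rintegral mu D (fun x => ar * complex.Im (f x) + ai * complex.Re (f x)).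
  by apply: eq_Rintegral => x _; case: (f x).
have eR y := @RintegralZl _ _ _ mu D (fun x => complex.Re (f x)) y mD hr.
have eI y := @RintegralZl _ _ _ mu D (fun x => complex.Im (f x)) y mD hi.
pose fr y x := y * complex.Re (f x); pose fi y x := y * complex.Im (f x).
apply: complexP.
  by rewrite reE (@RintegralB _ _ _ mu D (fr ar) (fi ai) mD (ir ar) (ii ai)) eR eI.
by rewrite imE (@RintegralD _ _ _ mu D (fi ar) (fr ai) mD (ii ar) (ir ai)) eR eI.
Qed.

Lemma cintegralJ D f : measurable D -> cintegrable D f ->
  cintegral D (fun x => conjc (f x)) = conjc (cintegral D f).
Proof.
move=> mD [hr hi]; apply: complexP => /=.
  by apply: eq_Rintegral => x _; case: (f x).
rewrite -mulN1r -RintegralZl//; apply: eq_Rintegral => x _.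
by case: (f x) => p q /=; rewrite mulN1r.
Qed.

Lemma eq_cintegral D f g : (forall x, D x -> f x = g x) -> cintegral D f = cintegral D g.
Proof.
move=> fg; apply: complexP; apply: eq_Rintegral => x /set_mem Dx; rewrite fg//.
Qed.

Lemma ae_eq_cintegral D f g : measurable D -> cmeasurable f -> cmeasurable g ->
  {ae mu, forall x, f x = g x} -> cintegral D f = cintegral D g.
Proof.
move=> mD [? ?] [? ?] fg; apply: complexP; rewrite /= /Rintegral; congr fine;
  apply: ae_eq_integral => //; do ?[by apply/measurable_EFinP; exact: measurable_funTS];
  by apply: aeS fg => x /= ->.
Qed.

Lemma cintegral_mkcond D f : cintegral D f = cintegral setT (fun x => (\1_D x)%:C * f x).
Proof.
apply: complexP; rewrite /= Rintegral_mkcond; apply: eq_Rintegral => x _.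
  by rewrite /patch indicE; case: ifPn; case: (f x) => p q /=; rewrite ?mul1r ?mul0r subr0.
by rewrite /patch indicE; case: ifPn; case: (f x) => p q /=; rewrite ?mul1r ?mul0r addr0.
Qed.

Lemma sqintM f g : f \in sqint (R := R) -> g \in sqint (R := R) ->
  cintegrable setT (fun x => f x * g x).
Proof.
move=> /andP[fr fi] /andP[gr gi].
have h (p q : R -> R) : p \in Lfun mu 2%:E -> q \in Lfun mu 2%:E ->
    mu.-integrable setT (fun x => (p x * q x)%:E).
  by move=> pL qL; apply/Lfun1_integrable; exact: Lfun2_mul_Lfun1.
split.
  have -> : (fun x => (complex.Re (f x * g x))%:E) = (fun x =>
      (complex.Re (f x) * complex.Re (g x))%:E - (complex.Im (f x) * complex.Im (g x))%:E)%E.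
    by apply/funext => x; case: (f x) (g x) => [? ?] [? ?].
  by apply: integrableB => //; exact: h.
have -> : (fun x => (complex.Im (f x * g x))%:E) = (fun x =>
    (complex.Re (f x) * complex.Im (g x))%:E + (complex.Im (f x) * complex.Re (g x))%:E)%E.
  by apply/funext => x; case: (f x) (g x) => [? ?] [? ?].
by apply: integrableD => //; exact: h.
Qed.

Lemma sqint_cmeasurable f : f \in sqint (R := R) -> cmeasurable f.
Proof. by case/sqintP. Qed.

Lemma sqintJ f : f \in sqint (R := R) -> (fun x => conjc (f x)) \in sqint (R := R).
Proof.
move=> /sqintP[mf ef]; apply/sqintP; split; first exact: cmeasurableJ.
by move: ef; rewrite /energy; under [in X in _ -> X]eq_integral do rewrite sqnJ.
Qed.

Lemma sqint_le f g : g \in sqint (R := R) -> cmeasurable f ->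
  (forall x, sqn (f x) <= sqn (g x)) -> f \in sqint (R := R).
Proof.
move=> /sqintP[mg eg] mf fg; apply/sqintP; split => //.
exact: le_lt_trans (le_energy mf mg fg) eg.
Qed.

Lemma sqintD f g : f \in sqint (R := R) -> g \in sqint (R := R) ->
  (fun x => f x + g x) \in sqint (R := R).
Proof. exact: rpredD. Qed.

Lemma sqintZ (a : C) f : f \in sqint (R := R) -> (fun x => a * f x) \in sqint (R := R).
Proof. by move=> fL; exact: (rpredZ a fL). Qed.

End ComplexIntegral.

Section L2Elements.
Variable R : realType.
Local Notation C := R[i].
Local Notation mu := (@lebesgue_measure R).
Local Notation RM := (measurableTypeR R).
Local Notation L2 := (L2 R).
Implicit Types (f g h : R -> C) (u v : L2).
Local Open Scope quotient_scope.

Lemma L2_fun_sqint u : L2_fun u \in sqint (R := R).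
Proof. exact: (valP (repr u)). Qed.

Lemma L2_fun_cmeasurable u : cmeasurable (L2_fun u).
Proof. exact/sqint_cmeasurable/L2_fun_sqint. Qed.

Lemma L2_pi_eq (f g : sqfun R) : \pi_L2 f = \pi_L2 g <-> {ae mu, forall x, f x = g x}.
Proof.
have h : (\pi_L2 f == \pi_L2 g) = (f - g \in ae_zero (R := R)).
  by rewrite -Quotient.idealrBE.
split=> [/eqP|fg].
  by rewrite h => /asboolP; apply: aeS => x /eqP; rewrite subr_eq0 => /eqP.
apply/eqP; rewrite h; apply/asboolP; apply: aeS fg => x fg.
by rewrite -[LHS]/(f x - g x) fg subrr.
Qed.

Lemma L2_funP u v : {ae mu, forall x, L2_fun u x = L2_fun v x} -> u = v.
Proof. by move=> h; rewrite -[u]reprK -[v]reprK; apply/L2_pi_eq; exact: h. Qed.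

Lemma L2_fun_pi (f : sqfun R) : {ae mu, forall x, L2_fun (\pi_L2 f) x = f x}.
Proof. by apply/L2_pi_eq; rewrite reprK. Qed.

(** Here f may fail to be Borel, as for a cutoff by a Lebesgue set; the Borel function g guarantees
    that [toL2] does not take its default. *)
Lemma toL2E f g : g \in sqint (R := R) -> {ae mu, forall x, f x = g x} ->
  {ae mu, forall x, L2_fun (toL2 f) x = f x}.
Proof.
move=> gL fg; rewrite /toL2.
have : [set v : L2 | {ae mu, forall x, L2_fun v x = f x}] (\pi_L2 (SqFun gL)).
  by apply: aeS2 fg (L2_fun_pi (SqFun gL)) => x -> ->.
by move=> /(xgetI 0).
Qed.

Lemma toL2_sqint f : f \in sqint (R := R) -> {ae mu, forall x, L2_fun (toL2 f) x = f x}.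
Proof. by move=> fL; apply: (toL2E fL); exact: aeW. Qed.

Lemma toL2_fun u : toL2 (L2_fun u) = u.
Proof. by apply: L2_funP; exact/toL2_sqint/L2_fun_sqint. Qed.

Lemma L2_funD u v : {ae mu, forall x, L2_fun (u + v) x = L2_fun u x + L2_fun v x}.
Proof.
have <- : \pi_L2 (repr u + repr v) = u + v by rewrite pi_L2_add !reprK.
exact: L2_fun_pi.
Qed.

Lemma L2_funZ (a : C) u : {ae mu, forall x, L2_fun (a *: u) x = a * L2_fun u x}.
Proof. exact: L2_fun_pi. Qed.

Lemma L2_funN u : {ae mu, forall x, L2_fun (- u) x = - L2_fun u x}.
Proof. by rewrite -scaleN1r; apply: aeS (L2_funZ (-1) u) => x ->; rewrite mulN1r. Qed.

Lemma L2_funB u v : {ae mu, forall x, L2_fun (u - v) x = L2_fun u x - L2_fun v x}.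
Proof. by apply: aeS2 (L2_funD u (- v)) (L2_funN v) => x -> ->. Qed.

Lemma L2_fun0 : {ae mu, forall x, L2_fun (0 : L2) x = 0}.
Proof.
have := L2_funZ 0 (0 : L2); rewrite scale0r; apply: aeS => x ->.
by rewrite mul0r.
Qed.

Lemma dotL2_ae u v f g : cmeasurable f -> cmeasurable g ->
  {ae mu, forall x, L2_fun u x = f x} -> {ae mu, forall x, L2_fun v x = g x} ->
  dotL2 u v = cintegral setT (fun x => f x * conjc (g x)).
Proof.
move=> mf mg uf vg; apply: ae_eq_cintegral => //.
- by apply: cmeasurableM; [|apply: cmeasurableJ]; exact: L2_fun_cmeasurable.
- by apply: cmeasurableM => //; exact: cmeasurableJ.
- by apply: aeS2 uf vg => x -> ->.
Qed.

Lemma dotL2E u v : dotL2 u v = cintegral setT (fun x => L2_fun u x * conjc (L2_fun v x)).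
Proof. by []. Qed.

Lemma energy_fin u : energy (L2_fun u) \is a fin_num.
Proof.
by rewrite ge0_fin_numE ?energy_ge0//; have /sqintP[] := L2_fun_sqint u.
Qed.

Lemma dotL2_self u : dotL2 u u = (fine (energy (L2_fun u)))%:C.
Proof.
rewrite dotL2E; apply: complexP => /=.
  rewrite /Rintegral /energy; congr fine; apply: eq_integral => x _.
  by rewrite mulcJ.
transitivity (Rintegral mu setT (fun=> 0)); last by rewrite Rintegral_cst// mul0r.
by apply: eq_Rintegral => x _; rewrite mulcJ.
Qed.

Lemma NL2E u : (N (@dotL2 R) u)%:E = energy (L2_fun u).
Proof. by rewrite /N dotL2_self/= fineK// energy_fin. Qed.

Lemma dotL2_inner_product : inner_product (@dotL2 R).
Proof.
have sM u v := sqintM (L2_fun_sqint u) (sqintJ (L2_fun_sqint v)).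
have mf := L2_fun_cmeasurable.
split.
- move=> a u v w.
  rewrite (@dotL2_ae _ _ (fun x => a * L2_fun u x + L2_fun v x) (L2_fun w)) //.
  + rewrite !dotL2E -cintegralZ// -cintegralD//; last exact: cintegrableZ.
    by apply: eq_cintegral => x _; ring.
  + by apply: cmeasurableD => //; exact: cmeasurableZ.
  + by apply: aeS2 (L2_funD (a *: u) v) (L2_funZ a u) => x -> ->.
  + exact: aeW.
- move=> u v; rewrite !dotL2E -cintegralJ//; apply: eq_cintegral => x _.
  by rewrite rmorphM/= conjcK mulrC.
- move=> u; rewrite dotL2_self lecR fine_ge0//; exact: energy_ge0.
- move=> u; rewrite dotL2_self => /complexI e0.
  have {}e0 : energy (L2_fun u) = 0%E by rewrite -(fineK (energy_fin u)) e0.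
  apply: L2_funP; apply: aeS2 L2_fun0 (_ : {ae mu, forall x, L2_fun u x = 0}).
    by move=> x -> ->.
  have mE : measurable_fun [set: RM] (fun x => (sqn (L2_fun u x))%:E).
    by apply/measurable_EFinP; exact: cmeasurable_sqn.
  have : ae_eq mu setT (fun x => (sqn (L2_fun u x))%:E) (cst 0%E).
    apply/ae_eq_integral_abs => //; rewrite -[RHS]e0; apply: eq_integral => x _.
    by rewrite gee0_abs// lee_fin sqn_ge0.
  by apply: aeS => x /(_ I)[] /sqn_eq0.
Qed.

End L2Elements.

Section L2Complete.
Variable R : realType.
Local Notation C := R[i].
Local Notation mu := (@lebesgue_measure R).
Local Notation RM := (measurableTypeR R).
Local Notation L2 := (L2 R).
Local Notation N := (N (@dotL2 R)).
Implicit Types (f g h : R -> C) (u v : L2).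
Let ip := @dotL2_inner_product R.

Lemma NL2_ae u f : cmeasurable f -> {ae mu, forall x, L2_fun u x = f x} ->
  (N u)%:E = energy f.
Proof.
by move=> mf uf; rewrite NL2E; apply: ae_eq_energy => //; exact: L2_fun_cmeasurable.
Qed.

Lemma NB_toL2 u f : f \in sqint (R := R) ->
  (N (u - toL2 f))%:E = energy (fun x => L2_fun u x - f x).
Proof.
move=> fL; apply: NL2_ae.
  by apply: cmeasurableB; [exact: L2_fun_cmeasurable|exact: sqint_cmeasurable].
by apply: aeS2 (L2_funB u (toL2 f)) (toL2_sqint fL) => x -> ->.
Qed.

Lemma NB_energy u v : (N (u - v))%:E = energy (fun x => L2_fun u x - L2_fun v x).
Proof.
apply: NL2_ae; first by apply: cmeasurableB; exact: L2_fun_cmeasurable.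
exact: L2_funB.
Qed.

Lemma cvgn_of_geometric_increments (a : nat -> R) (K : R) :
  (forall k, `|a k.+1 - a k| <= K * 2^-1 ^+ k) -> cvgn a.
Proof.
move=> aK.
have -> : a = (fun n => a 0%N + series (telescope a) n).
  by apply/funext => n; exact: eq_sum_telescope.
apply: is_cvgD; first exact: is_cvg_cst.
apply: normed_cvg; apply: (@series_le_cvg _ _ (geometric K 2^-1)).
- by move=> n /=.
- by move=> n; apply: le_trans (aK n); exact: normr_ge0.
- by move=> n; exact: aK.
- by apply: is_cvg_geometric_series; rewrite ger0_norm ?invr_ge0// invf_lt1 ?ltr1n.
Qed.

Lemma geometric_esum_lty : (\sum_(0 <= k <oo) (4^-1 ^+ k : R)%:E < +oo)%E.
Proof.
have h := @cvg_geometric_series R 1 4^-1; rewrite ger0_norm ?invr_ge0// in h.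
have {}h := h (ltac:(by rewrite invf_lt1 ?ltr1n)).
suff h2 : (fun n => \sum_(0 <= k < n) (4^-1 ^+ k : R)%:E)%E @ \oo -->
    (1 / (1 - 4^-1) : R)%:E by rewrite (cvg_lim (@ereal_hausdorff R) h2) ltry.
rewrite [X in X @ _](_ : _ = EFin \o series (geometric 1 4^-1)).
  by apply: cvg_EFin; [exact: nearW|exact: h].
apply/funext => n; rewrite /= /series/= -sumEFin; apply: eq_bigr => k _.
by rewrite /geometric/= mul1r.
Qed.

(* Riesz-Fischer, through a subsequence whose increments are summable a.e. *)
Lemma L2_complete : completeV (@dotL2 R).
Proof.
move=> u uC.
pose r : R := 4^-1; have r0 : 0 < r by rewrite invr_gt0.
have rk0 k : 0 < r ^+ k * r ^+ k by rewrite mulr_gt0// exprn_gt0.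
pose phi k := projT1 (cid (uC _ (rk0 k))).
have phiP k : forall m n, (phi k <= m)%N -> (phi k <= n)%N -> N (u m - u n) <= r ^+ k * r ^+ k.
  exact: (projT2 (cid (uC _ (rk0 k)))).
(* A partial sum serves as an index beyond [phi j] for all j <= k at once. *)
pose psi k := (\sum_(i < k.+1) phi i)%N.
have psi_mono j k : (j <= k)%N -> (phi j <= psi k)%N.
  move=> jk; rewrite /psi; have jk1 : (j < k.+1)%N by [].
  by rewrite (bigD1 (Ordinal jk1))//= leq_addr.
pose g k := L2_fun (u (psi k)).
have mg k : cmeasurable (g k) by exact: L2_fun_cmeasurable.
have gB j k : (j <= k)%N -> (energy (fun x => g k x - g j x)%R <= (r ^+ j * r ^+ j)%:E)%E.
  by move=> jk; rewrite -NB_energy lee_fin; apply: phiP; exact: psi_mono.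
pose h k x := sqn (g k.+1 x - g k x).
(* The k-th increment has energy at most 16^-k. The weight 4^k leaves a series with finite integral,
   and where it converges the increments are of order 2^-k, hence summable. *)
pose H x := (\sum_(0 <= k <oo) (4 ^+ k * h k x)%:E)%E.
have mh k : measurable_fun [set: RM] (fun x => (4 ^+ k * h k x)%:E).
  apply/measurable_EFinP; apply: measurable_funM => //.
  exact: (cmeasurable_sqn (cmeasurableB (mg _) (mg _))).
have h0 k x : (0 <= (4 ^+ k * h k x)%:E)%E by rewrite lee_fin mulr_ge0 ?sqn_ge0// exprn_ge0.
have mH : measurable_fun [set: RM] H.
  by apply: ge0_emeasurable_sum => [k x _ _|k _]; [exact: h0|exact: mh].
have H0 x : (0 <= H x)%E by apply: nneseries_ge0 => n _ _; exact: h0.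
have iH : (\int[mu]_x H x < +oo)%E.
  rewrite integral_nneseries//; apply: le_lt_trans geometric_esum_lty.
  apply: lee_nneseries => [k _ _|k _]; first by apply: integral_ge0 => x _; exact: h0.
  under eq_integral do rewrite EFinM.
  rewrite ge0_integralZl//; last 2 first.
  - by apply/measurable_EFinP; exact: (cmeasurable_sqn (cmeasurableB (mg _) (mg _))).
  - by move=> x _; rewrite lee_fin sqn_ge0.
  apply: (@le_trans _ _ ((4 ^+ k)%:E * (r ^+ k * r ^+ k)%:E)%E).
    by apply: lee_wpmul2l; [rewrite lee_fin exprn_ge0|exact: gB].
  rewrite -EFinM lee_fin mulrA -exprMn divff// expr1n mul1r.
  by [].
pose G := [set x : RM | (H x < +oo)%E].
have mG : measurable G.
  by rewrite -[G]setTI; apply: emeasurable_fun_infty_o.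
have aeG : {ae mu, forall x, G x}.
  have Hi : mu.-integrable setT H.
    apply/integrableP; split => //; move: iH; congr (_ < _)%E.
    by apply: eq_integral => x _; rewrite gee0_abs// nneseries_ge0.
  apply: aeS (integrable_ae measurableT Hi) => x /(_ I).
  by rewrite ge0_fin_numE.
(* Cutting off to the full-measure set [G] makes the sequence converge at every point, which gives a
   measurable limit. *)
pose f_ k x := (\1_G x)%:C * g k x.
have mf_ k : cmeasurable (f_ k) by apply: cmeasurableM => //; exact: cmeasurable_indic.
have f_cvg x : exists l, sqn (f_ k x - l) @[k --> \oo] --> (0 : R).
  have [Gx|nGx] := pselect (G x); last first.
    exists 0; rewrite /f_ indicE memNset//.
    by under eq_fun do rewrite mul0r subr0 sqn0; exact: cvg_cst.
  pose M := fine (H x).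
  have Hfin : H x \is a fin_num by rewrite ge0_fin_numE.
  have hM k : h k x <= M * (2^-1 ^+ k) ^+ 2.
    have : ((4 ^+ k * h k x)%:E <= H x)%E.
      by rewrite /H (@nneseriesD1 _ _ k)// leeDl// nneseries_ge0// => n _ _; exact: h0.
    rewrite -(fineK Hfin) lee_fin -/M => hk.
    rewrite -exprM mulnC exprM -ler_pdivrMr ?exprn_gt0// -exprVn mulrC.
    have -> : (2^-1 ^+ 2)^-1 = 4 :> R by rewrite exprVn invrK -natrX.
    by [].
  have M0 : 0 <= M by rewrite fine_ge0.
  have incr (a : R) k : a ^+ 2 <= h k x -> `|a| <= (M + 1) * 2^-1 ^+ k.
    move=> ah; rewrite -(@ler_pXn2r _ 2)// ?nnegrE ?mulr_ge0 ?exprn_ge0 ?addr_ge0//.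
    rewrite real_normK ?num_real// exprMn.
    apply: le_trans (le_trans ah (hM k)) _; rewrite ler_wpM2r ?sqr_ge0//; nra.
  have cr : cvgn (fun k => complex.Re (g k x)).
    apply: (@cvgn_of_geometric_increments _ (M + 1)) => k; apply: incr.
    by rewrite -raddfB /h /sqn lerDl sqr_ge0.
  have ci : cvgn (fun k => complex.Im (g k x)).
    apply: (@cvgn_of_geometric_increments _ (M + 1)) => k; apply: incr.
    by rewrite -raddfB /h /sqn lerDr sqr_ge0.
  exists (limn (fun k => complex.Re (g k x)) +i* limn (fun k => complex.Im (g k x)))%C.
  rewrite /f_ indicE mem_set//; under eq_fun do rewrite mul1r.
  by apply: cvg_ReIm_sqn.
pose f x := projT1 (cid (f_cvg x)).
have ff x : sqn (f_ k x - f x) @[k --> \oo] --> (0 : R).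
  exact: (projT2 (cid (f_cvg x))).
have mf : cmeasurable f by exact: (cmeasurable_cvg mf_).
have fg j : (energy (fun x => f x - g j x)%R <= (r ^+ j * r ^+ j)%:E)%E.
  apply: (@energy_fatou _ (fun k x => g k x - g j x)).
  - by move=> k; exact: (cmeasurableB (mg _) (mg _)).
  - exact: cmeasurableB.
  - apply: aeS aeG => x Gx; have := ff x; rewrite /f_ indicE mem_set//.
    under [in X in X -> _]eq_fun do rewrite mul1r.
    by under [in X in _ -> X]eq_fun do rewrite opprB addrA subrK.
  - by exists j => n jn; exact: gB.
have fL : f \in sqint (R := R).
  have -> : f = (fun x => (f x - g 0%N x) + g 0%N x) by apply/funext => x; rewrite subrK.
  apply: sqintD; last exact: L2_fun_sqint.
  apply/sqintP; split; first exact: cmeasurableB.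
  by apply: le_lt_trans (fg 0%N) _; rewrite ltry.
exists (toL2 f); apply/(cvgHP ip) => e e0.
have [j je] : exists j, 4 * (r ^+ j * r ^+ j) <= e.
  have h4 : r ^+ n @[n --> \oo] --> (0 : R).
    by apply: cvg_expr; rewrite ger0_norm ?ltW// invf_lt1 ?ltr1n.
  have /cvgn0P/(_ (e / 4)) := h4; rewrite divr_gt0// => /(_ erefl)[j hj].
  exists j; have := hj _ (leqnn j); rewrite ger0_norm ?exprn_ge0 ?(ltW r0)// => h5.
  have rj1 : r ^+ j <= 1 by rewrite exprn_ile1 ?(ltW r0)// invf_le1 ?ler1n.
  have rj0 : 0 <= r ^+ j by rewrite exprn_ge0 ?(ltW r0).
  nra.
exists (phi j) => n jn.
have -> : u n - toL2 f = (u n - u (psi j)) + (u (psi j) - toL2 f) by rewrite addrA subrK.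
have h1 := phiP j n (psi j) jn (psi_mono j j (leqnn j)).
have h2 : N (u (psi j) - toL2 f) <= r ^+ j * r ^+ j.
  rewrite -lee_fin NB_toL2//; apply: le_trans (fg j).
  rewrite /energy le_eqVlt; apply/orP; left; apply/eqP; apply: eq_integral => x _.
  by rewrite -sqnN opprB.
have := ND_le ip (u n - u (psi j)) (u (psi j) - toL2 f); lra.
Qed.

End L2Complete.

Section TimeProjection.
Variable R : realType.
Local Notation C := R[i].
Local Notation mu := (@lebesgue_measure R).
Local Notation RM := (measurableTypeR R).
Local Notation L2 := (L2 R).
Local Notation N := (N (@dotL2 R)).
Implicit Types (f g h : R -> C) (u v : L2) (D : set RM).
Let ip := @dotL2_inner_product R.

Local Notation aeeq f g := {ae mu, forall x : R, f x = g x}.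

Lemma ae_eqC f g : aeeq f g -> aeeq g f.
Proof. by apply: aeS => x ->. Qed.

Lemma ae_eqT f g h : aeeq f g -> aeeq g h -> aeeq f h.
Proof. by move=> fg gh; apply: aeS2 fg gh => x -> ->. Qed.

Lemma ae_eq_op (op : R -> C -> C -> C) f g f' g' : aeeq f f' -> aeeq g g' ->
  {ae mu, forall x, op x (f x) (g x) = op x (f' x) (g' x)}.
Proof. by move=> ff gg; apply: aeS2 ff gg => x -> ->. Qed.

Lemma toL2D f g : f \in sqint (R := R) -> g \in sqint (R := R) ->
  toL2 (fun x => f x + g x) = toL2 f + toL2 g.
Proof.
move=> fL gL; apply: L2_funP; apply: ae_eqT (toL2_sqint (sqintD fL gL)) _.
apply/ae_eqC/(ae_eqT (L2_funD (toL2 f) (toL2 g))).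
exact: (ae_eq_op (fun _ => +%R) (toL2_sqint fL) (toL2_sqint gL)).
Qed.

Lemma toL2Z (a : C) f : f \in sqint (R := R) -> toL2 (fun x => a * f x) = a *: toL2 f.
Proof.
move=> fL; apply: L2_funP; apply: ae_eqT (toL2_sqint (sqintZ a fL)) _.
apply/ae_eqC/(ae_eqT (L2_funZ a (toL2 f))).
exact: (ae_eq_op (fun _ y _ => a * y) (toL2_sqint fL) (toL2_sqint fL)).
Qed.

Lemma toL2B f g : f \in sqint (R := R) -> g \in sqint (R := R) ->
  toL2 (fun x => f x - g x) = toL2 f - toL2 g.
Proof.
move=> fL gL; rewrite -scaleN1r -toL2Z// -toL2D//; last exact: sqintZ.
by congr toL2; apply/funext => x; rewrite mulN1r.
Qed.

Lemma toL20 : toL2 (fun=> 0) = 0 :> L2.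
Proof.
apply: L2_funP; apply: ae_eqT (ae_eqC (L2_fun0 R)).
exact: (toL2_sqint (rpred0 (sqint (R := R)))).
Qed.

Lemma toL2_sum I (r : seq I) (F : I -> R -> C) : (forall i, F i \in sqint (R := R)) ->
  (fun x => \sum_(i <- r) F i x) \in sqint (R := R) /\
  toL2 (fun x => \sum_(i <- r) F i x) = \sum_(i <- r) toL2 (F i).
Proof.
move=> FL; elim: r => [|i r [IH1 IH2]].
  rewrite big_nil; have -> : (fun x => \sum_(i <- [::]) F i x) = (fun=> 0).
    by apply/funext => x; rewrite big_nil.
  by split; [exact: (rpred0 (sqint (R := R)))|exact: toL20].
have -> : (fun x => \sum_(j <- i :: r) F j x) = (fun x => F i x + \sum_(j <- r) F j x).
  by apply/funext => x; rewrite big_cons.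
by split; [exact: sqintD|rewrite toL2D// IH2 big_cons].
Qed.

Lemma sqint_indicM D f : measurable D -> f \in sqint (R := R) ->
  (fun x => (\1_D x)%:C * f x) \in sqint (R := R).
Proof.
move=> mD fL; apply: (sqint_le fL).
  by apply: cmeasurableM; [exact: cmeasurable_indic|exact: sqint_cmeasurable].
move=> x; rewrite sqnM sqn_real indicE; case: (x \in D) => /=.
  by rewrite expr1n mul1r.
by rewrite expr0n mul0r sqn_ge0.
Qed.

Lemma sqint_indic D : measurable D -> (mu D < +oo)%E ->
  (fun x => (\1_D x)%:C) \in sqint (R := R).
Proof.
move=> mD Dfin; apply/sqintP; split; first exact: cmeasurable_indic.
move: Dfin; congr (_ < _)%E; rewrite -[D in LHS]setIT -integral_indic//.
apply: eq_integral => x _; rewrite sqn_real indicE.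
by case: (x \in D); rewrite ?expr1n ?expr0n.
Qed.

Lemma energy_indic D : measurable D -> energy (fun x => (\1_D x)%:C) = mu D.
Proof.
move=> mD; rewrite -[D in RHS]setIT -integral_indic//.
apply: eq_integral => x _; rewrite sqn_real indicE.
by case: (x \in D); rewrite ?expr1n ?expr0n.
Qed.

(** A Lebesgue set is a Borel set together with a part of a null set. The inequality of measures
    lets the Borel set inherit finite measure and nullity. *)
Lemma lebesgue_measurable_borel (E : set R) : lebesgue_measurable E ->
  exists D : set RM, [/\ measurable D, (mu D <= completed_lebesgue_measure E)%E &
    {ae mu, forall x, \1_E x = \1_D x :> R}].
Proof.
rewrite /lebesgue_measurable -completed_caratheodory_measurable.
rewrite g_sigma_completed_algebra_genE => -[D mD [M negM <-]].
exists D; split => //.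
  by apply: le_outer_measure; exact: subsetUl.
case: negM => A [mA A0 MA]; exists A; split => // x /= h.
apply: MA; apply: contrapT => nMx; apply: h.
rewrite !indicE; congr (_%:R); congr nat_of_bool; apply/idP/idP; rewrite !inE.
  by case.
by left.
Qed.

Lemma borel_lebesgue_measurable D : measurable D -> lebesgue_measurable D.
Proof. exact: sub_caratheodory. Qed.

Section Projection.
Variable E : set R.
Hypothesis mE : lebesgue_measurable E.

Lemma time_projE u :
  {ae mu, forall x, L2_fun (time_proj E u) x = (\1_E x)%:C * L2_fun u x}.
Proof.
have [D [mD _ ED]] := lebesgue_measurable_borel mE.
apply: (toL2E (sqint_indicM mD (L2_fun_sqint u))).
by apply: aeS ED => x ->.
Qed.

Lemma time_proj_linear : linear (time_proj E).
Proof.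
move=> a u v; apply: L2_funP; apply: ae_eqT (time_projE (a *: u + v)) _.
have au : {ae mu, forall x, L2_fun (a *: u + v) x = a * L2_fun u x + L2_fun v x}.
  apply: ae_eqT (L2_funD (a *: u) v) _.
  by apply: aeS (L2_funZ a u) => x ->.
have aE : {ae mu, forall x, L2_fun (a *: time_proj E u + time_proj E v) x =
    a * L2_fun (time_proj E u) x + L2_fun (time_proj E v) x}.
  apply: ae_eqT (L2_funD (a *: time_proj E u) (time_proj E v)) _.
  by apply: aeS (L2_funZ a (time_proj E u)) => x ->.
apply/ae_eqC/(ae_eqT aE).
apply: ae_eqT (ae_eq_op (fun _ p q => a * p + q) (time_projE u) (time_projE v)) _.
by apply: aeS au => x ->; ring.
Qed.

Lemma time_proj_idem u : time_proj E (time_proj E u) = time_proj E u.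
Proof.
apply: L2_funP; apply: aeS2 (time_projE (time_proj E u)) (time_projE u) => x -> ->.
by rewrite indicE; case: (x \in E); rewrite ?mul1r ?mul0r.
Qed.

Lemma time_proj_sym u v : dotL2 (time_proj E u) v = dotL2 u (time_proj E v).
Proof.
have [D [mD _ ED]] := lebesgue_measurable_borel mE.
have mDf w : cmeasurable (fun x => (\1_D x)%:C * L2_fun w x).
  exact/sqint_cmeasurable/(sqint_indicM mD (L2_fun_sqint w)).
have tD w : {ae mu, forall x, L2_fun (time_proj E w) x = (\1_D x)%:C * L2_fun w x}.
  by apply: aeS2 (time_projE w) ED => x -> ->.
rewrite (dotL2_ae (mDf u) (L2_fun_cmeasurable v) (tD u)); last exact: aeW.
rewrite (dotL2_ae (L2_fun_cmeasurable u) (mDf v) _ (tD v)); last exact: aeW.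
by apply: eq_cintegral => x _; rewrite conjc_realM; ring.
Qed.

Lemma time_proj_orth : orth_projection (@dotL2 R) (time_proj E).
Proof. by split; [exact: time_proj_linear|exact: time_proj_idem|exact: time_proj_sym]. Qed.

End Projection.

Lemma time_proj_bigcup (K : nat) (E : set R) (E_ : 'I_K -> set R) :
  lebesgue_measurable E -> (forall i, lebesgue_measurable (E_ i)) ->
  trivIset setT E_ -> E = \bigcup_i E_ i ->
  forall u, time_proj E u = \sum_(i < K) time_proj (E_ i) u.
Proof.
move=> mE mE_ triv EE u; apply: L2_funP.
have sumE (r : seq 'I_K) : {ae mu, forall x, L2_fun (\sum_(i <- r) time_proj (E_ i) u) x =
    \sum_(i <- r) (\1_(E_ i) x)%:C * L2_fun u x}.
  elim: r => [|i r IH]; first by rewrite big_nil; apply: aeS (L2_fun0 R) => x ->; rewrite big_nil.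
  rewrite big_cons.
  apply: ae_eqT (L2_funD (time_proj (E_ i) u) (\sum_(j <- r) time_proj (E_ j) u)) _.
  apply: ae_eqT (ae_eq_op (fun _ => +%R) (time_projE (mE_ i) u) IH) _.
  by apply: aeW => x; rewrite big_cons.
apply: ae_eqT (time_projE mE u) (ae_eqC (ae_eqT (sumE (index_enum 'I_K)) _)).
apply: aeW => x.
rewrite -mulr_suml -rmorph_sum; congr (_%:C * _); apply/esym.
rewrite EE !indicE; case: (boolP (x \in _)) => [|xE].
  rewrite inE => -[i _ Eix]; rewrite (bigD1 i)//= indicE mem_set// big1 ?addr0// => j ji.
  rewrite indicE memNset// => Ejx; move/eqP : ji; apply.
  by apply: (triv j i) => //; exists x.
rewrite big1// => i _; rewrite indicE memNset// => Eix.
by move: xE; rewrite notin_setE; apply; exists i.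
Qed.

Lemma time_proj_null (E : set R) : lebesgue_measurable E ->
  completed_lebesgue_measure E = 0%E -> forall u, time_proj E u = 0.
Proof.
move=> mE E0 u; apply: L2_funP.
have [D [mD DE ED]] := lebesgue_measurable_borel mE.
have D0 : mu D = 0%E by apply/eqP; rewrite eq_le measure_ge0 andbT -E0.
have D00 : {ae mu, forall x, \1_D x = 0 :> R}.
  exists D; split => // x /= Dx; apply: contrapT => nDx; apply: Dx.
  by rewrite indicE memNset.
apply: ae_eqT (time_projE mE u) (ae_eqC (ae_eqT (L2_fun0 R) _)).
by apply: aeS2 ED D00 => x -> ->; rewrite mul0r.
Qed.

End TimeProjection.

Section Closure.
Variables (R : realType) (V : lmodType R[i]) (dot : V -> V -> R[i]).
Hypothesis ip : inner_product dot.
Local Notation N := (N dot).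
Variable S : V -> Prop.
Hypothesis SP : forall a u v, S u -> S v -> S (a *: u + v).

Definition closureH u : Prop := forall e : R, 0 < e -> exists2 v, S v & N (u - v) <= e.

Lemma sub_closureH u : S u -> closureH u.
Proof. by move=> Su e e0; exists u => //; rewrite subrr (N0 ip) ltW. Qed.

Lemma closureHP a u v : closureH u -> closureH v -> closureH (a *: u + v).
Proof.
move=> cu cv e e0; pose k := 4 * (sqn a + 1).
have k0 : 0 < k by rewrite mulr_gt0// ltr_wpDl// sqn_ge0.
have ek0 : 0 < e / k by rewrite divr_gt0.
have e40 : 0 < e / 4 by rewrite divr_gt0.
have [s Ss us] := cu _ ek0; have [t St vt] := cv _ e40.
exists (a *: s + t); first exact: SP.
have -> : a *: u + v - (a *: s + t) = a *: (u - s) + (v - t).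
  by rewrite scalerBr opprD addrACA.
have h1 : sqn a * N (u - s) <= e / 4.
  apply: (@le_trans _ _ (sqn a * (e / k))); first by rewrite ler_wpM2l ?sqn_ge0.
  have := divfK (negbT (gt_eqF k0)) e; have := ltW ek0; rewrite /k; nra.
have := ND_le ip (a *: (u - s)) (v - t); rewrite (NZ ip); lra.
Qed.

Lemma closureH_closed u : (forall e : R, 0 < e -> exists2 v, closureH v & N (u - v) <= e) ->
  closureH u.
Proof.
move=> h e e0; have e40 : 0 < e / 4 by rewrite divr_gt0.
have [v cv uv] := h _ e40; have [w Sw vw] := cv _ e40.
exists w => //; have -> : u - w = (u - v) + (v - w) by rewrite addrA subrK.
have := ND_le ip (u - v) (v - w); lra.
Qed.

Lemma closureH_cvg (s : nat -> V) u : (forall n, closureH (s n)) -> cvgH dot s u -> closureH u.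
Proof.
move=> cs su; apply: closureH_closed => e e0.
have [n hn] := (cvgHP ip s u).1 su e e0; exists (s n) => //.
by rewrite (NBC ip); exact: hn.
Qed.

Lemma closureH_seq u : closureH u -> exists s : nat -> V, (forall n, S (s n)) /\ cvgH dot s u.
Proof.
move=> cu; have h n : exists v, S v /\ N (u - v) <= n.+1%:R^-1.
  by have [|v Sv uv] := cu n.+1%:R^-1; [rewrite invr_gt0|exists v].
exists (fun n => projT1 (cid (h n))); split=> [n|].
  by have [] := projT2 (cid (h n)).
apply: (@cvg0_le R _ (fun n => n.+1%:R^-1)); last exact: cvg_harmonic.
by move=> n; rewrite N_ge0//= (NBC ip); have [] := projT2 (cid (h n)).
Qed.

End Closure.

Section StepFunctionsDense.
Variable R : realType.
Local Notation C := R[i].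
Local Notation mu := (@lebesgue_measure R).
Local Notation RM := (measurableTypeR R).
Local Notation L2 := (L2 R).
Local Notation N := (N (@dotL2 R)).
Implicit Types (f g h : R -> C) (u v : L2) (D E : set RM).
Let ip := @dotL2_inner_product R.

Lemma energy_dct (f_ : nat -> R -> C) f g : (forall k, cmeasurable (f_ k)) ->
  cmeasurable f -> g \in sqint (R := R) ->
  (forall k x, sqn (f_ k x - f x) <= sqn (g x)) ->
  (forall x, sqn (f_ k x - f x) @[k --> \oo] --> (0 : R)) ->
  energy (fun x => f_ k x - f x) @[k --> \oo] --> 0%E.
Proof.
move=> mf_ mf gL fg ff; have [mg eg] := (sqintP g).1 gL.
have mE h : cmeasurable h -> measurable_fun [set: RM] (fun x => (sqn (h x))%:E).
  by move=> mh; apply/measurable_EFinP; exact: cmeasurable_sqn.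
have gi : mu.-integrable setT (fun x => (sqn (g x))%:E).
  apply/integrableP; split; first exact: mE.
  move: eg; congr (_ < _)%E; apply: eq_integral => x _.
  by rewrite gee0_abs// lee_fin sqn_ge0.
have [] := @dominated_convergence _ _ _ mu setT measurableT
  (fun k x => (sqn (f_ k x - f x))%:E) (fun=> 0%E) (fun x => (sqn (g x))%:E).
- by move=> k; exact: (mE _ (cmeasurableB (mf_ k) mf)).
- exact: measurable_cst.
- by apply: aeW => x _; apply: cvg_EFin; [exact: nearW|exact: ff].
- exact: gi.
- by apply: aeW => x k _; rewrite gee0_abs lee_fin ?sqn_ge0.
by move=> _ _; rewrite integral0.
Qed.

Lemma cvgH_dct (f_ : nat -> R -> C) f g : (forall k, f_ k \in sqint (R := R)) ->
  f \in sqint (R := R) -> g \in sqint (R := R) ->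
  (forall k x, sqn (f_ k x - f x) <= sqn (g x)) ->
  (forall x, sqn (f_ k x - f x) @[k --> \oo] --> (0 : R)) ->
  cvgH (@dotL2 R) (fun k => toL2 (f_ k)) (toL2 f).
Proof.
move=> fL_ fL gL fg ff; rewrite /cvgH.
have h := energy_dct (fun k => sqint_cmeasurable (fL_ k)) (sqint_cmeasurable fL) gL fg ff.
have {}h := fine_cvg h.
suff -> : (fun k => N (toL2 (f_ k) - toL2 f)) =
    fine \o (fun k => energy (fun x => f_ k x - f x)) by exact: h.
apply/funext => k /=; rewrite -[LHS]/(fine (N _)%:E); congr fine.
apply: NL2_ae; first exact: (cmeasurableB (sqint_cmeasurable (fL_ k)) (sqint_cmeasurable fL)).
apply: ae_eqT (L2_funB (toL2 (f_ k)) (toL2 f)) _.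
by apply: aeS2 (toL2_sqint (fL_ k)) (toL2_sqint fL) => x /= -> ->.
Qed.

Lemma eventually_cst_sqn (z : nat -> C) l n0 : (forall n, (n0 <= n)%N -> z n = l) ->
  sqn (z n - l) @[n --> \oo] --> (0 : R).
Proof.
move=> h; apply: cvg_near_cst; exists n0 => // n /= /h ->.
by rewrite subrr sqn0.
Qed.

(** Half-open intervals are stable under intersection, as Dynkin's theorem and truncation require,
    and generate the Borel sets. *)
Definition istep (a b : R) : L2 := toL2 (fun x => (\1_(`]a, b]%classic) x)%:C).

Definition step_fun u : Prop := exists s : seq (C * (R * R)),
  u = \sum_(p <- s) p.1 *: istep p.2.1 p.2.2.

Lemma step_funP a u v : step_fun u -> step_fun v -> step_fun (a *: u + v).
Proof.
move=> [s ->] [t ->]; exists ([seq (a * p.1, p.2) | p <- s] ++ t).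
rewrite big_cat big_map/= scaler_sumr; congr (_ + _).
by apply: eq_bigr => p _; rewrite scalerA.
Qed.

Lemma step_fun_istep a b : step_fun (istep a b).
Proof. by exists [:: (1, (a, b))]; rewrite big_seq1 scale1r. Qed.

Lemma step_fun0 : step_fun 0.
Proof. by exists [::]; rewrite big_nil. Qed.

Let cl := closureH (@dotL2 R) step_fun.
Let clP a u v : cl u -> cl v -> cl (a *: u + v).
Proof. exact: (closureHP ip step_funP). Qed.
Let cl0 : cl 0.
Proof. exact: (sub_closureH ip step_fun0). Qed.
Let clZ a u : cl u -> cl (a *: u).
Proof. by move=> cu; have := clP a cu cl0; rewrite addr0. Qed.
Let clD u v : cl u -> cl v -> cl (u + v).
Proof. by move=> cu cv; have := clP 1 cu cv; rewrite scale1r. Qed.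
Let clB u v : cl u -> cl v -> cl (u - v).
Proof. by move=> cu cv; apply: clD => //; rewrite -scaleN1r; exact: clZ. Qed.
Let cl_sum I (r : seq I) (F : I -> L2) : (forall i, cl (F i)) -> cl (\sum_(i <- r) F i).
Proof.
move=> cF; elim: r => [|i r IH]; first by rewrite big_nil; exact: cl0.
by rewrite big_cons; exact: clD.
Qed.

Let I_ (n : nat) : set RM := `](- n%:R), n%:R]%classic.

Let I_lty n : (mu (I_ n) < +oo)%E.
Proof. by rewrite /I_ lebesgue_measure_itv/=; case: ifP => _; rewrite -?EFinB ltry. Qed.

Let sqDI D n : measurable D -> (fun x => (\1_(D `&` I_ n) x)%:C) \in sqint (R := R).
Proof.
move=> mD; have mDI : measurable (D `&` I_ n).
  by apply: measurableI => //; exact: measurable_itv.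
apply: sqint_indic => //; apply: le_lt_trans (I_lty n).
apply: le_measure; rewrite ?inE; [exact: mDI|exact: measurable_itv|exact: subIsetr].
Qed.

Let iB (A B D : set R) x : A `&` B = set0 -> D = A `|` B ->
  (\1_D x)%:C = (\1_A x)%:C + (\1_B x)%:C :> C.
Proof.
move=> AB ->; rewrite -rmorphD; congr (_%:C); rewrite !indicE in_setU.
case: (boolP (x \in A)) => xA; case: (boolP (x \in B)) => xB; rewrite ?addr0 ?add0r//.
by move: xA xB; rewrite !inE => xA xB; have : (A `&` B) x by []; rewrite AB.
Qed.

(** Dynkin's theorem for the Borel sets whose trace on the bounded interval [I_ n] has its indicator
    in the closure; taking traces keeps complements of finite measure. *)
Let cl_borel n D : measurable D -> cl (toL2 (fun x => (\1_(D `&` I_ n) x)%:C)).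
Proof.
have mI : measurable (I_ n) by exact: measurable_itv.
move=> mD; pose P E := cl (toL2 (fun x => (\1_(E `&` I_ n) x)%:C)).
apply: (@dynkin_induction _ RM (@ocitv R) P) => //; rewrite /P {P}.
- exact: ocitvI.
- by rewrite setTI; apply: (sub_closureH ip); exact: (step_fun_istep (- n%:R) n%:R).
- move=> _ /ocitvP[->|[[a b] /= ab ->]].
    rewrite set0I [X in toL2 X](_ : _ = fun=> 0); first by rewrite toL20.
    by apply/funext => x; rewrite indicE in_set0.
  have : (@ocitv R) (`]a, b]%classic `&` I_ n).
    by apply: ocitvI; [exists (a, b)|exists (- n%:R, n%:R)].
  case=> -[a' b'] _ <-; apply: (sub_closureH ip); exact: (step_fun_istep a' b').
- move=> S mS cS.
  have -> : toL2 (fun x => (\1_(~` S `&` I_ n) x)%:C) =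
      toL2 (fun x => (\1_(setT `&` I_ n) x)%:C) - toL2 (fun x => (\1_(S `&` I_ n) x)%:C) :> L2.
    apply/eqP; rewrite eq_sym subr_eq -toL2D; last 2 first.
    - by apply: sqDI; exact: measurableC.
    - exact: sqDI.
    apply/eqP; congr toL2; apply/funext => x; apply: iB.
      by rewrite setIACA setICl set0I.
    by rewrite -setIUl setUC setUv.
  apply: clB => //; rewrite setTI; apply: (sub_closureH ip); exact: (step_fun_istep (- n%:R) n%:R).
move=> F mF trF cF.
pose B m := \big[setU/set0]_(k < m) F k.
have mB m : measurable (B m) by apply: bigsetU_measurable.
have mU : measurable (\bigcup_k F k) by exact: bigcup_measurable.
have cB m : cl (toL2 (fun x => (\1_(B m `&` I_ n) x)%:C)).
  elim: m => [|m IH].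
    rewrite /B big_ord0 set0I [X in toL2 X](_ : _ = fun=> 0); first by rewrite toL20.
    by apply/funext => x; rewrite indicE in_set0.
  have -> : toL2 (fun x => (\1_(B m.+1 `&` I_ n) x)%:C) =
      toL2 (fun x => (\1_(B m `&` I_ n) x)%:C) + toL2 (fun x => (\1_(F m `&` I_ n) x)%:C) :> L2.
    rewrite -toL2D; [|exact: sqDI|exact: sqDI].
    congr toL2; apply/funext => x; apply: iB.
      rewrite setIACA [X in X `&` _](_ : _ = set0) ?set0I//.
      apply/seteqP; split => // y [+ Fmy]; rewrite /B -bigcup_mkord => -[k /= km Fky].
      by have := trF k m I I; move=> /(_ (ex_intro _ y (conj Fky Fmy))) kE; rewrite kE ltnn in km.
    by rewrite /B big_ord_recr/= setIUl.
  exact: clD.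
apply: (closureH_cvg ip cB).
apply: (cvgH_dct (g := fun x => (\1_(setT `&` I_ n) x)%:C)) => [k|||k x|x].
- exact: sqDI.
- exact: sqDI.
- exact: sqDI.
- rewrite -rmorphB !sqn_real !indicE !in_setI in_setT /=.
  case: (x \in I_ n); rewrite ?andbF ?andbT ?subr0 ?expr0n//=.
  case: (boolP (x \in B k)) => xB; case: (boolP (x \in \bigcup_k F k)) => xF;
    rewrite ?subrr ?subr0 ?sub0r ?sqrrN ?expr0n ?expr1n//=.
have [xU|xU] := pselect ((\bigcup_k F k) x); last first.
  apply: (@eventually_cst_sqn _ _ 0) => m _; congr (_%:C); rewrite !indicE !in_setI.
  rewrite [x \in \bigcup_k F k]memNset// memNset//.
  by rewrite /B -bigcup_mkord => -[k /= _ Fkx]; apply: xU; exists k.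
have [j _ Fjx] := xU.
apply: (@eventually_cst_sqn _ _ j.+1) => m jm; congr (_%:C); rewrite !indicE !in_setI.
rewrite [x \in \bigcup_k F k]mem_set// mem_set//.
by rewrite /B -bigcup_mkord; exists j.
Qed.

Import HBNNSimple.

(** Simple functions below f, cut off to [I_ n] so that [cl_borel] applies, converge to f pointwise
    and, being dominated by f, in norm. *)
Let cl_ge0 (f : R -> R) : measurable_fun [set: RM] f -> (forall x, 0 <= f x) ->
  (fun x => (f x)%:C) \in sqint (R := R) -> cl (toL2 (fun x => (f x)%:C)).
Proof.
move=> mf f0 fL.
have mEf : measurable_fun [set: RM] (EFin \o f) by exact/measurable_EFinP.
pose g := nnsfun_approx measurableT mEf.
have g_cvg x : g n x @[n --> \oo] --> f x.
  have f0E y : [set: RM] y -> (0 <= (EFin \o f) y)%E by rewrite lee_fin.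
  have h := @cvg_nnsfun_approx _ _ _ _ measurableT _ mEf f0E x I.
  exact: (fine_cvg h).
have g_le n x : g n x <= f x.
  have <- := cvg_lim (@Rhausdorff R) (g_cvg x).
  apply: (@nondecreasing_cvgn_le R (fun k => g k x)); last by apply/cvg_ex; exists (f x).
  by move=> a b ab; have /lefP := nd_nnsfun_approx measurableT mEf ab; apply.
have g0 n x : 0 <= g n x by [].
pose F n x : C := ((\1_(I_ n) x) * g n x)%:C.
have msec n y : measurable (g n @^-1` [set y] : set RM).
  by rewrite -[X in measurable X]setTI; apply: (measurable_funP (g n)).
have gE n : exists m (c : 'I_m -> R) (D : 'I_m -> set RM), (forall i, measurable (D i)) /\
    forall x, g n x = \sum_(i < m) c i * \1_(D i) x.
  pose s := finmap.enum_fset (fset_set (g n @` setT)).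
  exists (size s), (fun i => nth 0 s i), (fun i => g n @^-1` [set nth 0 s i]).
  by split=> [i|]; [exact: msec|exact: (fimfunEord (g n))].
have [FL cF] : (forall n, F n \in sqint (R := R)) /\ (forall n, cl (toL2 (F n))).
  split=> n; have [m [c [D [mD gD]]]] := gE n;
    have FE : F n = (fun x => \sum_(i < m) (c i)%:C * (\1_(D i `&` I_ n) x)%:C).
  - apply/funext => x; rewrite /F gD mulr_sumr rmorph_sum; apply: eq_bigr => i _.
    rewrite -rmorphM; congr (_%:C); rewrite mulrCA; congr (_ * _).
    by rewrite !indicE in_setI -natrM mulnb andbC.
  - rewrite FE; have [] // := @toL2_sum R _ (index_enum 'I_m)
      (fun i x => (c i)%:C * (\1_(D i `&` I_ n) x)%:C).
    by move=> i; exact/sqintZ/sqDI.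
  - apply/funext => x; rewrite /F gD mulr_sumr rmorph_sum; apply: eq_bigr => i _.
    rewrite -rmorphM; congr (_%:C); rewrite mulrCA; congr (_ * _).
    by rewrite !indicE in_setI -natrM mulnb andbC.
  - rewrite FE; have [|_ ->] // := @toL2_sum R _ (index_enum 'I_m)
      (fun i x => (c i)%:C * (\1_(D i `&` I_ n) x)%:C).
      by move=> i; exact/sqintZ/sqDI.
    apply: cl_sum => i; rewrite toL2Z; last exact: sqDI.
    exact/clZ/cl_borel.
apply: (closureH_cvg ip cF); apply: (cvgH_dct FL fL fL) => [k x|x].
  rewrite /F -rmorphB !sqn_real indicE; have := g_le k x; have := g0 k x; have := f0 x.
  by case: (x \in I_ k) => /=; nra.
rewrite /F; have := g_cvg x; set a := f x => ga.
have h : (\1_(I_ n) x) * g n x @[n --> \oo] --> a.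
  apply: cvg_trans ga; apply: near_eq_cvg.
  exists (Num.truncn `|x|).+1 => // n /= xn; rewrite indicE mem_set ?mul1r// /I_/= in_itv/=.
  have xn' : `|x| < n%:R.
    by apply: lt_le_trans (truncnS_gt _) _; rewrite ler_nat.
  by move: xn'; rewrite ltr_norml => /andP[-> /ltW].
by apply: cvg_ReIm_sqn => //=; exact: cvg_cst.
Qed.

Lemma step_fun_dense u : closureH (@dotL2 R) step_fun u.
Proof.
rewrite -(toL2_fun u); set f := L2_fun u.
have fL : f \in sqint (R := R) by exact: L2_fun_sqint.
have [mr mi] : cmeasurable f by exact: sqint_cmeasurable.
(* The positive part of g for s = 1, and the negative part for s = -1. *)
pose p (s : R) (g : R -> R) x := Num.max (s * g x) 0.
have p0 (s : R) (g : R -> R) x : 0 <= p s g x by rewrite le_max lexx orbT.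
have mp (s : R) (g : R -> R) : measurable_fun [set: RM] g -> measurable_fun [set: RM] (p s g).
  by move=> mg; apply: measurable_maxr; [exact: (measurable_funM (measurable_cst s) mg)|exact: measurable_cst].
have pE (g : R -> R) x : g x = p 1 g x - p (-1) g x.
  by rewrite /p mul1r mulN1r; case: (leP (g x) 0) => ?; case: (leP (- g x) 0) => ?; lra.
have pL (s : R) (g : R -> R) : (s = 1 \/ s = -1) -> measurable_fun [set: RM] g ->
    (forall x, g x ^+ 2 <= sqn (f x)) -> (fun x => (p s g x)%:C) \in sqint (R := R).
  move=> s1 mg gf; apply: (sqint_le fL); first by apply: cmeasurable_real; exact: mp.
  move=> x; apply: le_trans (gf x); rewrite sqn_real /p.
  case: (leP (s * g x) 0) => _; first by rewrite expr0n sqr_ge0.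
  by case: s1 => ->; rewrite ?mul1r// mulN1r sqrrN.
have rf x : complex.Re (f x) ^+ 2 <= sqn (f x) by rewrite lerDl sqr_ge0.
have if_ x : complex.Im (f x) ^+ 2 <= sqn (f x) by rewrite lerDr sqr_ge0.
pose P (s : R) (g : R -> R) : L2 := toL2 (fun x => (p s g x)%:C).
have cP (s : R) (g : R -> R) : (s = 1 \/ s = -1) -> measurable_fun [set: RM] g ->
    (forall x, g x ^+ 2 <= sqn (f x)) -> cl (P s g).
  by move=> s1 mg gf; apply: cl_ge0; [exact: mp|exact: p0|exact: pL].
have l1 : (1 = 1 :> R \/ 1 = -1 :> R) by left.
have l2 : (-1 = 1 :> R \/ -1 = -1 :> R) by right.
pose fr x := complex.Re (f x); pose fi x := complex.Im (f x).
have frL : (fun x => (fr x)%:C) \in sqint (R := R).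
  by apply: (sqint_le fL) => [|x]; [exact: cmeasurable_real|rewrite sqn_real; exact: rf].
have fiL : (fun x => (fi x)%:C) \in sqint (R := R).
  by apply: (sqint_le fL) => [|x]; [exact: cmeasurable_real|rewrite sqn_real; exact: if_].
have PE (g : R -> R) : measurable_fun [set: RM] g -> (forall x, g x ^+ 2 <= sqn (f x)) ->
    toL2 (fun x => (g x)%:C) = P 1 g - P (-1) g.
  move=> mg gf; rewrite /P -toL2B; [|exact: pL|exact: pL].
  by congr toL2; apply/funext => x; rewrite -rmorphB -pE.
have -> : toL2 f = toL2 (fun x => (fr x)%:C) + 'i%C *: toL2 (fun x => (fi x)%:C).
  rewrite -(toL2Z 'i%C fiL) -(toL2D frL (sqintZ 'i%C fiL)); congr toL2.
  apply/funext => x; rewrite /fr /fi.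
  by case: (f x) => a b; apply: complexP => /=; ring.
rewrite (PE _ mr rf) (PE _ mi if_).
apply: clD; first by apply: clB; apply: cP.
by apply: clZ; apply: clB; apply: cP.
Qed.

End StepFunctionsDense.

(** * The Fourier transform *)

Section LebesgueScaling.
Variable R : realType.
Local Notation mu := (@lebesgue_measure R).
Local Notation RM := (measurableTypeR R).

Let mulM (s : R) : measurable_fun [set: RM] (fun x : RM => (s * x : RM)).
Proof. exact: measurable_funM. Qed.

Lemma lebesgue_measure_scale (s : R) (E : set RM) : 0 < s -> measurable E ->
  mu E = (s%:E * mu ((fun x : RM => (s * x)%R : RM) @^-1` E))%E.
Proof.
move=> s0 mE; pose sn := NngNum (ltW s0).
pose m : {measure set RM -> \bar R} :=
  mscale sn (pushforward mu (fun x : RM => (s * x : RM))).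
rewrite -[RHS]/(m (mulM s) E); apply: lebesgue_measure_unique => // _ [[a b] _ <-].
rewrite /m /= /mscale /pushforward /=.
rewrite [X in (_ = _ * mu X)%E](_ : _ = `](a / s), (b / s)]%classic); last first.
  apply/seteqP; split => x /=; rewrite !in_itv/= ltr_pdivrMr// ler_pdivlMr// ![x * s]mulrC//.
rewrite !lebesgue_measure_itv/= !lte_fin ltr_pM2r ?invr_gt0//.
case: ifP => _; last by rewrite mule0.
by rewrite -!EFinB -EFinM; congr (_%:E); field; rewrite gt_eqF.
Qed.

Lemma ge0_integral_scale (s : R) (f : RM -> \bar R) : 0 < s ->
  measurable_fun setT f -> (forall x, 0 <= f x)%E ->
  (\int[mu]_x f x = s%:E * \int[mu]_x f (s * x)%R)%E.
Proof.
move=> s0 mf f0; pose sn := NngNum (ltW s0).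
pose m : {measure set RM -> \bar R} := pushforward mu (fun x : RM => (s * x : RM)).
rewrite (eq_measure_integral (mscale sn (m (mulM s)))); last first.
  by move=> A mA _; exact: (lebesgue_measure_scale s0 mA).
rewrite ge0_integral_mscale//; congr (_ * _)%E.
by rewrite ge0_integral_pushforward.
Qed.

Lemma ge0_integral_opp (f : RM -> \bar R) :
  measurable_fun setT f -> (forall x, 0 <= f x)%E ->
  (\int[mu]_x f x = \int[mu]_x f (- x)%R)%E.
Proof.
move=> mf f0.
have mo : measurable_fun [set: RM] (fun x : RM => (- x : RM)) by exact: measurableT_comp.
pose m : {measure set RM -> \bar R} := pushforward mu (fun x : RM => (- x : RM)).
rewrite (eq_measure_integral (m mo)); last first.
  by move=> A mA _; apply/esym/lebesgue_measureN.
by rewrite ge0_integral_pushforward.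
Qed.

Lemma odd_integral (f : RM -> R) : mu.-integrable setT (EFin \o f) ->
  (forall x, f (- x) = - f x) -> Rintegral mu setT f = 0.
Proof.
move=> fi fo; have mf := measurable_int _ fi.
rewrite /Rintegral integralE.
have -> : (\int[mu]_x (EFin \o f)^\- x = \int[mu]_x (EFin \o f)^\+ x)%E.
  rewrite [RHS]ge0_integral_opp//; last exact: measurable_funepos.
  by apply: eq_integral => x _; rewrite funeposE funenegE /= fo EFinN.
by rewrite subee// integrable_pos_fin_num.
Qed.

End LebesgueScaling.

(** * The integral of (1 - cos (2 pi s x)) / x^2 *)

Section CosineKernel.
Variable R : realType.
Local Notation mu := (@lebesgue_measure R).
Local Notation RM := (measurableTypeR R).
Local Notation pi := (@trigo.pi R).

(* Rocq's junk value gives cosk s 0 = 0. *)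
Definition cosk (s x : R) : R := (1 - cos (2 * pi * s * x)) / x ^+ 2.

Lemma cosk_ge0 s x : 0 <= cosk s x.
Proof. by rewrite divr_ge0 ?sqr_ge0// subr_ge0 cos_le1. Qed.

Lemma cosk0 x : cosk 0 x = 0.
Proof. by rewrite /cosk mulr0 mul0r cos0 subrr mul0r. Qed.

Lemma coskN s x : cosk (- s) x = cosk s x.
Proof. by rewrite /cosk mulrN mulNr cosN. Qed.

Lemma cosk_scale s x : cosk s x = s ^+ 2 * cosk 1 (s * x).
Proof.
have [->|s0] := eqVneq s 0; first by rewrite cosk0 expr0n mul0r.
have [->|x0] := eqVneq x 0; first by rewrite mulr0 /cosk expr0n invr0 !mulr0.
by rewrite /cosk mulr1 mulrA; field; rewrite s0 x0.
Qed.

Lemma measurable_cos_lin (s : R) : measurable_fun [set: RM] (fun x : R => cos (s * x)).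
Proof.
apply: (measurableT_comp (f := cos)); last exact: measurable_funM.
by apply: continuous_measurable_fun; exact: continuous_cos.
Qed.

Lemma measurable_sin_lin (s : R) : measurable_fun [set: RM] (fun x : R => sin (s * x)).
Proof.
apply: (measurableT_comp (f := sin)); last exact: measurable_funM.
by apply: continuous_measurable_fun; exact: continuous_sin.
Qed.

Lemma measurable_inv_sqr : measurable_fun [set: RM] (fun x : R => (x ^+ 2)^-1).
Proof.
have -> : (fun x : R => (x ^+ 2)^-1) = (fun x => (x ^+ 2) `^ (-1)).
  by apply/funext => x; rewrite powR_inv1// sqr_ge0.
apply: (measurableT_comp (f := (@powR R)^~ (-1))); first exact: measurable_powR.
exact: measurable_funX.
Qed.

Lemma measurable_cosk s : measurable_fun [set: RM] (cosk s).
Proof.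
apply: measurable_funM; last exact: measurable_inv_sqr.
by apply: measurable_funB => //; exact: measurable_cos_lin.
Qed.

Lemma one_sub_cos_le (y : R) : 1 - cos y <= y ^+ 2.
Proof.
wlog y0 : y / 0 <= y => [h|].
  have [|/ltW yn] := leP 0 y; first exact: h.
  by rewrite -cosN -sqrrN; apply: h; rewrite oppr_ge0.
have sin_le (c : R) : 0 <= c -> sin c <= c.
  move=> c0; have [|d _] := @MVT_segment R sin cos 0 c c0.
  - by apply: continuous_subspaceT => x; exact: continuous_sin.
  - by rewrite sin0 !subr0 => ->; rewrite ler_piMl// cos_le1.
have [|c] := @MVT_segment R cos (fun x => - sin x) 0 y y0.
- by apply: continuous_subspaceT => x; exact: continuous_cos.
rewrite in_itv/= => /andP[c0 cy]; rewrite cos0 subr0 => h.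
have -> : 1 - cos y = sin c * y by rewrite -opprB h mulNr opprK.
by rewrite expr2 ler_wpM2r// (le_trans (sin_le _ c0)).
Qed.

Definition phi (s : R) : \bar R := (\int[mu]_x (cosk s x)%:E)%E.

(** The substitution of s x for x yields a factor s^-1 against the s^2 of [cosk_scale]. Linearity in
    |s| is what turns inner products of transforms into lengths of intervals. *)
Lemma phi_scale s : phi s = (`|s|%:E * phi 1)%E.
Proof.
wlog s0 : s / 0 < s => [h|].
  have [s0|s0|->] := ltgtP s 0.
  - rewrite -normrN -h ?oppr_gt0// /phi; apply: eq_integral => x _.
    by rewrite coskN.
  - exact: h.
  - by rewrite normr0 mul0e /phi; apply: integral0_eq => x _; rewrite cosk0.
rewrite (gtr0_norm s0) /phi.
have mE (r : R) : measurable_fun [set: RM] (fun x => (cosk r x)%:E).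
  by apply/measurable_EFinP; exact: measurable_cosk.
rewrite [X in (_ * X)%E](ge0_integral_scale s0)//; last first.
  by move=> x; rewrite lee_fin cosk_ge0.
under eq_integral do rewrite cosk_scale EFinM.
rewrite ge0_integralZl//; last 3 first.
- apply/measurable_EFinP; apply: (measurableT_comp (f := cosk 1)).
    exact: measurable_cosk.
  exact: measurable_funM.
- by move=> x _; rewrite lee_fin cosk_ge0.
- by rewrite lee_fin sqr_ge0.
by rewrite muleA -EFinM expr2.
Qed.

Lemma phi1_lty : (phi 1 < +oo)%E.
Proof.
(* [cosk 1 x] times 1 + x^2 is at most this: the term 1 contributes (2 pi)^2, by 1 - cos y <= y^2,
   and the term x^2 contributes 1 - cos <= 2. *)
pose K : R := (2 * pi) ^+ 2 + 2.
have K0 : 0 <= K by rewrite addr_ge0// sqr_ge0.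
have o0 x : 0 < oneDsqr x :> R := lt_le_trans ltr01 (oneDsqr_ge1 x).
have mV : measurable_fun [set: RM] (fun x : R => (oneDsqr x)^-1).
  by apply: continuous_measurable_fun; exact: continuous_oneDsqrV.
apply: (@le_lt_trans _ _ (\int[mu]_x (K%:E * ((oneDsqr x)^-1)%:E))%E).
  apply: ge0_le_integral => //.
  - by move=> x _; rewrite lee_fin cosk_ge0.
  - by apply/measurable_EFinP; exact: measurable_cosk.
  - by apply/measurable_EFinP; exact: measurable_funM.
  move=> x _; rewrite lee_fin.
  rewrite (ler_pdivlMr _ _ (o0 x)) /cosk mulr1 /oneDsqr mulrDr mulr1.
  have [->|x0] := eqVneq x 0; first by rewrite expr0n invr0 !mulr0 addr0.
  have x20 : 0 < x ^+ 2 by rewrite exprn_even_gt0.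
  rewrite divfK ?gt_eqF//; apply: lerD.
    by rewrite ler_pdivrMr// -exprMn one_sub_cos_le.
  by have := cos_geN1 (2 * pi * x); lra.
rewrite ge0_integralZl//; last exact/measurable_EFinP.
rewrite lte_mul_pinfty// ge0_symfun_integralT.
- have -> : [set x : R | 0 <= x] = `[0, +oo[%classic.
    by apply/seteqP; split => x /=; rewrite in_itv/= andbT.
  by rewrite integral0y_oneDsqr -EFinM ltry.
- by move=> x; rewrite invr_ge0 ltW.
- exact: continuous_oneDsqrV.
- by move=> x; rewrite /= /oneDsqr sqrrN.
Qed.

Lemma phi1_gt0 : (0 < phi 1)%E.
Proof.
(* For these x the angle 2 pi x lies between pi / 2 and pi, so the cosine is at most 0 while x^2 <=
   1: the kernel is at least 1. *)
pose I : set RM := `[4^-1 : R, 2^-1]%classic.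
have mI : measurable I by exact: measurable_itv.
apply: (@lt_le_trans _ _ (\int[mu]_(x in I) (cst 1%:E x))%E).
  have lt42 : (4^-1 < 2^-1 :> R) by rewrite ltf_pV2 ?posrE ?ltr_nat.
  rewrite integral_cst// mul1e; apply: (@lt_le_trans _ _ (2^-1 - 4^-1)%:E).
    by rewrite lte_fin subr_gt0.
  have := lebesgue_measure_itv `[4^-1 : R, 2^-1]; rewrite /= lte_fin lt42 => h.
  by rewrite EFinB -h.
apply: (@le_trans _ _ (\int[mu]_(x in I) (cosk 1 x)%:E)%E); last first.
  apply: ge0_subset_integral => //.
  - by apply/measurable_EFinP; exact: measurable_cosk.
  - by move=> x _; rewrite lee_fin cosk_ge0.
apply: ge0_le_integral => //.
- by apply/measurable_EFinP; apply: measurable_funTS; exact: measurable_cosk.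
move=> x; rewrite /I /= in_itv/= => /andP[x1 x2]; rewrite lee_fin /cosk mulr1.
have pi0 := pi_gt0 R.
have c0 : cos (2 * pi * x) <= 0.
  have -> : 2 * pi * x = (2 * pi * x - pi) + pi by rewrite subrK.
  rewrite cosDpi oppr_le0; apply: cos_ge0_pihalf; apply/andP; split; nra.
have x0 : 0 < x ^+ 2 by rewrite exprn_gt0//; lra.
rewrite ler_pdivlMr// mul1r; nra.
Qed.

End CosineKernel.

Section HatFunctions.
Variable R : realType.
Local Notation C := R[i].
Local Notation mu := (@lebesgue_measure R).
Local Notation RM := (measurableTypeR R).
Local Notation pi := (@trigo.pi R).
Local Notation dot := (@dotL2 R).

Lemma dotL2_toL2 (f g : R -> C) : f \in sqint (R := R) -> g \in sqint (R := R) ->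
  dot (toL2 f) (toL2 g) = cintegral setT (fun x => f x * conjc (g x)).
Proof. by move=> fL gL; apply: dotL2_ae; do ?[exact: sqint_cmeasurable|exact: toL2_sqint]. Qed.

Lemma Rintegral_deriv (F f : R -> R) (a b : R) : a <= b ->
  (forall x : R, is_derive x 1 F (f x)) -> continuous f ->
  Rintegral mu `]a, b]%classic f = F b - F a.
Proof.
rewrite le_eqVlt => /orP[/eqP <- _ _|ab Ff cf].
  by rewrite set_itvoc0// Rintegral_set0 subrr.
have cF : continuous F.
  move=> x; apply/differentiable_continuous/derivable1_diffP.
  by case: (Ff x).
have cfab : {within `[a, b], continuous f} by exact: continuous_subspaceT.
have If : mu.-integrable `[a, b] (EFin \o f).
  by apply: continuous_compact_integrable => //; exact: segment_compact.
rewrite Rintegral_itv_obnd_cbnd; last first.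
  by apply: (integrableS _ _ _ If) => //; exact: subset_itv_oc_cc.
rewrite /Rintegral (@continuous_FTC2 _ f F)//.
- split; first by move=> x _; case: (Ff x).
  + by apply: cvg_at_right_filter; exact: cF.
  + by apply: cvg_at_left_filter; exact: cF.
- by move=> x _; rewrite derive1E; apply: derive_val.
Qed.

(* The Fourier transform of the indicator of ]a, b]; at 0 the value is the junk
   value 0 instead of b - a. *)
Definition hat (a b xi : R) : C :=
  ((sin (2 * pi * b * xi) - sin (2 * pi * a * xi)) / (2 * pi * xi)) +i*
  ((cos (2 * pi * b * xi) - cos (2 * pi * a * xi)) / (2 * pi * xi)).

Let is_derive_lin (w x : R) : is_derive x 1 (fun x => w * x) w.
Proof. by apply: is_derive_eq; rewrite /GRing.scale /= mulr1. Qed.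

Lemma cintegral_cis a b xi : a <= b -> xi != 0 ->
  cintegral `]a, b] (fun x => cis (- (2 * pi * x * xi))) = hat a b xi.
Proof.
move=> ab xi0; set w := 2 * pi * xi.
have w0 : w != 0 by rewrite !mulf_neq0// gt_eqF// pi_gt0.
have E x : 2 * pi * x * xi = w * x by rewrite /w; ring.
have clin : continuous (fun x => w * x) by move=> x; apply: cvgM; [exact: cvg_cst|exact: cvg_id].
have mV (f : R -> R) (x v : R) : is_derive (w * x) 1 f v -> is_derive x 1 (fun x => w^-1 * f (w * x)) v.
  move=> d; rewrite (_ : (fun x => _) = w^-1 *: (f \o (fun x => w * x)))//.
  have dw := is_derive_lin w x.
  have {}d : is_derive x 1 (f \o (fun x => w * x)) (v * w) by exact: is_derive1_comp.
  by apply: is_derive_eq; rewrite /GRing.scale /=; field.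
apply: complexP; rewrite /= !E.
- under eq_Rintegral do rewrite E cosN.
  rewrite (@Rintegral_deriv (fun x => w^-1 * sin (w * x)))//.
  + by rewrite -mulrBr mulrC.
  + by move=> x; apply: (continuous_comp (g := cos)); [exact: clin|exact: continuous_cos].
- under eq_Rintegral do rewrite E sinN.
  rewrite (@Rintegral_deriv (fun x => w^-1 * cos (w * x)))//.
  + by rewrite -mulrBr mulrC.
  + move=> x; apply: (continuous_comp (g := fun y => - sin y)); first exact: clin.
    by apply: cvgN; exact: continuous_sin.
Qed.

Lemma hatN a b xi : hat a b (- xi) = conjc (hat a b xi).
Proof.
apply: complexP; rewrite /hat /= !mulrN ?sinN ?cosN invrN mulrN -?mulNr//.
by congr (_ / _); rewrite !opprB addrC opprK.
Qed.

(** Product-to-sum formulas reduce inner products of transforms of intervals to the integrals [phi]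
    at differences of endpoints. *)
Lemma Re_hatJ a b c d xi : complex.Re (hat a b xi * conjc (hat c d xi)) =
  ((2 * pi) ^+ 2)^-1 * (cosk (b - c) xi + cosk (a - d) xi - cosk (b - d) xi - cosk (a - c) xi).
Proof.
have E s t : cosk (s - t) xi = (1 - (cos (2 * pi * s * xi) * cos (2 * pi * t * xi) +
    sin (2 * pi * s * xi) * sin (2 * pi * t * xi))) * xi^-1 ^+ 2.
  rewrite /cosk (_ : 2 * pi * (s - t) * xi = 2 * pi * s * xi - 2 * pi * t * xi); last by ring.
  by rewrite cosB exprVn.
rewrite !E /hat /= invfM -exprVn.
move: (2 * pi)^-1 (xi^-1) (cos _) (cos _) (cos _) (cos _) (sin _) (sin _) (sin _) (sin _).
by move=> *; ring.
Qed.

Lemma cmeasurable_hat a b : cmeasurable (hat a b).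
Proof.
have mV : measurable_fun [set: RM] (fun x : R => (2 * pi * x)^-1).
  have -> : (fun x : R => (2 * pi * x)^-1) = (fun x => (2 * pi)^-1 * (x * (x ^+ 2)^-1)).
    apply/funext => x; have [->|x0] := eqVneq x 0; first by rewrite !(mulr0,mul0r) invr0 ?mulr0.
    by rewrite invfM expr2 [(x * x)^-1]invfM; congr (_ * _); rewrite mulrA divff ?mul1r.
  by apply: measurable_funM => //; apply: measurable_funM => //; exact: measurable_inv_sqr.
split; apply: measurable_funM => //; apply: measurable_funB;
  do ?[exact: measurable_cos_lin|exact: measurable_sin_lin].
Qed.

Lemma cosk_integrable (s : R) : mu.-integrable setT (EFin \o cosk s).
Proof.
apply/integrableP; split; first by apply/measurable_EFinP; exact: measurable_cosk.
rewrite (_ : (\int[mu]_x _)%E = phi s).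
  by rewrite phi_scale lte_mul_pinfty// phi1_lty.
by apply: eq_integral => x _; rewrite /= ger0_norm// cosk_ge0.
Qed.

(** The factor by which [fourier] multiplies inner products, equal to 1 by Plancherel's theorem. The
    2 comes from [interval_overlap]. *)
Definition plancherel_const : R := 2 * ((2 * pi) ^+ 2)^-1 * fine (phi (1 : R)).

Lemma plancherel_const_gt0 : 0 < plancherel_const.
Proof.
rewrite /plancherel_const !mulr_gt0// ?invr_gt0 ?exprn_gt0 ?mulr_gt0 ?pi_gt0//.
by rewrite fine_gt0// phi1_gt0 phi1_lty.
Qed.

Lemma Rintegral_cosk s : Rintegral mu setT (cosk s) = `|s| * fine (phi (1 : R)).
Proof.
rewrite /Rintegral -/(phi s) phi_scale fineM//.
by rewrite ge0_fin_numE ?phi1_lty// ltW// phi1_gt0.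
Qed.

Lemma hat_sqint a b : hat a b \in sqint (R := R).
Proof.
apply/sqintP; split; first exact: cmeasurable_hat.
have -> : energy (hat a b) =
    (\int[mu]_x ((2 * ((2 * pi) ^+ 2)^-1)%:E * (cosk (b - a) x)%:E))%E.
  apply: eq_integral => x _; rewrite -EFinM; congr EFin.
  have -> : sqn (hat a b x) = complex.Re (hat a b x * conjc (hat a b x)) by rewrite mulcJ.
  by rewrite Re_hatJ !subrr !cosk0 -[a - b]opprB coskN; ring.
rewrite ge0_integralZl//.
- rewrite -/(phi (b - a)) phi_scale; apply: lte_mul_pinfty => //.
    by rewrite lee_fin mulr_ge0// invr_ge0 sqr_ge0.
  by apply: lte_mul_pinfty => //; exact: phi1_lty.
- by apply/measurable_EFinP; exact: measurable_cosk.
- by move=> x _; rewrite lee_fin cosk_ge0.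
- by rewrite lee_fin mulr_ge0// invr_ge0 sqr_ge0.
Qed.

(** A mixed second difference of the absolute value is twice the length of the overlap: this
    converts the sum of [phi] values into the inner product of two indicators. *)
Lemma interval_overlap (a b c d : R) : a <= b -> c <= d ->
  `|b - c| + `|a - d| - `|b - d| - `|a - c| = 2 * Num.max 0 (Num.min b d - Num.max a c).
Proof.
move=> ab cd; case: (lerP a c) => ?; case: (lerP b d) => ?; case: (lerP b c) => ?;
  case: (lerP a d) => ?; case: (lerP 0 _) => ?; lra.
Qed.

Lemma dot_hat a b c d : a <= b -> c <= d ->
  dot (toL2 (hat a b)) (toL2 (hat c d)) = plancherel_const%:C * dot (istep a b) (istep c d).
Proof.
move=> ab cd; rewrite dotL2_toL2 ?hat_sqint// dotL2_toL2; last 2 first.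
- by apply: sqint_indic => //; rewrite lebesgue_measure_itv; case: ifP; rewrite ?ltry// -EFinB ltry.
- by apply: sqint_indic => //; rewrite lebesgue_measure_itv; case: ifP; rewrite ?ltry// -EFinB ltry.
have [_ HI] := sqintM (hat_sqint a b) (sqintJ (hat_sqint c d)).
have -> : cintegral setT (fun x => hat a b x * conjc (hat c d x)) =
    (((2 * pi) ^+ 2)^-1 * fine (phi (1 : R)) * (`|b - c| + `|a - d| - `|b - d| - `|a - c|))%:C.
  rewrite /cintegral; congr (_ +i* _)%C.
    under eq_Rintegral do rewrite Re_hatJ.
    have ci := cosk_integrable.
    have i2 : mu.-integrable setT (EFin \o (fun x => cosk (b - c) x + cosk (a - d) x)).
      by rewrite /comp; under eq_fun do rewrite EFinD; exact: (integrableD measurableT (ci _) (ci _)).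
    have i3 : mu.-integrable setT (EFin \o (fun x => cosk (b - c) x + cosk (a - d) x - cosk (b - d) x)).
      by rewrite /comp; under eq_fun do rewrite EFinB; exact: (integrableB measurableT i2 (ci _)).
    rewrite RintegralZl//; last first.
      by rewrite /comp; under eq_fun do rewrite EFinB; exact: (integrableB measurableT i3 (ci _)).
    rewrite RintegralB// RintegralB// RintegralD// !Rintegral_cosk.
    by move: (fine _) => k; ring.
  (* Reflection conjugates both factors, so the imaginary part is odd and integrates to 0. *)
  apply: odd_integral => // x; rewrite !hatN.
  by case: (hat a b x) (hat c d x) => [p q] [r s] /=; ring.
rewrite (eq_cintegral (g := fun x => (\1_(`]Num.max a c, Num.min b d]%classic) x)%:C)); last first.
  move=> x _; rewrite conjc_real -rmorphM; congr (_%:C).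
  transitivity (\1_(`]a, b]%classic `&` `]c, d]%classic) x : R); first by rewrite indicI.
  congr (\1_ _ x); apply/seteqP; split => y /=; rewrite !in_itv/= gt_max le_min.
    by move=> [/andP[-> ->] /andP[-> ->]].
  by move=> /andP[/andP[-> ->] /andP[-> ->]].
have -> : cintegral setT (fun x => (\1_(`]Num.max a c, Num.min b d]%classic) x)%:C) =
    (Num.max 0 (Num.min b d - Num.max a c))%:C :> C.
  apply: complexP => /=; last by rewrite /Rintegral integral0.
  transitivity (fine (mu `]Num.max a c, Num.min b d]%classic)).
    by rewrite /Rintegral integral_indic// setIT.
  rewrite lebesgue_measure_itv/= lte_fin.
  rewrite /Num.max; case: ifPn; rewrite ?subr_gt0 => h.
    by rewrite h.
  by rewrite (negbTE h).
rewrite -rmorphM interval_overlap// /plancherel_const.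
by congr (_%:C); move: (fine _) (Num.max 0 _) => k m; ring.
Qed.

End HatFunctions.

Section Extension.
Variables (R : realType) (V : lmodType R[i]) (dot : V -> V -> R[i]).
Local Notation C := R[i].
Local Notation N := (N dot).
Hypothesis ip : inner_product dot.

Lemma scaled_isometry_dot (U : V -> V) (c : R) : linear U ->
  (forall u, N (U u) = c * N u) -> forall u v, dot (U u) (U v) = c%:C * dot u v.
Proof.
move=> lU Uc; have Re_dot u v : complex.Re (dot (U u) (U v)) = c * complex.Re (dot u v).
  have := Uc (u + v); rewrite (linear_funD lU) (ND ip) (ND ip u) !Uc; lra.
move=> u v; apply: complexP; first by rewrite Re_dot RemulrC.
have ImE (x y : V) : complex.Im (dot x y) = complex.Re (dot x ('i%C *: y)).
  by rewrite (dotZr ip); case: (dot x y) => p q /=; ring.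
by rewrite ImmulrC !ImE -(linear_funZ lU) Re_dot.
Qed.

(** Combinations are formal lists, so that the same coefficients can be applied to two families. *)
Definition lincomb (I : Type) (x : I -> V) (s : seq (C * I)) : V :=
  \sum_(p <- s) p.1 *: x p.2.

Definition scale_comb (I : Type) (a : C) (s : seq (C * I)) := [seq (a * p.1, p.2) | p <- s].

Lemma lincomb_lin (I : Type) (x : I -> V) a s t :
  lincomb x (scale_comb a s ++ t) = a *: lincomb x s + lincomb x t.
Proof.
rewrite /lincomb big_cat big_map/= scaler_sumr; congr (_ + _).
by apply: eq_bigr => p _; rewrite scalerA.
Qed.

Lemma cvgH_lin a s t u v : cvgH dot s u -> cvgH dot t v ->
  cvgH dot (fun n => a *: s n + t n) (a *: u + v).
Proof.
move=> su tv; apply: (@cvg0_le _ _ (fun n => 2 * sqn a * N (s n - u) + 2 * N (t n - v))).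
  move=> n; rewrite N_ge0//= (_ : _ - _ = a *: (s n - u) + (t n - v)).
    by apply: le_trans (ND_le ip _ _) _; rewrite (NZ ip) mulrA.
  by rewrite scalerBr opprD addrACA.
rewrite -[X in _ --> X](addr0 (0 : R)); apply: cvgD.
  by rewrite -[X in _ --> X](mulr0 (2 * sqn a)); exact: cvgn_mull.
by rewrite -[X in _ --> X](mulr0 (2 : R)); exact: cvgn_mull.
Qed.

(** U is built through its graph: the pairs (u, w) that are limits of the same formal combinations
    of x and of y. Equality of Gram matrices up to c gives |w|^2 = c |u|^2 on the graph; as the
    graph is linear, w is determined by u even if the x i are linearly dependent. *)
Lemma isometry_extension (I : Type) (x y : I -> V) (c : R) : completeV dot -> 0 < c ->
  (forall i j, dot (y i) (y j) = c%:C * dot (x i) (x j)) ->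
  (forall u, closureH dot (fun v => exists s, v = lincomb x s) u) ->
  exists U : V -> V, [/\ linear U, forall i, U (x i) = y i &
    forall u v, dot (U u) (U v) = c%:C * dot u v].
Proof.
move=> cV c0 xy dx.
have Nxy s : N (lincomb y s) = c * N (lincomb x s).
  rewrite -RemulrC /N; congr complex.Re; rewrite /lincomb !(dot_suml ip) mulr_sumr.
  apply: eq_bigr => p _; rewrite !(dot_sumr ip) mulr_sumr; apply: eq_bigr => q _.
  by rewrite !(dotZl ip) !(dotZr ip) xy; ring.
pose G u w := exists l : nat -> seq (C * I),
  cvgH dot (lincomb x \o l) u /\ cvgH dot (lincomb y \o l) w.
have NBxy s t : N (lincomb y s - lincomb y t) = c * N (lincomb x s - lincomb x t).
  have E (z : I -> V) : lincomb z s - lincomb z t = lincomb z (scale_comb (-1) t ++ s).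
    by rewrite lincomb_lin scaleN1r addrC.
  by rewrite !E Nxy.
have totG u : exists w, G u w.
  have [s [sS su]] := closureH_seq ip (dx u).
  have [l hl] := choice sS.
  have [w hw] : exists w, cvgH dot (lincomb y \o l) w.
    apply: cV => e e0; have [|n0 hn] := cvgH_cauchy ip su (e := e / c); first by rewrite divr_gt0.
    exists n0 => m n n0m n0n; rewrite /= NBxy -!hl mulrC -ler_pdivlMr//.
    exact: hn.
  exists w, l; split=> //; rewrite (_ : _ \o _ = s)//.
  by apply/funext => n; rewrite /= -hl.
have linG a u v w w' : G u w -> G v w' -> G (a *: u + v) (a *: w + w').
  move=> [l [lu lw]] [l' [lv lw']]; exists (fun n => scale_comb a (l n) ++ l' n).
  by split; rewrite /comp; under eq_fun do rewrite lincomb_lin; exact: cvgH_lin.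
have NG u w : G u w -> N w = c * N u.
  move=> [l [lu lw]]; apply: (cvgn_unique (cvgH_N ip lw)).
  rewrite /comp; under eq_fun do rewrite Nxy; apply: cvgn_mull.
  exact: cvgH_N lu.
have funG u w w' : G u w -> G u w' -> w = w'.
  move=> uw uw'; apply/eqP; rewrite -subr_eq0; apply/eqP/(N_eq0 ip).
  have := NG _ _ (linG (-1) _ _ _ _ uw' uw).
  by rewrite !scaleN1r [- u + u]addrC subrr (N0 ip) mulr0 addrC.
have [U GU] := choice totG.
have lU : linear U by move=> a u v; apply: (funG (a *: u + v)) => //; exact: linG.
exists U; split=> [//|i|]; last by apply: scaled_isometry_dot => // u; exact: NG.
apply: (funG (x i)) => //; exists (fun=> [:: (1, i)]).
split; rewrite /comp /lincomb; under eq_fun do rewrite big_seq1 scale1r.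
  by rewrite /cvgH; under eq_fun do rewrite subrr (N0 ip); exact: cvg_cst.
by rewrite /cvgH; under eq_fun do rewrite subrr (N0 ip); exact: cvg_cst.
Qed.

End Extension.

Section Truncation.
Variable R : realType.
Local Notation C := R[i].
Local Notation mu := (@lebesgue_measure R).
Local Notation RM := (measurableTypeR R).
Local Notation L2 := (L2 R).
Local Notation dot := (@dotL2 R).
Local Notation N := (N dot).
Local Notation pi := (@trigo.pi R).
Implicit Types (u v w : L2) (D : set RM) (xi : R).
Let ip := @dotL2_inner_product R.

Lemma conjc_cis (t : R) : conjc (cis t) = cis (- t).
Proof. by rewrite /cis cosN sinN. Qed.

Lemma sqn_cis (t : R) : sqn (cis t) = 1.
Proof. by rewrite /sqn/= cos2Dsin2. Qed.

Lemma cmeasurable_cis xi : cmeasurable (fun x => cis (2 * pi * x * xi)).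
Proof.
have E x : 2 * pi * x * xi = (2 * pi * xi) * x by ring.
split; under eq_fun do rewrite E /=; [exact: measurable_cos_lin|exact: measurable_sin_lin].
Qed.

Lemma cmeasurable_wave D xi : measurable D ->
  cmeasurable (fun x => (\1_D x)%:C * cis (2 * pi * x * xi)).
Proof.
move=> mD; apply: cmeasurableM; [exact: cmeasurable_indic|exact: cmeasurable_cis].
Qed.

Lemma energy_wave D xi : measurable D ->
  energy (fun x => (\1_D x)%:C * cis (2 * pi * x * xi)) = mu D.
Proof.
move=> mD; rewrite -energy_indic//; apply: eq_integral => x _.
by rewrite sqnM sqn_cis mulr1.
Qed.

Lemma wave_sqint D xi : measurable D -> (mu D < +oo)%E ->
  (fun x => (\1_D x)%:C * cis (2 * pi * x * xi)) \in sqint (R := R).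
Proof.
by move=> mD fD; apply/sqintP; split; [exact: cmeasurable_wave|rewrite energy_wave].
Qed.

Definition wave D xi : L2 := toL2 (fun x => (\1_D x)%:C * cis (2 * pi * x * xi)).

Lemma fourier_integralE D u xi : measurable D -> (mu D < +oo)%E ->
  fourier_integral D (L2_fun u) xi = dot u (wave D xi).
Proof.
move=> mD fD; rewrite (dotL2_ae (f := L2_fun u) (g := fun x => (\1_D x)%:C * cis (2 * pi * x * xi))).
- rewrite /fourier_integral cintegral_mkcond; apply: eq_cintegral => x _.
  by rewrite conjc_realM conjc_cis mulrA mulrC.
- exact: L2_fun_cmeasurable.
- exact: cmeasurable_wave.
- exact: aeW.
- exact: toL2_sqint (wave_sqint xi mD fD).
Qed.

(** Half-open, unlike the interval in [is_fourier], so that truncating a step function gives a step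
    function; the two integrals agree by [fourier_integral_closed]. *)
Definition trunc (n : nat) : set RM := `](- n%:R), n%:R]%classic.

Lemma measurable_trunc n : measurable (trunc n).
Proof. exact: measurable_itv. Qed.

Lemma trunc_lty n : (mu (trunc n) < +oo)%E.
Proof. by rewrite /trunc lebesgue_measure_itv; case: ifP => _; rewrite ?ltry// -EFinB ltry. Qed.

Lemma indic_itv_sqint (a b : R) : (fun x => (\1_(`]a, b]%classic) x)%:C) \in sqint (R := R).
Proof.
apply: sqint_indic => //.
by rewrite lebesgue_measure_itv; case: ifP => _; rewrite ?ltry// -EFinB ltry.
Qed.

Lemma fourier_integral_closed n u xi :
  fourier_integral `[(- n%:R), n%:R]%classic (L2_fun u) xi =
  fourier_integral (trunc n) (L2_fun u) xi.
Proof.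
rewrite /fourier_integral [LHS]cintegral_mkcond [RHS]cintegral_mkcond; apply: ae_eq_cintegral => //.
- apply: cmeasurableM; first exact: cmeasurable_indic.
  apply: cmeasurableM; last exact: L2_fun_cmeasurable.
  by under eq_fun do rewrite -conjc_cis; exact/cmeasurableJ/cmeasurable_cis.
- apply: cmeasurableM; first exact: (cmeasurable_indic (measurable_trunc n)).
  apply: cmeasurableM; last exact: L2_fun_cmeasurable.
  by under eq_fun do rewrite -conjc_cis; exact/cmeasurableJ/cmeasurable_cis.
exists [set (- n%:R) : R]; split => //; first exact: lebesgue_measure_set1.
move=> x /=; apply: contra_notP => xn; rewrite /trunc !indicE !mem_setE !in_itv/=.
by congr ((nat_of_bool _)%:R%:C * _); rewrite le_eqVlt eq_sym; case: eqP xn.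
Qed.

(** The outer maximum yields an empty interval with ordered endpoints when nothing is left, as [hat]
    is used for a <= b. *)
Definition clip n (a b : R) : R * R :=
  let a' := Num.max a (- n%:R) in (a', Num.max a' (Num.min b n%:R)).

Lemma clip_le n a b : (clip n a b).1 <= (clip n a b).2.
Proof. by rewrite /clip/= le_max lexx. Qed.

Lemma indic_clip n a b x : \1_(trunc n) x * \1_(`]a, b]%classic) x =
  \1_(`](clip n a b).1, (clip n a b).2]%classic) x :> R.
Proof.
transitivity (\1_(trunc n `&` `]a, b]%classic) x : R); first by rewrite indicI.
congr (\1_ _ x); apply/seteqP; split => y /=; rewrite /trunc/= !in_itv/= gt_max le_max le_min.
  by move=> [/andP[-> ->] /andP[-> ->]]; rewrite orbT.
by move=> /andP[/andP[ay ny]]; rewrite leNgt gt_max ay ny/= => /andP[-> ->].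
Qed.

Lemma time_proj_istep n a b :
  time_proj (trunc n) (istep a b) = istep (clip n a b).1 (clip n a b).2.
Proof.
apply: L2_funP; apply: ae_eqT (time_projE (borel_lebesgue_measurable (measurable_trunc n)) _) _.
apply: aeS2 (toL2_sqint (indic_itv_sqint a b))
  (toL2_sqint (indic_itv_sqint (clip n a b).1 (clip n a b).2)) => x -> ->.
by rewrite -rmorphM indic_clip.
Qed.

Lemma fourier_integral_istep n a b xi : xi != 0 ->
  fourier_integral (trunc n) (L2_fun (istep a b)) xi = hat (clip n a b).1 (clip n a b).2 xi.
Proof.
move=> xi0; rewrite -cintegral_cis ?clip_le// [RHS]cintegral_mkcond.
rewrite /fourier_integral [LHS]cintegral_mkcond; apply: ae_eq_cintegral => //.
- apply: cmeasurableM; first exact: (cmeasurable_indic (measurable_trunc n)).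
  apply: cmeasurableM; last exact: L2_fun_cmeasurable.
  by under eq_fun do rewrite -conjc_cis; exact/cmeasurableJ/cmeasurable_cis.
- apply: cmeasurableM; first exact: cmeasurable_indic.
  by under eq_fun do rewrite -conjc_cis; exact/cmeasurableJ/cmeasurable_cis.
apply: aeS (toL2_sqint (indic_itv_sqint a b)) => x ->.
by rewrite mulrCA -rmorphM indic_clip mulrC.
Qed.

(** Meant for [hat], which differs from the true transform at 0 alone. *)
Lemma cmeasurable_off0 (f g : R -> C) : cmeasurable f -> (forall x, x != 0 -> f x = g x) ->
  cmeasurable g.
Proof.
move=> mf fg; rewrite (_ : g = fun x => f x + (g 0 - f 0) * (\1_[set 0 : R] x)%:C); last first.
  apply/funext => x; rewrite indicE; have [->|x0] := eqVneq x 0.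
    by rewrite mem_set// mulr1 addrC subrK.
  by rewrite memNset ?mulr0 ?addr0 ?fg//; apply/eqP.
apply: cmeasurableD => //; apply/cmeasurableZ/cmeasurable_indic.
exact: measurable_set1.
Qed.

End Truncation.

(** * The transform [fourier] as the extension of the isometry on step functions *)

Section FourierIsometry.
Variable R : realType.
Local Notation C := R[i].
Local Notation mu := (@lebesgue_measure R).
Local Notation RM := (measurableTypeR R).
Local Notation L2 := (L2 R).
Local Notation dot := (@dotL2 R).
Local Notation N := (N dot).
Local Notation kap := (plancherel_const R).
Implicit Types (u v w : L2) (D : set RM) (xi : R).
Let ip := @dotL2_inner_product R.

Lemma istep_max (a b : R) : istep a b = istep a (Num.max a b).
Proof.
congr toL2; apply/funext => x; congr (_%:C); congr (\1_ _ x).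
apply/seteqP; split => y /=; rewrite !in_itv/= le_max.
  by move=> /andP[-> ->]; rewrite orbT.
by move=> /andP[ay]; rewrite leNgt ay.
Qed.

Lemma exists_fourier_isometry : exists U : L2 -> L2, [/\ linear U,
  forall a b, a <= b -> U (istep a b) = toL2 (hat a b) &
  forall u v, dot (U u) (U v) = kap%:C * dot u v].
Proof.
have [p q|u|U [lU Uhat Udot]] := @isometry_extension R L2 dot ip (R * R)
  (fun p => istep p.1 p.2) (fun p => toL2 (hat p.1 (Num.max p.1 p.2))) kap
  (@L2_complete R) (plancherel_const_gt0 R).
- have le r : r.1 <= Num.max r.1 r.2 :> R by rewrite le_max lexx.
  by rewrite (istep_max p.1) (istep_max q.1) (dot_hat (le p) (le q)).
- exact: step_fun_dense.
by exists U; split => // a b ab; rewrite (Uhat (a, b))/= max_r.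
Qed.

Lemma energy_eq0 (f : R -> C) : cmeasurable f -> energy f = 0%E -> {ae mu, forall x, f x = 0}.
Proof.
move=> mf ef; have mE : measurable_fun [set: RM] (fun x => (sqn (f x))%:E).
  by apply/measurable_EFinP; exact: cmeasurable_sqn.
have /(ae_eq_integral_abs mu measurableT mE) h : (\int[mu]_x `|(sqn (f x))%:E| = 0)%E.
  by rewrite -[RHS]ef; apply: eq_integral => x _; rewrite gee0_abs// lee_fin sqn_ge0.
by apply: aeS h => x hx; apply: sqn_eq0; apply: EFin_inj; exact: hx.
Qed.

Lemma cvgH_energy (f_ : nat -> R -> C) (u_ : nat -> L2) u :
  (forall n, (N (u_ n - u))%:E = energy (f_ n)) ->
  energy (f_ n) @[n --> \oo] --> 0%E <-> cvgH dot u_ u.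
Proof.
move=> E; rewrite /cvgH; split=> h.
  have {}h := fine_cvg h; suff : (fun n => N (u_ n - u)) = fine \o (fun n => energy (f_ n)) by move=> ->; exact: h.
  by apply/funext => n /=; rewrite -E.
suff -> : (fun n => energy (f_ n)) = (fun n => (N (u_ n - u))%:E).
  by apply: cvg_EFin; [exact: nearW|exact: h].
by apply/funext => n; rewrite -E.
Qed.

Section Isometry.
Variable U : L2 -> L2.
Hypothesis lU : linear U.
Hypothesis Uhat : forall a b, a <= b -> U (istep a b) = toL2 (hat a b).
Hypothesis Udot : forall u v, dot (U u) (U v) = kap%:C * dot u v.
Local Notation P_ n := (time_proj (@trunc R n)).
Local Notation FI n u := (fourier_integral (@trunc R n) (L2_fun u)).

Let lP n : linear (P_ n).
Proof. exact: time_proj_linear (borel_lebesgue_measurable (measurable_trunc n)). Qed.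

Let NP n u : N (P_ n u) <= N u.
Proof.
exact: (orth_projection_le ip u (time_proj_orth (borel_lebesgue_measurable (measurable_trunc n)))).
Qed.

Let NU u : N (U u) = kap * N u.
Proof. by rewrite /N Udot RemulrC. Qed.

Let FIE n u xi : FI n u xi = dot u (wave (@trunc R n) xi).
Proof. exact: fourier_integralE (measurable_trunc n) (@trunc_lty R n). Qed.

Let FI_step n u : step_fun u ->
  cmeasurable (FI n u) /\ {ae mu, forall xi, FI n u xi = L2_fun (U (P_ n u)) xi}.
Proof.
move=> [s ->]; pose h (p : C * (R * R)) := hat (clip n p.2.1 p.2.2).1 (clip n p.2.1 p.2.2).2.
pose g xi := \sum_(p <- s) p.1 * h p xi.
have gE xi : xi != 0 -> g xi = FI n (\sum_(p <- s) p.1 *: istep p.2.1 p.2.2) xi.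
  move=> xi0; rewrite FIE (dot_suml ip); apply: eq_bigr => p _.
  by rewrite (dotZl ip) -FIE fourier_integral_istep.
have [gL gS] := toL2_sum s (fun p : C * (R * R) =>
  sqintZ p.1 (hat_sqint (clip n p.2.1 p.2.2).1 (clip n p.2.1 p.2.2).2)).
have mg : cmeasurable g := sqint_cmeasurable gL.
split; first exact: cmeasurable_off0 mg gE.
have -> : U (P_ n (\sum_(p <- s) p.1 *: istep p.2.1 p.2.2)) = toL2 g.
  rewrite gS (linear_fun_sum (lP n)) (linear_fun_sum lU); apply: eq_bigr => p _.
  by rewrite (linear_funZ (lP n)) (linear_funZ lU) time_proj_istep Uhat ?clip_le// toL2Z// hat_sqint.
apply: ae_eqT (ae_eqC (toL2_sqint gL)).
exists [set (0 : R)]; split => //; first exact: lebesgue_measure_set1.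
by move=> x /=; apply: contra_notP => /eqP x0; rewrite -gE.
Qed.

(** At each xi the truncated Fourier integral is the inner product with a fixed element of L^2, so
    norm approximation by step functions gives pointwise convergence of these integrals. *)
Let step_seq u n : exists s : nat -> L2, [/\ forall k, step_fun (s k), cvgH dot s u &
  forall xi, sqn (FI n (s k) xi - FI n u xi) @[k --> \oo] --> (0 : R)].
Proof.
have [s [sS su]] := closureH_seq ip (step_fun_dense u); exists s; split=> // xi.
apply: (@cvg0_le _ _ (fun k => N (wave (@trunc R n) xi) * N (s k - u))).
  move=> k; rewrite sqn_ge0/= !FIE -(dotBl ip) mulrC.
  exact: dot_sqn_le.
by rewrite -[X in _ --> X](mulr0 (N (wave (@trunc R n) xi))); exact: cvgn_mull.
Qed.

Lemma cmeasurable_fourier_integral n u : cmeasurable (FI n u).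
Proof.
have [s [sS _ sF]] := step_seq u n.
by apply: (cmeasurable_cvg (f_ := fun k => FI n (s k))) => [k|//]; case: (FI_step n (sS k)).
Qed.

(** For step functions this is a computation. In general the integrals of approximating step
    functions converge pointwise and their images under U converge in norm; Fatou's lemma identifies
    the two limits. *)
Lemma fourier_integral_trunc n u : {ae mu, forall xi, FI n u xi = L2_fun (U (P_ n u)) xi}.
Proof.
have mL v : cmeasurable (L2_fun v) by exact: L2_fun_cmeasurable.
have mFI := cmeasurable_fourier_integral.
suff e0 : energy (fun xi => FI n u xi - L2_fun (U (P_ n u)) xi) = 0%E.
  apply: aeS (energy_eq0 (cmeasurableB (cmeasurable_fourier_integral n u) (mL _)) e0) => x /eqP.
  by rewrite subr_eq0 => /eqP.
apply/eqP; rewrite eq_le energy_ge0 andbT; apply/lee_addgt0Pr => e e0; rewrite add0e.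
have [s [sS su sF]] := step_seq u n.
apply: (energy_fatou (f_ := fun k xi => FI n (s k) xi - L2_fun (U (P_ n u)) xi)).
- by move=> k; exact: cmeasurableB.
- exact: cmeasurableB.
- apply: aeW => xi; rewrite (_ : (fun k => _) = (fun k => sqn (FI n (s k) xi - FI n u xi))); first exact: sF.
  by apply/funext => k; congr sqn; rewrite opprB subrKA.
have [|k0 hk] := (cvgHP ip s u).1 su (e / kap); first by rewrite divr_gt0 ?plancherel_const_gt0.
exists k0 => k /hk; rewrite ler_pdivlMr ?plancherel_const_gt0// => h.
rewrite (_ : energy _ = (N (U (P_ n (s k)) - U (P_ n u)))%:E).
  rewrite lee_fin -(linear_funB lU) -(linear_funB (lP n)) NU.
  by apply: le_trans h; rewrite mulrC ler_pM2r ?plancherel_const_gt0.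
rewrite NB_energy; apply: ae_eq_energy; do ?exact: cmeasurableB.
by apply: aeS (FI_step n (sS k)).2 => x ->.
Qed.

Lemma is_fourierE u v : is_fourier u v <-> cvgH dot (fun n => U (P_ n u)) v.
Proof.
have mL w : cmeasurable (L2_fun w) by exact: L2_fun_cmeasurable.
have mFI := cmeasurable_fourier_integral.
rewrite -(cvgH_energy (f_ := fun n xi => FI n u xi - L2_fun v xi)); last first.
  move=> n; rewrite NB_energy; apply: ae_eq_energy; do ?exact: cmeasurableB.
  by apply: aeS (fourier_integral_trunc n u) => x ->.
rewrite /is_fourier /energy.
under [X in X @ _ --> _]eq_fun => n do under eq_integral => xi _ do
  rewrite fourier_integral_closed normc_sqn.
by [].
Qed.

Lemma cvgH_trunc u : cvgH dot (fun n => P_ n u) u.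
Proof.
rewrite -[X in cvgH _ _ X]toL2_fun.
apply: (cvgH_dct (f_ := fun n x => (\1_(@trunc R n) x)%:C * L2_fun u x) (g := L2_fun u)).
- by move=> n; apply: sqint_indicM (measurable_trunc n) (L2_fun_sqint u).
- exact: L2_fun_sqint.
- exact: L2_fun_sqint.
- move=> n x; rewrite indicE; case: (x \in _).
    by rewrite mul1r subrr sqn0 sqn_ge0.
  by rewrite mul0r sub0r sqnN.
move=> x; apply: (@eventually_cst_sqn _ _ _ (Num.bound `|x|).+1) => n bn.
rewrite indicE mem_set ?mul1r// /trunc/= in_itv/=.
have xn : `|x| < n%:R.
  apply: lt_le_trans (archi_boundP (normr_ge0 x)) _; rewrite ler_nat.
  exact: leq_trans (leqnSn _) bn.
by move: xn; rewrite ltr_norml => /andP[-> /ltW ->].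
Qed.

Lemma cvgH_isometry s u : cvgH dot s u -> cvgH dot (U \o s) (U u).
Proof.
move=> su; apply: (cvgH_le (c := kap) ip su) => n.
by rewrite -(linear_funB lU) NU.
Qed.

Lemma fourier_isometryE u : fourier u = U u.
Proof.
have h : is_fourier u (U u) by apply/is_fourierE; exact: cvgH_isometry (cvgH_trunc u).
have := xgetPex 0 (ex_intro _ _ h); rewrite -/(fourier u) => /is_fourierE h'.
exact: (cvgH_unique ip h' ((is_fourierE _ _).1 h)).
Qed.

End Isometry.

Lemma fourierP : [/\ linear (@fourier R),
  forall a b, a <= b -> fourier (istep a b) = toL2 (hat a b) :> L2,
  forall u v, dot (fourier u) (fourier v) = kap%:C * dot u v,
  forall n u, cmeasurable (fourier_integral (@trunc R n) (L2_fun u)) &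
  forall n u, {ae mu, forall xi, fourier_integral (@trunc R n) (L2_fun u) xi =
    L2_fun (fourier (time_proj (@trunc R n) u)) xi}].
Proof.
have [U [lU Uhat Udot]] := exists_fourier_isometry.
have E : @fourier R = U by apply/funext => u; exact: fourier_isometryE.
rewrite E; split => // n u; first exact: (cmeasurable_fourier_integral lU Uhat).
exact: fourier_integral_trunc.
Qed.

End FourierIsometry.

Section IndicatorFubini.
Variable R : realType.
Local Notation mu := (@lebesgue_measure R).
Local Notation RM := (measurableTypeR R).

Lemma indic_bounded_integrable d (T : measurableType d) (nu : {measure set T -> \bar R})
    (A : set T) (g : T -> R) : measurable A -> (nu A < +oo)%E ->
  measurable_fun setT g -> (forall x, `|g x| <= 1) ->
  nu.-integrable setT (fun x => (\1_A x * g x)%:E).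
Proof.
move=> mA nA mg g1; apply: (le_integrable measurableT (g := fun x => (\1_A x)%:E)).
- by apply/measurable_EFinP; apply: measurable_funM.
- move=> x _; rewrite !abse_EFin lee_fin normrM ler_piMr//.
apply/integrableP; split; first by apply/measurable_EFinP.
under eq_integral do rewrite gee0_abs ?lee_fin//.
by rewrite integral_indic// setIT.
Qed.

Lemma Rintegral_indic_swap (A B : set RM) (K : R -> R) :
  measurable A -> (mu A < +oo)%E -> measurable B -> (mu B < +oo)%E ->
  measurable_fun [set: RM] K -> (forall t, `|K t| <= 1) ->
  Rintegral mu setT (fun y => \1_B y * Rintegral mu setT (fun x => \1_A x * K (x * y))) =
  Rintegral mu setT (fun x => \1_A x * Rintegral mu setT (fun y => \1_B y * K (x * y))).
Proof.
move=> mA fA mB fB mK K1.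
pose f (z : RM * RM) : \bar R := (\1_(A `*` B) z * K (z.1 * z.2))%:E.
have fi : (mu \x mu)%E.-integrable setT f.
  apply: indic_bounded_integrable => //; first exact: measurableX.
    apply: (@le_lt_trans _ _ (mu A * mu B)%E); last by rewrite lte_mul_pinfty// ge0_fin_numE.
    by rewrite le_eqVlt; apply/orP; left; apply/eqP; exact: product_measure1E.
  apply: (measurableT_comp mK); apply: measurable_funM.
    exact: measurable_fst.
  exact: measurable_snd.
have fE x y : f (x, y) = (\1_A x * (\1_B y * K (x * y)))%:E.
  rewrite /f mulrA; congr (_ * _)%:E; rewrite !indicE in_setX/=.
  by case: (x \in A); case: (y \in B); rewrite ?mul1r ?mul0r.
have mKl (y : R) : measurable_fun [set: RM] (fun x => K (x * y)).
  by apply: (measurableT_comp mK); exact: measurable_funM.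
have mKr (x : R) : measurable_fun [set: RM] (fun y => K (x * y)).
  by apply: (measurableT_comp mK); exact: measurable_funM.
apply: (congr1 fine).
transitivity (\int[mu]_y \int[mu]_x f (x, y))%E.
  apply: eq_integral => y _; have ix := indic_bounded_integrable mA fA (mKl y) (fun=> K1 _).
  under [RHS]eq_integral => x _ do rewrite fE mulrCA EFinM.
  by rewrite integralZl// EFinM fineK//; exact: integrable_fin_num.
rewrite -(Fubini fi).
apply: eq_integral => x _; have iy := indic_bounded_integrable mB fB (mKr x) (fun=> K1 _).
under [LHS]eq_integral => y _ do rewrite fE EFinM.
by rewrite integralZl// [RHS]EFinM fineK//; exact: integrable_fin_num.
Qed.

End IndicatorFubini.

(** * Surjectivity of the Fourier transform *)

Section FourierInversion.
Variable R : realType.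
Local Notation C := R[i].
Local Notation mu := (@lebesgue_measure R).
Local Notation RM := (measurableTypeR R).
Local Notation L2 := (L2 R).
Local Notation dot := (@dotL2 R).
Local Notation N := (N dot).
Local Notation kap := (plancherel_const R).
Local Notation pi := (@trigo.pi R).
Implicit Types (u v w : L2) (D : set RM) (xi : R).
Let ip := @dotL2_inner_product R.
Variable F : L2 -> L2.
Hypothesis lF : linear F.
Hypothesis FE : forall a b, a <= b -> F (istep a b) = toL2 (hat a b).
Hypothesis Fdot : forall u v, dot (F u) (F v) = kap%:C * dot u v.

Definition conjL2 u : L2 := toL2 (fun x => conjc (L2_fun u x)).

Lemma conjL2E u : {ae mu, forall x, L2_fun (conjL2 u) x = conjc (L2_fun u x)}.
Proof. exact: toL2_sqint (sqintJ (L2_fun_sqint u)). Qed.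

Lemma conjL2K u : conjL2 (conjL2 u) = u.
Proof.
apply: L2_funP; apply: aeS2 (conjL2E (conjL2 u)) (conjL2E u) => x -> ->.
exact: conjcK.
Qed.

(** Without conjugation, the kernel exp (- 2 i pi x xi) is symmetric in x and xi, so F is its own
    transpose; for [dot] the adjoint involves the opposite exponential. *)
Definition bil u v : C := dot u (conjL2 v).

Lemma bilE u v : bil u v = cintegral setT (fun x => L2_fun u x * L2_fun v x).
Proof.
rewrite /bil (dotL2_ae (f := L2_fun u) (g := fun x => conjc (L2_fun v x))).
- by apply: eq_cintegral => x _; rewrite conjcK.
- exact: L2_fun_cmeasurable.
- exact/cmeasurableJ/L2_fun_cmeasurable.
- exact: aeW.
- exact: conjL2E.
Qed.

Lemma bilC u v : bil u v = bil v u.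
Proof. by rewrite !bilE; apply: eq_cintegral => x _; rewrite mulrC. Qed.

Lemma bil_lin a u v w : bil (a *: u + v) w = a * bil u w + bil v w.
Proof. by rewrite /bil (dotDl ip) (dotZl ip). Qed.

Lemma dot_conjL2 u v : dot (conjL2 u) v = conjc (dot u (conjL2 v)).
Proof.
rewrite -(dotC ip) -[v in LHS]conjL2K -/(bil (conjL2 u) (conjL2 v)) bilC /bil conjL2K.
by [].
Qed.

Lemma N_conjL2 u : N (conjL2 u) = N u.
Proof.
by rewrite /N dot_conjL2 conjL2K; case: (dot u u).
Qed.

Lemma bil_ae u v (f g : R -> C) : cmeasurable f -> cmeasurable g ->
  {ae mu, forall x, L2_fun u x = f x} -> {ae mu, forall x, L2_fun v x = g x} ->
  bil u v = cintegral setT (fun x => f x * g x).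
Proof.
move=> mf mg uf vg; rewrite bilE; apply: ae_eq_cintegral => //.
- by apply: cmeasurableM; exact: L2_fun_cmeasurable.
- exact: cmeasurableM.
- by apply: aeS2 uf vg => x -> ->.
Qed.

Lemma bil_le u v : sqn (bil u v) <= N u * N v.
Proof. by rewrite -(N_conjL2 v); exact: (dot_sqn_le ip). Qed.

Lemma bil_fourier_istep a b c d : a <= b -> c <= d ->
  bil (F (istep a b)) (istep c d) = bil (istep a b) (F (istep c d)).
Proof.
(* The integral itself, correct also at 0 where [hat] takes its junk value; Fubini's theorem needs
   this form. *)
pose h (a b xi : R) : C := cintegral `]a, b]%classic (fun x => cis (- (2 * pi * x * xi))).
have hE (p q xi : R) : p <= q -> xi != 0 -> hat p q xi = h p q xi.
  by move=> pq xi0; rewrite /h cintegral_cis.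
have hF (p q : R) : p <= q -> {ae mu, forall x, L2_fun (F (istep p q)) x = h p q x}.
  move=> pq; rewrite FE//; apply: ae_eqT (toL2_sqint (hat_sqint p q)) _.
  exists [set (0 : R)]; split => //; first exact: lebesgue_measure_set1.
  by move=> x /=; apply: contra_notP => /eqP x0; rewrite hE.
have mh (p q : R) : p <= q -> cmeasurable (h p q).
  by move=> pq; apply: (cmeasurable_off0 (cmeasurable_hat p q)) => x; exact: hE.
have mI (p q : R) : cmeasurable (fun x => (\1_(`]p, q]%classic) x)%:C).
  exact: cmeasurable_indic.
have fI (p q : R) : (mu `]p, q]%classic < +oo)%E.
  by rewrite lebesgue_measure_itv; case: ifP => _; rewrite ?ltry// -EFinB ltry.
move=> ab cd.
rewrite (bil_ae (mh _ _ ab) (mI c d) (hF _ _ ab) (toL2_sqint (indic_itv_sqint c d))).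
rewrite bilC (bil_ae (mh _ _ cd) (mI a b) (hF _ _ cd) (toL2_sqint (indic_itv_sqint a b))).
pose K1 (t : R) := cos (2 * pi * t); pose K2 (t : R) := - sin (2 * pi * t).
have hK p q xi : h p q xi = Rintegral mu setT (fun x => \1_(`]p, q]%classic) x * K1 (x * xi)) +i*
    Rintegral mu setT (fun x => \1_(`]p, q]%classic) x * K2 (x * xi)).
  rewrite /h cintegral_mkcond /cintegral; congr (_ +i* _)%C; apply: eq_Rintegral => x _.
    by rewrite RemulrC /cis/= /K1 cosN mulrA.
  by rewrite ImmulrC /cis/= /K2 sinN mulrA.
have mK1 : measurable_fun [set: RM] K1 by exact: measurable_cos_lin.
have mK2 : measurable_fun [set: RM] K2.
  by apply: measurableT_comp => //; exact: measurable_sin_lin.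
have K1le t : `|K1 t| <= 1 by rewrite ler_norml cos_geN1 cos_le1.
have K2le t : `|K2 t| <= 1 by rewrite normrN ler_norml sin_geN1 sin_le1.
have E p q r s : cintegral setT (fun x => h p q x * (\1_(`]r, s]%classic) x)%:C) =
    Rintegral mu setT (fun y => \1_(`]r, s]%classic) y *
      Rintegral mu setT (fun x => \1_(`]p, q]%classic) x * K1 (x * y))) +i*
    Rintegral mu setT (fun y => \1_(`]r, s]%classic) y *
      Rintegral mu setT (fun x => \1_(`]p, q]%classic) x * K2 (x * y))).
  rewrite /cintegral; congr (_ +i* _)%C; apply: eq_Rintegral => x _.
    by rewrite mulrC RemulrC hK.
  by rewrite mulrC ImmulrC hK.
have mIt (p q : R) : measurable (`]p, q]%classic : set RM) by exact: measurable_itv.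
have S (K : R -> R) : measurable_fun [set: RM] K -> (forall t, `|K t| <= 1) ->
    Rintegral mu setT (fun y => \1_(`]c, d]%classic) y *
      Rintegral mu setT (fun x => \1_(`]a, b]%classic) x * K (x * y))) =
    Rintegral mu setT (fun y => \1_(`]a, b]%classic) y *
      Rintegral mu setT (fun x => \1_(`]c, d]%classic) x * K (x * y))).
  move=> mK K1'; rewrite (Rintegral_indic_swap (mIt a b) (fI a b) (mIt c d) (fI c d) mK K1').
  apply: eq_Rintegral => x _; congr (_ * _); apply: eq_Rintegral => y _.
  by rewrite [x * y]mulrC.
by rewrite (E a b c d) (E c d a b) (S _ mK1 K1le) (S _ mK2 K2le).
Qed.

Lemma linear_form_eq0 (L : L2 -> C) (K : R) u :
  (forall a u v, L (a *: u + v) = a * L u + L v) -> (forall u, sqn (L u) <= K * N u) ->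
  (forall a b, a <= b -> L (istep a b) = 0) -> L u = 0.
Proof.
move=> lL LK L0; have K0 : 0 <= K \/ N u = 0.
  have [|K0] := leP 0 K; [by left|right].
  apply/eqP; rewrite eq_le N_ge0// andbT -(nmulr_rge0 _ K0) (le_trans _ (LK u))//.
  exact: sqn_ge0.
have Lz : L 0 = 0 by have := lL (-1) 0 0; rewrite scaler0 addr0 mulN1r addNr.
have [K_ge0|u0] := K0; last first.
  by apply: sqn_eq0; apply/eqP; rewrite eq_le sqn_ge0 andbT (le_trans (LK u))// u0 mulr0.
have Ls v : step_fun v -> L v = 0.
  move=> [s ->]; elim: s => [|p s IH]; first by rewrite big_nil.
  by rewrite big_cons lL IH addr0 istep_max L0 ?le_max ?lexx// mulr0.
apply: sqn_eq0; apply/eqP; rewrite eq_le sqn_ge0 andbT; apply/ler_addgt0Pr => e e0.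
have [|v Sv uv] := step_fun_dense u (e := e / (K + 1)).
  by rewrite divr_gt0// ltr_wpDl.
have -> : L u = L (u - v).
  by have := lL 1 (u - v) v; rewrite scale1r subrK mul1r (Ls v Sv) addr0.
rewrite add0r; apply: le_trans (LK _) _.
apply: (@le_trans _ _ ((K + 1) * N (u - v))).
  by rewrite ler_wpM2r ?N_ge0// lerDl.
by rewrite mulrC -ler_pdivlMr// ltr_wpDl.
Qed.

(** The difference [L] of the two sides is bounded in each variable and antisymmetric under their
    exchange, so density of step functions can be used for one variable and then for the other. *)
Lemma bil_fourier u v : bil (F u) v = bil u (F v).
Proof.
have NF w : N (F w) = kap * N w by rewrite /N Fdot RemulrC.
have sqnB_le (z w : C) : sqn (z - w) <= 2 * sqn z + 2 * sqn w.
  by apply: le_trans (sqnD_le _ _) _; rewrite sqnN.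
have linD (a x y z w : C) : a * x + y - (a * z + w) = a * (x - z) + (y - w) by ring.
have le4 (x y n k m : R) : x <= k * n * m -> y <= n * (k * m) -> 2 * x + 2 * y <= 4 * (k * m) * n.
  by move=> hx hy; lra.
pose L w x := bil (F x) w - bil x (F w).
have lL w a x y : L w (a *: x + y) = a * L w x + L w y.
  by rewrite /L lF !bil_lin linD.
have Lle w x : sqn (L w x) <= 4 * (kap * N w) * N x.
  by apply: le_trans (sqnB_le _ _) _; apply: le4; rewrite -NF; exact: bil_le.
have Lsym w x : L w x = - L x w.
  by rewrite /L [RHS]opprB (bilC (F x) w) (bilC x (F w)).
have L0 c d w : c <= d -> L (istep c d) w = 0.
  move=> cd; apply: (linear_form_eq0 w (lL _) (Lle _)) => a b ab.
  by rewrite /L (bil_fourier_istep ab cd) subrr.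
have : L v u = 0.
  apply: (linear_form_eq0 u (lL _) (Lle _)) => a b ab.
  by rewrite Lsym (L0 _ _ _ ab) oppr0.
by move/eqP; rewrite subr_eq0 => /eqP.
Qed.

Lemma isometry_conjL2 u : F (conjL2 (F u)) = kap%:C *: conjL2 u.
Proof.
apply: (dot_inj ip) => w; rewrite -[w]conjL2K -/(bil _ (conjL2 w)) bil_fourier.
rewrite bilC /bil conjL2K Fdot (dotZl ip); congr (_ * _).
by rewrite dot_conjL2 conjL2K -(dotC ip).
Qed.

Lemma isometry_surj v : exists u, F u = v.
Proof.
exists (kap^-1%:C *: conjL2 (F (conjL2 v))).
rewrite (linear_funZ lF) isometry_conjL2 conjL2K scalerA -rmorphM mulVf ?scale1r//.
by rewrite gt_eqF// plancherel_const_gt0.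
Qed.

Lemma isometry_inj : injective F.
Proof.
move=> u v uv; apply/eqP; rewrite -subr_eq0; apply/eqP/(N_eq0 ip).
have : N (F (u - v)) = 0 by rewrite (linear_funB lF) uv subrr (N0 ip).
rewrite /N Fdot RemulrC => /eqP; rewrite mulf_eq0 gt_eqF ?plancherel_const_gt0//=.
by move/eqP.
Qed.

End FourierInversion.

Section InverseFourier.
Variable R : realType.
Local Notation L2 := (L2 R).
Implicit Types u v : L2.

Lemma inv_fourierK u : fourier (inv_fourier u) = u.
Proof.
have [lF FE Fdot _ _] := fourierP R; have [w wu] := isometry_surj lF FE Fdot u.
exact: (@xgetPex _ 0 [set v : L2 | fourier v = u] (ex_intro _ w wu)).
Qed.

Lemma fourier_freq_proj (E : set R) u : fourier (freq_proj E u) = time_proj E (fourier u).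
Proof. exact: inv_fourierK. Qed.

End InverseFourier.

(** * Time-frequency localization *)

Section FrequencyProjection.
Variable R : realType.
Local Notation C := R[i].
Local Notation mu := (@lebesgue_measure R).
Local Notation RM := (measurableTypeR R).
Local Notation L2 := (L2 R).
Local Notation dot := (@dotL2 R).
Local Notation N := (N dot).
Local Notation kap := (plancherel_const R).
Local Notation P := (@time_proj R).
Implicit Types (u v w : L2) (D : set RM) (xi : R) (A B E : set R).
Let ip := @dotL2_inner_product R.
Variables (F : L2 -> L2) (Q : set R -> L2 -> L2).
Hypothesis lF : linear F.
Hypothesis Fdot : forall u v, dot (F u) (F v) = kap%:C * dot u v.
Hypothesis mFI : forall n u, cmeasurable (fourier_integral (@trunc R n) (L2_fun u)).
Hypothesis FIE : forall n u, {ae mu, forall xi,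
  fourier_integral (@trunc R n) (L2_fun u) xi = L2_fun (F (P (@trunc R n) u)) xi}.
Hypothesis QF : forall E u, F (Q E u) = P E (F u).

Let injF : injective F. Proof. exact: isometry_inj lF Fdot. Qed.
Let kap0 : kap != 0. Proof. by rewrite gt_eqF// plancherel_const_gt0. Qed.

Lemma Q_linear E : lebesgue_measurable E -> linear (Q E).
Proof. by move=> mE a u v; apply: injF; rewrite QF lF time_proj_linear// lF !QF. Qed.

Lemma dot_Q E u w : kap%:C * dot (Q E u) w = dot (P E (F u)) (F w).
Proof. by rewrite -Fdot QF. Qed.

Lemma Q_orth E : lebesgue_measurable E -> orth_projection dot (Q E).
Proof.
move=> mE; split; first exact: Q_linear.
  by move=> u; apply: injF; rewrite !QF time_proj_idem.
move=> u v; have kC : kap%:C != 0 :> C by rewrite eq_complex/= (negbTE kap0).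
by apply: (mulfI kC); rewrite dot_Q time_proj_sym// -QF Fdot.
Qed.

Lemma Q_bigcup (K : nat) E (E_ : 'I_K -> set R) :
  lebesgue_measurable E -> (forall i, lebesgue_measurable (E_ i)) ->
  trivIset setT E_ -> E = \bigcup_i E_ i ->
  forall u, Q E u = \sum_(i < K) Q (E_ i) u.
Proof.
move=> mE mE_ tE EE u; apply: injF.
rewrite QF (time_proj_bigcup mE mE_ tE EE) (linear_fun_sum lF).
by apply: eq_bigr => i _; rewrite QF.
Qed.

Lemma Q_null E : lebesgue_measurable E -> completed_lebesgue_measure E = 0%E ->
  forall u, Q E u = 0.
Proof.
by move=> mE E0 u; apply: injF; rewrite QF time_proj_null// (linear_fun0 lF).
Qed.

Lemma N_Q E u : N (Q E u) = kap^-1 * N (P E (F u)).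
Proof.
have -> : N (P E (F u)) = kap * N (Q E u) by rewrite -QF /N Fdot RemulrC.
by rewrite mulrA mulVf// mul1r.
Qed.

Lemma N_time_proj_wave A (A' : set RM) n xi : lebesgue_measurable A -> measurable A' ->
  (mu A' < +oo)%E -> {ae mu, forall x, \1_A x = \1_A' x :> R} ->
  N (P A (wave (@trunc R n) xi)) <= fine (mu A').
Proof.
move=> mA mA' fA AA'; set w := wave _ _.
pose g x := (\1_A' x)%:C * ((\1_(@trunc R n) x)%:C * cis (2 * trigo.pi * x * xi)).
have mg : cmeasurable g.
  by apply: cmeasurableM; [exact: cmeasurable_indic|exact: cmeasurable_wave (measurable_trunc n)].
have wg : {ae mu, forall x, L2_fun (P A w) x = g x}.
  apply: ae_eqT (time_projE mA w) _.
  apply: aeS2 AA' (toL2_sqint (wave_sqint xi (measurable_trunc n) (@trunc_lty R n))) => x -> ->.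
  by [].
rewrite -lee_fin (NL2_ae mg wg) fineK ?ge0_fin_numE// -energy_indic//.
apply: le_energy => //; first exact: cmeasurable_indic.
move=> x; rewrite /g sqnM sqnM sqn_cis mulr1 ler_piMr ?sqn_ge0// sqn_real indicE.
by case: (_ \in _); rewrite ?expr1n ?expr0n.
Qed.

(** Truncation to [trunc m] makes the transform an integral at every xi, so that Bessel's inequality
    applies at fixed xi to the single vector [P A (wave _ xi)]. The bound does not depend on m and
    survives the limit in [localization_trace_bounded]. *)
Lemma orthonormal_trunc_le A A' B B' n m (e : nat -> L2) :
  lebesgue_measurable A -> measurable A' -> (mu A' < +oo)%E ->
  {ae mu, forall x, \1_A x = \1_A' x :> R} ->
  lebesgue_measurable B -> measurable B' -> (mu B' < +oo)%E ->
  {ae mu, forall x, \1_B x = \1_B' x :> R} ->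
  orthonormal_family dot n e ->
  \sum_(i < n) N (P B (F (P (@trunc R m) (P A (e i))))) <= fine (mu A') * fine (mu B').
Proof.
move=> mA mA' fA AA' mB mB' fB BB' on.
pose g i xi := (\1_B' xi)%:C * fourier_integral (@trunc R m) (L2_fun (P A (e i))) xi.
have mg i : cmeasurable (g i) by apply: cmeasurableM; [exact: cmeasurable_indic|exact: mFI].
have gE i : (N (P B (F (P (@trunc R m) (P A (e i))))))%:E = energy (g i).
  apply: NL2_ae => //; apply: ae_eqT (time_projE mB _) _.
  by apply: aeS2 BB' (FIE m (P A (e i))) => x h1 h2; rewrite /g h1 h2.
rewrite -lee_fin -sumEFin (eq_bigr (fun i : 'I_n => energy (g i))); last by move=> i _; exact: gE.
rewrite -ge0_integral_sum//; last 2 first.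
- by move=> i; apply/measurable_EFinP; exact: cmeasurable_sqn.
- by move=> i x _; rewrite lee_fin sqn_ge0.
apply: (@le_trans _ _ (\int[mu]_x ((fine (mu A'))%:E * (\1_B' x)%:E))%E).
  apply: ge0_le_integral => //.
  - by move=> x _; apply: sume_ge0 => i _; rewrite lee_fin sqn_ge0.
  - by apply: emeasurable_sum => i; apply/measurable_EFinP; exact: cmeasurable_sqn.
  - by apply/measurable_EFinP; apply: measurable_funM.
  move=> xi _; rewrite sumEFin lee_fin.
  have -> : \sum_(i < n) sqn (g i xi) =
      \1_B' xi * \sum_(i < n) sqn (dot (P A (wave (@trunc R m) xi)) (e i)).
    rewrite mulr_sumr; apply: eq_bigr => i _; rewrite /g sqnM sqn_real.
    rewrite (fourier_integralE _ _ (measurable_trunc m) (@trunc_lty R m)) time_proj_sym//.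
    rewrite -sqnJ -(dotC ip); congr (_ * _).
    by rewrite indicE; case: (_ \in _); rewrite ?expr1n ?expr0n.
  rewrite mulrC ler_wpM2r//.
  exact: le_trans (bessel ip _ on) (N_time_proj_wave m xi mA mA' fA AA').
rewrite ge0_integralZl//; last 2 first.
- by apply/measurable_EFinP.
- by rewrite lee_fin fine_ge0.
by rewrite integral_indic// setIT EFinM lee_wpmul2l ?lee_fin ?fine_ge0// fineK// ge0_fin_numE.
Qed.

Lemma cvgH_F s u : cvgH dot s u -> cvgH dot (fun n => F (s n)) (F u).
Proof. exact: (cvgH_isometry lF Fdot). Qed.

Lemma cvgH_P E s u : lebesgue_measurable E -> cvgH dot s u ->
  cvgH dot (fun n => P E (s n)) (P E u).
Proof.
move=> mE su; apply: (cvgH_le (c := 1) ip su) => n.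
rewrite -(linear_funB (time_proj_linear mE)) mul1r.
exact: (orth_projection_le ip _ (time_proj_orth mE)).
Qed.

Lemma localization_trace_bounded A B :
  lebesgue_measurable A -> (completed_lebesgue_measure A < +oo)%E ->
  lebesgue_measurable B -> (completed_lebesgue_measure B < +oo)%E ->
  exists tau, trace_bounded dot (fun u => P A (Q B (P A u))) tau.
Proof.
move=> mA fA mB fB.
have [A' [mA' lA AA']] := lebesgue_measurable_borel mA.
have [B' [mB' lB BB']] := lebesgue_measurable_borel mB.
have {}fA := le_lt_trans lA fA; have {}fB := le_lt_trans lB fB.
exists (kap^-1 * (fine (mu A') * fine (mu B'))) => n e on.
have -> : \sum_(i < n) complex.Re (dot (P A (Q B (P A (e i)))) (e i)) =
    kap^-1 * \sum_(i < n) N (P B (F (P A (e i)))).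
  rewrite mulr_sumr; apply: eq_bigr => i _; rewrite -N_Q.
  have [_ QQ Qs] := Q_orth mB.
  by rewrite time_proj_sym// -{1}QQ Qs.
rewrite ler_pM2l ?invr_gt0 ?plancherel_const_gt0//.
have cv : \sum_(i < n) N (P B (F (P (@trunc R m) (P A (e i))))) @[m --> \oo] -->
    \sum_(i < n) N (P B (F (P A (e i)))).
  apply: cvg_big => [|i _].
    exact: add_continuous.
  by apply: (cvgH_N ip); apply: cvgH_P => //; apply: cvgH_F; exact: cvgH_trunc.
rewrite -(cvg_lim (@Rhausdorff R) cv); apply: limr_le; first by apply/cvg_ex; eexists; exact: cv.
by apply: nearW => m; exact: orthonormal_trunc_le.
Qed.

Lemma localization_spectral_measure A B :
  lebesgue_measurable A -> (completed_lebesgue_measure A < +oo)%E ->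
  lebesgue_measurable B -> (completed_lebesgue_measure B < +oo)%E ->
  exists S, is_spectral_measure dot (fun u => P A (Q B (P A u))) S.
Proof.
move=> mA fA mB fB; have [tau tr] := localization_trace_bounded mA fA mB fB.
have lP := time_proj_linear mA; have [lQ QQ Qs] := Q_orth mB.
apply: (trace_class_spectral_measure ip (@L2_complete R) _ _ _ tr).
- by move=> a u v; rewrite lP lQ lP.
- by move=> u v; rewrite time_proj_sym// Qs time_proj_sym.
- move=> u; rewrite time_proj_sym// -QQ Qs.
  exact: (N_ge0 ip).
Qed.

End FrequencyProjection.

(** * The defect of P Q P for two orthogonal projections *)

Section Defect.
Variables (R : realType) (V : lmodType R[i]) (dot : V -> V -> R[i]).
Local Notation N := (N dot).
Local Notation nrm := (nrm dot).
Local Notation defect T u := (complex.Re (dot (T u) u) - N (T u)).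
Hypothesis ip : inner_product dot.

Definition localization (P Q : V -> V) (u : V) : V := P (Q (P u)).

Lemma localization_linear P Q : linear P -> linear Q -> linear (localization P Q).
Proof. by move=> lP lQ a u v; rewrite /localization lP lQ lP. Qed.

Lemma localization_sym P Q : orth_projection dot P -> orth_projection dot Q ->
  forall u v, dot (localization P Q u) v = dot u (localization P Q v).
Proof. by move=> [_ _ sP] [_ _ sQ] u v; rewrite /localization sP sQ sP. Qed.

Lemma N_orth_compl P w : orth_projection dot P -> N (w - P w) = N w - N (P w).
Proof.
move=> [_ PP sP]; rewrite (NB ip) -(Re_dotC ip) sP -{2}(PP w) -sP.
by rewrite -[complex.Re _]/(N (P w)); lra.
Qed.

(** <T u, u> = |Q P u|^2 and |T u|^2 = |P Q P u|^2, so Pythagoras applies to the vector Q P u. *)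
Lemma defect_localization P Q u : orth_projection dot P -> orth_projection dot Q ->
  defect (localization P Q) u = N (Q (P u) - P (Q (P u))).
Proof.
move=> oP [_ QQ sQ]; rewrite (N_orth_compl _ oP); case: oP => _ _ sP.
by rewrite /localization sP -{1}QQ sQ.
Qed.

Lemma sqrt_defect_subadditive (I J : finType) (p : pred I) (q : pred J)
    (P Q : V -> V) (P_ : I -> V -> V) (Q_ : J -> V -> V) u :
  orth_projection dot P -> orth_projection dot Q ->
  (forall i, orth_projection dot (P_ i)) -> (forall j, orth_projection dot (Q_ j)) ->
  (forall u, P u = \sum_i P_ i u) -> (forall u, Q u = \sum_j Q_ j u) ->
  (forall i u, P_ i (P u) = P_ i u) ->
  (forall i u, ~~ p i -> P_ i u = 0) -> (forall j u, ~~ q j -> Q_ j u = 0) ->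
  Num.sqrt (defect (localization P Q) u) <=
  \sum_(k | p k.1 && q k.2) Num.sqrt (defect (localization (P_ k.1) (Q_ k.2)) u).
Proof.
move=> oP oQ oP_ oQ_ PE QE PP_ P0 Q0; rewrite defect_localization// -/(nrm _).
have lin T : orth_projection dot T -> linear T by case.
have lP := lin _ oP; have lQ_ j := lin _ (oQ_ j).
have -> : Q (P u) - P (Q (P u)) =
    \sum_(k | p k.1 && q k.2) (Q_ k.2 (P_ k.1 u) - P (Q_ k.2 (P_ k.1 u))).
  rewrite sumrB -(linear_fun_sum lP).
  suff -> : Q (P u) = \sum_(k | p k.1 && q k.2) Q_ k.2 (P_ k.1 u) by [].
  rewrite QE (eq_bigr (fun j => \sum_(i | p i) Q_ j (P_ i u))); last first.
    move=> j _; rewrite PE (linear_fun_sum (lQ_ j)) (bigID p)/= [X in _ + X]big1 ?addr0// => i pi.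
    by rewrite P0// (linear_fun0 (lQ_ j)).
  rewrite (bigID q)/= [X in _ + X]big1 ?addr0; last first.
    by move=> j qj; rewrite big1// => i _; rewrite Q0.
  by rewrite exchange_big/= pair_big.
apply: le_trans (nrm_sum ip _ _ _) _; apply: ler_sum => -[i j] /= _.
apply: ler_wsqrtr; rewrite (defect_localization _ (oP_ i) (oQ_ j)).
(* The local defect involves 1 - P_i instead of 1 - P, which only increases the norm: |P_i w| = |P_i
   P w| <= |P w|. *)
set w := Q_ j (P_ i u); rewrite (N_orth_compl _ oP) (N_orth_compl _ (oP_ i)).
by rewrite lerD2l lerN2 -PP_; exact: orth_projection_le.
Qed.

End Defect.

Lemma lebesgue_outer_le (R : realType) (A B : set R) : A `<=` B ->
  (lebesgue_measure A <= completed_lebesgue_measure B)%E.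
Proof. by move=> AB; apply: le_outer_measure; exact: AB. Qed.

Section Scaling.
Variable R : realType.
Local Notation mu := (@lebesgue_measure R).
Local Notation RM := (measurableTypeR R).
Variable c : R.
Hypothesis c0 : 0 < c.
Local Notation scale E := [set (c * x)%R | x in E].

Lemma scale_preimage (E : set R) : scale E = (fun x => c^-1 * x) @^-1` E.
Proof.
apply/seteqP; split => [_ [x Ex <-]|x Ex] /=; first by rewrite mulKf ?gt_eqF.
by exists (c^-1 * x) => //; rewrite mulVKf// gt_eqF.
Qed.

Let scale_measurable (D : set RM) : measurable D -> measurable (scale D : set RM).
Proof.
move=> mD; rewrite scale_preimage -[X in measurable X]setTI.
have mf : measurable_fun [set: RM] (fun x : RM => (c^-1 * x : RM)) by exact: measurable_funM.
exact: mf.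
Qed.

Let mu_scale (D : set RM) : measurable D -> mu (scale D) = (c%:E * mu D)%E.
Proof.
move=> mD; rewrite (lebesgue_measure_scale c0 (scale_measurable mD)); congr (_ * mu _)%E.
apply/seteqP; split => x /= => [[y Dy /(mulfI (lt0r_neq0 c0)) <-]|Dx] //.
by exists x.
Qed.

(** The upper bound carries finiteness and nullity of a window over to its dilate. *)
Lemma lebesgue_measurable_scale (E : set R) : lebesgue_measurable E ->
  lebesgue_measurable (scale E) /\
  (completed_lebesgue_measure (scale E) <= c%:E * completed_lebesgue_measure E)%E.
Proof.
rewrite /lebesgue_measurable -!completed_caratheodory_measurable.
rewrite !g_sigma_completed_algebra_genE => -[D mD [M [A [mA A0 MA]] <-]].
have cU : scale (D `|` M) = scale D `|` scale M by rewrite image_setU.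
have mcD := scale_measurable mD; have mcA := scale_measurable mA.
have A0' : mu (scale A) = 0%E by rewrite mu_scale// [X in (_ * X)%E](_ : _ = 0%E) ?mule0.
split.
  rewrite cU; exists (scale D) => //; exists (scale M) => //.
  by exists (scale A); split => //; exact: image_subset.
apply: (@le_trans _ _ (mu (scale D `|` scale A))).
  have H : scale (D `|` M) `<=` scale D `|` scale A.
    by rewrite cU; apply: setUS; exact: image_subset.
  exact: (lebesgue_outer_le H).
apply: (@le_trans _ _ (mu (scale D) + mu (scale A))%E); first exact: measureU2.
rewrite A0' adde0 mu_scale//; apply: lee_wpmul2l; first by rewrite lee_fin ltW.
exact: (lebesgue_outer_le (@subsetUl _ D M)).
Qed.

Lemma scale_bigcup (K : nat) (E_ : 'I_K -> set R) :
  scale (\bigcup_i E_ i) = \bigcup_i scale (E_ i).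
Proof. by rewrite image_bigcup. Qed.

Lemma scale_trivIset (K : nat) (E_ : 'I_K -> set R) : trivIset setT E_ ->
  trivIset setT (fun i => scale (E_ i)).
Proof.
move=> tE i j _ _ [x [[y Ey <-] [z Ez /(mulfI (lt0r_neq0 c0)) zy]]].
by apply: tE => //; exists y; split => //; rewrite -zy.
Qed.

End Scaling.

Section Main.
Variable R : realType.
Local Notation L2 := (L2 R).
Local Notation dot := (@dotL2 R).
Implicit Types (A B : set R).
Let ip := @dotL2_inner_product R.

Lemma completed_measure_le A B : A `<=` B ->
  (completed_lebesgue_measure A <= completed_lebesgue_measure B :> \bar R)%E.
Proof. by move=> AB; exact: lebesgue_outer_le. Qed.

(** [spectral_proj] makes one choice of spectral measure for all Borel sets at once, so a single
    existence proof makes it a spectral measure. *)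
Lemma spectral_projP (T : L2 -> L2) : (exists S, is_spectral_measure dot T S) ->
  is_spectral_measure dot T (spectral_proj dot T).
Proof. by move=> [S TS]; exact: (@xgetPex _ _ (is_spectral_measure dot T) (ex_intro _ S TS)). Qed.

Lemma freq_proj_orth B : lebesgue_measurable B -> orth_projection dot (@freq_proj R B).
Proof.
by have [lF _ Fdot _ _] := fourierP R; exact: (Q_orth lF Fdot (@fourier_freq_proj R)).
Qed.

Lemma freq_proj_bigcup (K : nat) B (B_ : 'I_K -> set R) :
  lebesgue_measurable B -> (forall i, lebesgue_measurable (B_ i)) ->
  trivIset setT B_ -> B = \bigcup_i B_ i ->
  forall u, freq_proj B u = \sum_(i < K) freq_proj (B_ i) u.
Proof.
have [lF _ Fdot _ _] := fourierP R; exact: (Q_bigcup lF Fdot (@fourier_freq_proj R)).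
Qed.

Lemma freq_proj_null B : lebesgue_measurable B -> completed_lebesgue_measure B = 0%E ->
  forall u, freq_proj B u = 0.
Proof.
have [lF _ Fdot _ _] := fourierP R; exact: (Q_null lF Fdot (@fourier_freq_proj R)).
Qed.

Lemma localization_spectralP A B :
  lebesgue_measurable A -> (completed_lebesgue_measure A < +oo)%E ->
  lebesgue_measurable B -> (completed_lebesgue_measure B < +oo)%E ->
  let T := localization (@time_proj R A) (@freq_proj R B) in
  is_spectral_measure dot T (spectral_proj dot T).
Proof.
move=> mA fA mB fB; apply: spectral_projP; have [lF _ Fdot mFI FIE] := fourierP R.
exact: (localization_spectral_measure lF Fdot mFI FIE (@fourier_freq_proj R)).
Qed.

Lemma time_proj_sub A B : lebesgue_measurable A -> lebesgue_measurable B -> A `<=` B ->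
  forall u : L2, time_proj A (time_proj B u) = time_proj A u.
Proof.
move=> mA mB AB u; apply: L2_funP.
apply: ae_eqT (time_projE mA _) _.
apply: aeS2 (time_projE mB u) (time_projE mA u) => x -> ->.
rewrite !indicE; case: (boolP (x \in A)) => [/set_mem/AB Bx|_]; last by rewrite !mul0r.
by rewrite (mem_set Bx) !mul1r.
Qed.

End Main.

Close Scope complex_scope.

Theorem theorem5p6 (R : realType) (c : R) (A B : set R) (M K : nat)
    (A_ : 'I_M -> set R) (B_ : 'I_K -> set R)
    (eps : R) (eps_ : 'I_M -> 'I_K -> R) :
  0 < c ->
  lebesgue_measurable A -> (completed_lebesgue_measure A < +oo)%E ->
  lebesgue_measurable B -> (completed_lebesgue_measure B < +oo)%E ->
  (forall i, lebesgue_measurable (A_ i)) -> trivIset setT A_ -> A = \bigcup_i A_ i ->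
  (forall j, lebesgue_measurable (B_ j)) -> trivIset setT B_ -> B = \bigcup_j B_ j ->
  0 < eps < 1 / 2 ->
  (forall i j, completed_lebesgue_measure (A_ i) != 0%E ->
     completed_lebesgue_measure (B_ j) != 0%E -> 0 < eps_ i j < 1 / 2) ->
  \sum_(i < M | completed_lebesgue_measure (A_ i) != 0%E)
    \sum_(j < K | completed_lebesgue_measure (B_ j) != 0%E)
      Num.sqrt (eps_ i j * (1 - eps_ i j))
    <= Num.sqrt (eps * (1 - eps)) ->
  (Lambda eps A [set (c * x)%R | x in B] <=
   \sum_(i < M | completed_lebesgue_measure (A_ i) != 0%E)
     \sum_(j < K | completed_lebesgue_measure (B_ j) != 0%E)
       Lambda (eps_ i j) (A_ i) [set (c * x)%R | x in B_ j])%E.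
Proof.
move=> c0 mA fA mB fB mA_ tA AE mB_ tB BE eps0 eps_0 sum_le.
pose p i := completed_lebesgue_measure (A_ i) != 0%E.
pose q j := completed_lebesgue_measure (B_ j) != 0%E.
pose D := [set (c * x)%R | x in B]; pose D_ j := [set (c * x)%R | x in B_ j].
have sA i : A_ i `<=` A by move=> x Ax; rewrite AE; exists i.
have sB j : B_ j `<=` B by move=> x Bx; rewrite BE; exists j.
have fA_ i : (completed_lebesgue_measure (A_ i) < +oo)%E.
  exact: le_lt_trans (completed_measure_le (sA i)) fA.
have fB_ j : (completed_lebesgue_measure (B_ j) < +oo)%E.
  exact: le_lt_trans (completed_measure_le (sB j)) fB.
have fin_scale (E : set R) : lebesgue_measurable E ->
    (completed_lebesgue_measure E < +oo)%E ->
    (completed_lebesgue_measure [set (c * x)%R | x in E] < +oo)%E.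
  move=> mE fE; apply: le_lt_trans (lebesgue_measurable_scale c0 mE).2 _.
  by apply: lte_mul_pinfty => //; rewrite lee_fin ltW.
have [mD _] := lebesgue_measurable_scale c0 mB.
have mD_ j : lebesgue_measurable (D_ j) by have [] := lebesgue_measurable_scale c0 (mB_ j).
have fD : (completed_lebesgue_measure D < +oo)%E by exact: fin_scale.
have fD_ j : (completed_lebesgue_measure (D_ j) < +oo)%E by exact: fin_scale.
have tD : trivIset setT D_ by exact: scale_trivIset.
have DE : D = \bigcup_j D_ j by rewrite /D BE scale_bigcup.
have P0 i u : ~~ p i -> time_proj (A_ i) u = 0 :> L2 R.
  by rewrite negbK => /eqP A0; exact: time_proj_null.
(* The statement discards pieces by the nullity of [B_ j], whereas the projection is that of the
   dilated piece. *)
have Q0 j u : ~~ q j -> freq_proj (D_ j) u = 0.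
  rewrite negbK => /eqP B0; apply: freq_proj_null => //.
  apply/eqP; rewrite eq_le measure_ge0 andbT.
  by have [_] := lebesgue_measurable_scale c0 (mB_ j); rewrite B0 mule0.
(* A single sum over pairs of nonnull pieces is the form taken by the dimension count. *)
rewrite /Lambda pair_big/=.
have oA := time_proj_orth mA; have oA_ i := time_proj_orth (mA_ i).
have oD := freq_proj_orth mD; have oD_ j := freq_proj_orth (mD_ j).
apply: (@rank_spectral_measure_le R (L2 R) (@dotL2 R) (dotL2_inner_product R)
  ('I_M * 'I_K)%type (fun k => p k.1 && q k.2)
  (localization (time_proj A) (freq_proj D)) _ eps
  (fun k => localization (time_proj (A_ k.1)) (freq_proj (D_ k.2)))
  (fun k => spectral_proj (@dotL2 R) (localization (time_proj (A_ k.1)) (freq_proj (D_ k.2))))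
  (fun k => eps_ k.1 k.2)).
- by apply: localization_linear; [case: oA|case: oD].
- exact: (localization_sym oA oD).
- by move=> k _; apply: localization_linear; [case: (oA_ k.1)|case: (oD_ k.2)].
- move=> k _; exact: (localization_sym (oA_ k.1) (oD_ k.2)).
- exact: (localization_spectralP mA fA mD fD).
- move=> k _; exact: (localization_spectralP (mA_ k.1) (fA_ k.1) (mD_ k.2) (fD_ k.2)).
- by [].
- by move=> k /andP[]; exact: eps_0.
- move=> u; apply: (@sqrt_defect_subadditive R (L2 R) (@dotL2 R) (dotL2_inner_product R)
    'I_M 'I_K p q (time_proj A) (freq_proj D)
    (fun i => time_proj (A_ i)) (fun j => freq_proj (D_ j)) u oA oD oA_ oD_).
  + exact: (time_proj_bigcup mA mA_ tA AE).
  + exact: (freq_proj_bigcup mD mD_ tD DE).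
  + move=> i v; exact: (time_proj_sub (mA_ i) mA (sA i)).
  + move=> i v; exact: P0.
  + move=> j v; exact: Q0.
- by move: sum_le; rewrite pair_big.
Qed.
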